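(* Let $(M,\pi_M,E_M)$ be a holomorphic Jacobi manifold which is not a contact manifold. Then $(M,\pi_M,E_M)$ does not admit a semi-connected (holomorphic) contact resolution.
   Context: Manifolds, structures and maps are holomorphic (complex manifolds, holomorphic bivector fields and vector fields), dimensions are complex dimensions, and all manifolds, including the sources of resolutions, are assumed separable (second countable). A Jacobi structure on a manifold $M$ is a pair $(\pi_M,E_M)$ of a bivector field and a vector field such that $[\pi_M,\pi_M]=2E_M\wedge\pi_M$ and $[E_M,\pi_M]=0$, with the sign of the Schouten bracket normalized so that this is equivalent to the Jacobi identity for $\{f,g\}=\pi_M(df,dg)+fE_M[g]-gE_M[f]$ on local functions. A contact manifold of dimension $2n+1$ is regarded as a manifold $\Sigma$ with a Jacobi structure $(\Pi_\Sigma,E_\Sigma)$ such that $E_\Sigma\wedge\Pi_\Sigma^n$ vanishes at no point. The singular locus of a Jacobi structure $(\pi_M,E_M)$ in dimension $2n+1$ is the set of points of $M$ where $E_M\wedge\pi_M^n=0$. A Jacobi morphism $\varphi:\Sigma\to M$ is a map projecting $\Pi_\Sigma$ and $E_\Sigma$ onto $\pi_M$ and $E_M$, i.e. $\wedge^2T_\sigma\varphi(\Pi_\Sigma|_\sigma)=\pi_M|_{\varphi(\sigma)}$ and $T_\sigma\varphi(E_\Sigma|_\sigma)=E_M|_{\varphi(\sigma)}$ for all $\sigma\in\Sigma$. A contact resolution of a Jacobi manifold $M$ is a contact manifold $\Sigma$ of the same dimension together with a surjective Jacobi morphism $\varphi:\Sigma\to M$; it is semi-connected if no connected component of $\Sigma$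 is mapped by $\varphi$ into the singular locus of $(\pi_M,E_M)$. *)

(* Defs.v *)
From HB Require Import structures.
From mathcomp Require Import all_boot all_order all_algebra.
From mathcomp Require Import complex.
From mathcomp Require Import all_classical all_reals all_analysis.

Set Implicit Arguments.
Unset Strict Implicit.
Unset Printing Implicit Defensive.

Import Order.TTheory GRing.Theory Num.Theory numFieldNormedType.Exports.

Local Open Scope classical_set_scope.
Local Open Scope ring_scope.

(* The complex numbers. Being declared as a closed field, C R carries the norm
   topology and is a normed module over itself, whereas the head constant of
   R[i] has no topology attached to it. *)
Definition C (R : realType) : numClosedFieldType := R[i].

(* The exterior algebra of K^d: a S is the coefficient of a on the basis
   multivector e_(i1) /\ ... /\ e_(ik), where S = {i1 < ... < ik}. *)
Notation extalg K d := {ffun {set 'I_d} -> K}.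

Section ExteriorAlgebra.
Variable K : comNzRingType.
Local Notation ext d := (extalg K d).

Definition inversions (d : nat) (A B : {set 'I_d}) : nat :=
  #|[set p : 'I_d * 'I_d | [&& p.1 \in A, p.2 \in B & (p.2 < p.1)%N]]|.

Definition wedge (d : nat) (a b : ext d) : ext d :=
  [ffun S : {set 'I_d} => \sum_(A : {set 'I_d} | A \subset S)
     (-1) ^+ inversions A (S :\: A) * a A * b (S :\: A)].

Definition ext1 (d : nat) : ext d := [ffun S => (S == finset.set0)%:R].

Definition ext_pow (d : nat) (a : ext d) (n : nat) : ext d :=
  iter n (wedge a) (ext1 d).

Definition ext_vec (d : nat) (v : 'rV[K]_d) : ext d :=
  [ffun S : {set 'I_d} => \sum_(i < d | S == [set i]%SET) v 0 i].

(* The algebra morphism induced by the linear map v |-> v *m L; enum S lists S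
   in increasing order. *)
Definition ext_map (d e : nat) (L : 'M[K]_(d, e)) (a : ext d) : ext e :=
  [ffun T : {set 'I_e} => \sum_(S : {set 'I_d})
     a S * (\big[@wedge e / ext1 e]_(i <- enum S) ext_vec (row i L)) T].

(* Contraction with the i-th coordinate covector, i.e. the left derivative with
   respect to the i-th generator. *)
Definition contract (d : nat) (i : 'I_d) (a : ext d) : ext d :=
  [ffun S : {set 'I_d} =>
     if i \in S then 0
     else (-1) ^+ #|[set j in S | (j < i)%N]%SET| * a (i |: S)%SET].

Definition grade_inv (d : nat) (a : ext d) : ext d :=
  [ffun S : {set 'I_d} => (-1) ^+ #|S| * a S].

Definition ext_homogeneous (d k : nat) (a : ext d) : Prop :=
  forall S : {set 'I_d}, #|S| != k -> a S = 0.

End ExteriorAlgebra.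

Section LocalCalculus.
Variable R : realType.

(* Complex differentiability at each point of D; D is open in all uses. *)
Definition holomorphic_on (V W : normedModType (C R)) (D : set V) (f : V -> W)
  : Prop := forall y, D y -> differentiable f y.

Definition partial (d : nat) (i : 'I_d) (P : 'rV[C R]_d -> extalg (C R) d)
    (y : 'rV[C R]_d) : extalg (C R) d :=
  [ffun S : {set 'I_d} =>
     'D_(delta_mx 0 i) (fun z => P z S : C R) y].

(* The Schouten bracket in coordinates: for P homogeneous of degree p,
     [P, Q] = \sum_i ( iota_(dx_i) P /\ d_i Q
                       + (-1)^p d_i P /\ iota_(dx_i) Q ).
   It extends the Lie bracket of vector fields and [X, Q] is the Lie derivative
   of Q along X. For a bivector field P = 1/2 \sum P^(ij) e_i /\ e_j, [P, P] is
   -2 times the trivector field with components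
     \sum_i (P^(ai) d_i P^(bc) + P^(bi) d_i P^(ca) + P^(ci) d_i P^(ab)).
   This is the sign for which [P, P] = 2 E /\ P and [E, P] = 0 amount to the
   Jacobi identity of {f, g} = P(df, dg) + f E(g) - g E(f). *)
Definition schouten (d : nat) (P Q : 'rV[C R]_d -> extalg (C R) d)
    (y : 'rV[C R]_d) : extalg (C R) d :=
  \sum_(i < d) (wedge (contract i (P y)) (partial i Q y)
                + wedge (grade_inv (partial i P y)) (contract i (Q y))).

End LocalCalculus.

Section Manifolds.
Variable R : realType.

(* chart_inv is only meaningful on chart_cod. *)
Record chart (T : topologicalType) (d : nat) := Chart {
  chart_dom : set T ;
  chart_cod : set 'rV[C R]_d ;
  chart_map : T -> 'rV[C R]_d ;
  chart_inv : 'rV[C R]_d -> T ;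
  chart_dom_open : open chart_dom ;
  chart_cod_open : open chart_cod ;
  chart_map_cod : forall x, chart_dom x -> chart_cod (chart_map x) ;
  chart_inv_dom : forall y, chart_cod y -> chart_dom (chart_inv y) ;
  chart_mapK : forall x, chart_dom x -> chart_inv (chart_map x) = x ;
  chart_invK : forall y, chart_cod y -> chart_map (chart_inv y) = y ;
  chart_map_continuous : {within chart_dom, continuous chart_map} ;
  chart_inv_continuous : {within chart_cod, continuous chart_inv}
}.

(* The expression in charts of f : T -> U, and the set where it is defined. *)
Definition local_map (T U : topologicalType) (d e : nat) (c : chart T d)
    (c' : chart U e) (f : T -> U) : 'rV[C R]_d -> 'rV[C R]_e :=
  chart_map c' \o f \o chart_inv c.

Definition local_dom (T U : topologicalType) (d e : nat) (c : chart T d)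
    (c' : chart U e) (f : T -> U) : set 'rV[C R]_d :=
  [set y | chart_cod c y /\ chart_dom c' (f (chart_inv c y))].

Record complex_manifold (d : nat) := ComplexManifold {
  manifold_space :> topologicalType ;
  atlas : set (chart manifold_space d) ;
  manifold_hausdorff : hausdorff_space manifold_space ;
  manifold_second_countable : @second_countable manifold_space ;
  atlas_cover : forall x, exists2 c, atlas c & chart_dom c x ;
  atlas_holomorphic : forall c c', atlas c -> atlas c' ->
    holomorphic_on (local_dom c c' id) (local_map c c' id)
}.

Definition holomorphic_map (d e : nat) (M : complex_manifold d)
    (N : complex_manifold e) (f : M -> N) : Prop :=
  continuous f /\
  forall c c', atlas c -> atlas c' ->
    holomorphic_on (local_dom c c' f) (local_map c c' f).

(* Holomorphic multivector fields of degree k, given by their components in the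
   charts of the atlas. *)
Record mvfield (d : nat) (M : complex_manifold d) (k : nat) := MvField {
  comp : chart M d -> 'rV[C R]_d -> extalg (C R) d ;
  comp_homogeneous : forall c y, atlas c -> chart_cod c y ->
    ext_homogeneous k (comp c y) ;
  comp_holomorphic : forall c (S : {set 'I_d}), atlas c ->
    holomorphic_on (chart_cod c) (fun y => comp c y S : C R) ;
  comp_transition : forall c c' y, atlas c -> atlas c' ->
    local_dom c c' id y ->
    comp c' (local_map c c' id y) =
      ext_map (jacobian (local_map c c' id) y) (comp c y)
}.

(* The pointwise condition /\^k (T f) (P|_x) = Q|_(f x) for all x. *)
Definition projects_onto (d e k : nat) (M : complex_manifold d)
    (N : complex_manifold e) (f : M -> N) (P : mvfield M k) (Q : mvfield N k)
    : Prop :=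
  forall c c' y, atlas c -> atlas c' -> local_dom c c' f y ->
    ext_map (jacobian (local_map c c' f) y) (comp P c y) =
      comp Q c' (local_map c c' f y).

Record jacobi_manifold (d : nat) := JacobiManifold {
  jacobi_space :> complex_manifold d ;
  jacobi_pi : mvfield jacobi_space 2 ;
  jacobi_E : mvfield jacobi_space 1 ;
  jacobi_pi_pi : forall c y, atlas c -> chart_cod c y ->
    schouten (comp jacobi_pi c) (comp jacobi_pi c) y =
      wedge (comp jacobi_E c y) (comp jacobi_pi c y) *+ 2 ;
  jacobi_E_pi : forall c y, atlas c -> chart_cod c y ->
    schouten (comp jacobi_E c) (comp jacobi_pi c) y = 0
}.

(* In dimension d = 2n+1, with n = d./2: the points where E /\ pi^n vanishes.
   Meaningful only when d is odd. *)
Definition singular_locus (d : nat) (M : jacobi_manifold d) : set M :=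
  [set x | forall c, atlas c -> chart_dom c x ->
     wedge (comp (jacobi_E M) c (chart_map c x))
           (ext_pow (comp (jacobi_pi M) c (chart_map c x)) d./2) = 0].

Definition contact_manifold (d : nat) (M : jacobi_manifold d) : Prop :=
  odd d /\ forall x : M, ~ singular_locus x.

Definition jacobi_morphism (d e : nat) (M : jacobi_manifold d)
    (N : jacobi_manifold e) (f : M -> N) : Prop :=
  [/\ holomorphic_map f,
      projects_onto f (jacobi_pi M) (jacobi_pi N) &
      projects_onto f (jacobi_E M) (jacobi_E N)].

Definition contact_resolution (d : nat) (M S : jacobi_manifold d) (f : S -> M)
    : Prop :=
  [/\ contact_manifold S, jacobi_morphism f & forall x, exists s, f s = x].

Definition semi_connected (d : nat) (M S : jacobi_manifold d) (f : S -> M)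
    : Prop :=
  forall s : S,
    ~ (f @` connected_component setT s `<=` @singular_locus d M).

End Manifolds.

(* Main.v *)
From HB Require Import structures.
Require Import Defs.
From mathcomp Require Import all_boot all_order all_algebra.
From mathcomp Require Import complex ring lra.
From mathcomp Require Import all_classical all_reals all_analysis.

Set Implicit Arguments.
Unset Strict Implicit.
Unset Printing Implicit Defensive.

Import Order.TTheory GRing.Theory Num.Theory numFieldNormedType.Exports.

Local Open Scope classical_set_scope.
Local Open Scope ring_scope.

(** Let f : S -> M be a semi-connected contact resolution, and suppose that M
    has a singular point x0. In a chart around x0 let h be the top coefficient
    of E /\ pi^n, so that the singular locus is the hypersurface h = 0. As f is
    a Jacobi morphism between manifolds of the same dimension, h \o f is in
    charts the product of the Jacobian determinant of f and of the top
    coefficient on S, which vanishes nowhere ([ext_map_top]). Hence f is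
    degenerate at every point over the singular locus, and the contradiction
    is one of size: the image of the degenerate points is too small to contain
    the hypersurface h = 0.

    First, h \o f vanishes on no open set: the points near which it vanishes
    form an open and closed subset of S by the identity theorem ([flat_closed]),
    and semi-connectedness makes this set empty. In particular h does not
    vanish on any neighbourhood of x0, so there is a direction v along which it
    has a zero of finite order ([nonzero_direction]). Let P be a linear
    projection with kernel spanned by v. By Hurwitz's theorem ([hurwitz]) the
    zeros of h persist on the lines parallel to v, so that P maps the
    hypersurface onto a set that contains a ball.

    On the other hand, P maps f (h \o f = 0) to a meagre set
    ([degenerate_meagre]); since S is second countable this is a local matter.
    Let F = P \o f, whose target has one dimension less. The critical values of
    F form a meagre set by Sard's theorem ([sard]). Near a regular point there
    are coordinates (tau, s) in which F is (tau, s) |-> s. On each fibre of F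
    the map f moves along a line parallel to v, with a speed that is a multiple
    of its Jacobian determinant, hence of h \o f. So c = h \o f satisfies an
    equation c' = g c on the fibres, and a zero of c propagates along its fibre
    ([linear_ode]). The values s whose fibre meets the zero set therefore form
    a closed set, and this set has no interior because h \o f vanishes on no
    open set. By Baire's theorem ([baire_rV]) a meagre set contains no ball,
    whereas f is onto.

    The complex analysis is derived from differentiability alone. Goursat's
    lemma and Cauchy's formula are proved for Riemann sums along polygons; they
    show that the difference quotient of a holomorphic function is holomorphic,
    which gives Cauchy estimates, zeros of finite order and a maximum principle
    up to a constant. Statements in several variables are reduced to complex
    lines. *)

(** * The norm with values in the real field *)

Section RealNorm.
Variable R : realType.
Notation K := (C R).

Fact rn_key : unit. Proof. exact: tt. Qed.

(** The norm of a complex normed space takes values in [K], whose order is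
    partial; [rn] is the same number in the ordered field [R]. *)
Definition rn (V : normedModType K) (x : V) : R :=
  locked_with rn_key (complex.Re `|x|).

Definition RtoC (x : R) : K := Complex x 0.

Lemma normE (V : normedModType K) (x : V) : `|x| = RtoC (rn x).
Proof.
have := normr_ge0 x; rewrite /rn locked_withE /RtoC; case: (`|x|) => a b.
by rewrite /Order.le /= => /andP[/eqP -> _].
Qed.

Lemma RtoC_le a b : (RtoC a <= RtoC b) = (a <= b).
Proof. exact: lecR. Qed.

Lemma RtoC_lt a b : (RtoC a < RtoC b) = (a < b).
Proof. exact: ltcR. Qed.

Lemma RtoCD a b : RtoC (a + b) = RtoC a + RtoC b.
Proof. exact: (rmorphD (real_complex R)). Qed.

Lemma RtoCM a b : RtoC (a * b) = RtoC a * RtoC b.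
Proof. exact: (rmorphM (real_complex R)). Qed.

Lemma RtoC_inj : injective RtoC.
Proof. exact: complexI. Qed.

Lemma RtoC0 : RtoC 0 = 0. Proof. by []. Qed.

Lemma RtoC1 : RtoC 1 = 1. Proof. by []. Qed.

Lemma RtoCV a : RtoC a^-1 = (RtoC a)^-1.
Proof. exact: (fmorphV (real_complex R)). Qed.

Lemma RtoC_pos (e : K) : 0 < e -> exists2 d : R, 0 < d & e = RtoC d.
Proof.
case: e => a b; rewrite ltcE /= => /andP[/eqP -> a0].
by exists a.
Qed.

Section VectorNorm.
Variable V : normedModType K.
Implicit Types x y z : V.

Lemma rn_ge0 x : 0 <= rn x.
Proof. by rewrite -RtoC_le -normE RtoC0. Qed.

Lemma rn0 : rn (0 : V) = 0.
Proof. by apply: RtoC_inj; rewrite -normE normr0. Qed.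

Lemma rn_eq0 x : (rn x == 0) = (x == 0).
Proof. by rewrite -[RHS]normr_eq0 normE -RtoC0 (inj_eq RtoC_inj). Qed.

Lemma rn_gt0 x : (0 < rn x) = (x != 0).
Proof. by rewrite lt_neqAle rn_ge0 andbT eq_sym rn_eq0. Qed.

Lemma rnN x : rn (- x) = rn x.
Proof. by apply: RtoC_inj; rewrite -!normE normrN. Qed.

Lemma rnD x y : rn (x + y) <= rn x + rn y.
Proof. by rewrite -RtoC_le RtoCD -!normE ler_normD. Qed.

Lemma rnB x y : rn (x - y) = rn (y - x).
Proof. by rewrite -opprB rnN. Qed.

Lemma rn_dist z x y : rn (x - y) <= rn (x - z) + rn (z - y).
Proof. by have := rnD (x - z) (z - y); rewrite addrA subrK. Qed.

Lemma rn_triB x y : rn (x - y) <= rn x + rn y.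
Proof. by have := rnD x (- y); rewrite rnN. Qed.

Lemma rn_subl x y : rn x - rn y <= rn (x - y).
Proof. have := rnD (x - y) y; rewrite subrK; lra. Qed.

Lemma rn_ball x y z (s t r : R) : rn (x - y) < s -> rn (y - z) <= t -> s + t <= r ->
  rn (x - z) < r.
Proof. by have := rn_dist y x z; lra. Qed.

Lemma rn_near x y z (s : R) : rn (x - z) <= s -> rn (y - z) <= s -> rn (x - y) <= 2 * s.
Proof. by have := rn_dist z x y; rewrite (rnB z); lra. Qed.

Lemma rn_far x y z (r : R) : rn (y - x) < rn (x - z) - r -> ~ rn (y - z) <= r.
Proof. by have := rn_dist y x z; rewrite (rnB x y); lra. Qed.

End VectorNorm.

Lemma rnM (x y : K) : rn (x * y) = rn x * rn y.
Proof. by apply: RtoC_inj; rewrite RtoCM -!normE normrM. Qed.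

Lemma rn1 : rn (1 : K) = 1.
Proof. by apply: RtoC_inj; rewrite -normE normr1. Qed.

Lemma rnV (x : K) : rn x^-1 = (rn x)^-1.
Proof. by apply: RtoC_inj; rewrite RtoCV -!normE normfV. Qed.

Lemma rnX (x : K) n : rn (x ^+ n) = rn x ^+ n.
Proof. by elim: n => [|n IH]; rewrite ?expr0 ?rn1 // !exprS rnM IH. Qed.

Lemma rnZ (V : normedModType K) (k : K) (x : V) : rn (k *: x) = rn k * rn x.
Proof. by apply: RtoC_inj; rewrite RtoCM -!normE normrZ. Qed.

Lemma rn_real (a : R) : rn (RtoC a) = `|a|.
Proof.
rewrite /rn locked_withE normc_def /= expr0n /= addr0 sqrtr_sqr.
by [].
Qed.

Lemma rn_Re (x : K) : `|complex.Re x| <= rn x.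
Proof. by have := normc_ge_Re x; rewrite (normE (x : K)) lecR. Qed.

Lemma rn_Im (x : K) : `|complex.Im x| <= rn x.
Proof.
rewrite /rn locked_withE normc_def /= -[leLHS]sqrtr_sqr ler_sqrt ?lerDr ?sqr_ge0 //.
by rewrite addr_ge0 ?sqr_ge0.
Qed.

Lemma rn_ReIm (x : K) : rn x <= `|complex.Re x| + `|complex.Im x|.
Proof.
rewrite /rn locked_withE normc_def /= -[leRHS]ger0_norm ?addr_ge0 // -[leRHS]sqrtr_sqr.
rewrite ler_sqrt ?sqr_ge0 // sqrrD !real_normK ?num_real // lerD2r lerDl.
by rewrite mulrn_wge0 // mulr_ge0.
Qed.

Lemma rn_nat n : rn (n%:R : K) = n%:R.
Proof.
have -> : (n%:R : K) = RtoC n%:R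
  by rewrite /RtoC; exact: (esym (rmorph_nat (real_complex R) n)).
by rewrite rn_real ger0_norm.
Qed.

Lemma natK_neq0 n : (n.+1%:R : K) != 0.
Proof. by rewrite pnatr_eq0. Qed.

Lemma nbhs_rn (V : normedModType K) (x : V) (A : set V) :
  nbhs x A <-> exists2 e : R, 0 < e & forall y, rn (x - y) < e -> A y.
Proof.
split=> [/nbhs_ballP[e /= e0]|[e e0 eA]].
  have [d d0 ->] := RtoC_pos e0 => dA.
  exists d => // y xy; apply: dA.
  by rewrite -ball_normE /= normE RtoC_lt.
apply/nbhs_ballP; exists (RtoC e); first by rewrite /= -RtoC0 RtoC_lt.
by move=> y; rewrite -ball_normE /= normE RtoC_lt; apply: eA.
Qed.

Lemma continuous_rn (V W : normedModType K) (f : V -> W) (x : V) :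
  {for x, continuous f} <->
  forall e : R, 0 < e -> exists2 d : R, 0 < d &
    forall y, rn (x - y) < d -> rn (f x - f y) < e.
Proof.
split=> [fc e e0|fc A /nbhs_rn[e e0 eA]].
  have : nbhs (f x) [set y | rn (f x - y) < e] by apply/nbhs_rn; exists e.
  by move/fc/nbhs_rn.
have [d d0 dA] := fc e e0; apply/nbhs_rn; exists d => // y xy.
by apply: eA; apply: dA.
Qed.

Lemma diff_rn (V W : normedModType K) (f : V -> W) (x : V) :
  differentiable f x -> forall e : R, 0 < e -> exists2 d : R, 0 < d &
    forall h, rn h < d -> rn (f (x + h) - f x - 'd f x h) <= e * rn h.
Proof.
move=> /diff_locallyP[_ /eqaddoP fx] e e0.
have e0' : 0 < RtoC e by rewrite -RtoC0 RtoC_lt.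
have /nbhs_rn[d d0 dP] := fx _ e0'; exists d => // h hd.
have := dP h; rewrite sub0r rnN => /(_ hd).
rewrite /= !fctE /= (normE (h : V)) normE -RtoCM RtoC_le.
by rewrite opprD addrA [x + h]addrC.
Qed.

Lemma rn_diff (V W : normedModType K) (f : V -> W) (L : {linear V -> W})
    (x : V) : continuous L ->
  (forall e : R, 0 < e -> exists2 d : R, 0 < d &
    forall h, rn h < d -> rn (f (x + h) - f x - L h) <= e * rn h) ->
  differentiable f x /\ 'd f x = L :> (V -> W).
Proof.
move=> Lc fL.
have fx : f \o shift x = cst (f x) + L +o_ (0 : V) id.
  apply/eqaddoP => _ /RtoC_pos[e e0 ->]; have [d d0 dP] := fL e e0.
  apply/nbhs_rn; exists d => // h; rewrite sub0r rnN => /dP.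
  rewrite /= !fctE /= (normE (h : V)) normE -RtoCM RtoC_le.
  by rewrite opprD addrA [x + h]addrC.
have dL := diff_unique Lc fx.
by split => //; apply/diff_locallyP; rewrite dL.
Qed.

End RealNorm.

(** * Completeness *)

Section Completeness.
Variable R : realType.
Notation K := (C R).

Lemma geo_dist (u : nat -> R) (d : R) :
  (forall k, `|u k.+1 - u k| <= d / 2 ^+ k) ->
  forall k j, `|u (k + j)%N - u k| <= 2 * d / 2 ^+ k - 2 * d / 2 ^+ (k + j).
Proof.
move=> ud k; elim=> [|j IH]; first by rewrite addn0 !subrr normr0.
rewrite addnS exprS.
have -> : 2 * d / (2 * 2 ^+ (k + j)) = d / 2 ^+ (k + j).
  by field; rewrite expf_neq0 // pnatr_eq0.
have := ud (k + j)%N; have := ler_distD (u (k + j)%N) (u (k + j).+1) (u k).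
move: IH; lra.
Qed.

(** Completeness in the form used by all limiting arguments below: steps that
    decrease geometrically, and the rate of convergence. *)
Lemma real_geo_lim (u : nat -> R) (d : R) :
  (forall k, `|u k.+1 - u k| <= d / 2 ^+ k) ->
  exists l, forall k, `|l - u k| <= 2 * d / 2 ^+ k.
Proof.
move=> ud; pose e k := 2 * d / 2 ^+ k; pose A := range (fun k => u k - e k).
have d0 : 0 <= d by have := ud 0%N; rewrite expr0 divr1; apply: le_trans.
have e0 k : 0 <= e k by rewrite divr_ge0 ?exprn_ge0 ?mulr_ge0.
have Ale k : ubound A (u k + e k).
  move=> _ [j _ <-]; case: (leqP j k) => [/subnKC <-|/ltnW/subnKC <-].
  - have := geo_dist ud j (k - j); have := e0 (j + (k - j))%N; rewrite -/(e _) -/(e _).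
    by rewrite ler_norml => ? /andP[? ?]; lra.
  - have := geo_dist ud k (j - k); have := e0 (k + (j - k))%N; rewrite -/(e _) -/(e _).
    by rewrite ler_norml => ? /andP[? ?]; lra.
have As : has_sup A by split; [exists (u 0%N - e 0%N), 0%N | exists (u 0%N + e 0%N); apply: Ale].
exists (sup A) => k; rewrite -/(e k) ler_norml.
have := sup_upper_bound As (ex_intro2 _ _ k I erefl).
have := ge_sup As.1 (Ale k).
lra.
Qed.

Lemma complex_geo_lim (u : nat -> K) (d : R) :
  (forall k, rn (u k.+1 - u k) <= d / 2 ^+ k) ->
  exists z, forall k, rn (z - u k) <= 4 * d / 2 ^+ k.
Proof.
move=> ud.
have [a aP] : exists l, forall k, `|l - complex.Re (u k)| <= 2 * d / 2 ^+ k.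
  apply: real_geo_lim => k; apply: le_trans (ud k).
  by have := rn_Re (u k.+1 - u k); rewrite (raddfB (@complex.Re R : Rcomplex R -> R)).
have [b bP] : exists l, forall k, `|l - complex.Im (u k)| <= 2 * d / 2 ^+ k.
  apply: real_geo_lim => k; apply: le_trans (ud k).
  by have := rn_Im (u k.+1 - u k); rewrite (raddfB (@complex.Im R : Rcomplex R -> R)).
exists (Complex a b) => k; apply: le_trans (rn_ReIm _) _.
rewrite (raddfB (@complex.Re R : Rcomplex R -> R)).
rewrite (raddfB (@complex.Im R : Rcomplex R -> R)) /=.
apply: le_trans (lerD (aP k) (bP k)) _.
by have -> : 4 * d / 2 ^+ k = 2 * d / 2 ^+ k + 2 * d / 2 ^+ k by ring.
Qed.

Lemma rn_rV n (v : 'rV[K]_n) (c : R) : 0 <= c ->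
  (forall i, rn (v 0 i : K) <= c) -> rn v <= c.
Proof.
move=> c0 vc; rewrite -RtoC_le -normE.
have c0' : 0 <= RtoC c by rewrite -RtoC0 RtoC_le.
have [->|] := eqVneq v 0; first by rewrite normr0.
rewrite -normr_eq0 => /mx_norm_neq0[[i j]] /= vE.
have -> : `|v| = mx_norm v by [].
by rewrite vE normE RtoC_le (ord1 i).
Qed.

Lemma rn_coord n (v : 'rV[K]_n) i : rn (v 0 i : K) <= rn v.
Proof.
rewrite -RtoC_le -!normE.
have -> : `|v| = mx_norm v by [].
rewrite mx_normE.
rewrite [leLHS](_ : _ = `|v 0 i|%:nng%:num) // num_le.
exact: (le_bigmax _ (fun ij : 'I_1 * 'I_n => `|v ij.1 ij.2|%:nng) (0, i)).
Qed.

Lemma rV_geo_lim n (u : nat -> 'rV[K]_n) (d : R) :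
  (forall k, rn (u k.+1 - u k) <= d / 2 ^+ k) ->
  exists z, forall k, rn (z - u k) <= 4 * d / 2 ^+ k.
Proof.
move=> ud.
have d0 : 0 <= d.
  by have := ud 0%N; rewrite expr0 divr1; apply: le_trans; exact: rn_ge0.
have /choice[z zP] (i : 'I_n) : exists z : K,
    forall k, rn (z - u k 0 i) <= 4 * d / 2 ^+ k.
  apply: complex_geo_lim => k; apply: le_trans (ud k).
  by have := rn_coord (u k.+1 - u k) i; rewrite !mxE.
exists (\row_i z i) => k; apply: rn_rV => [|i].
  by rewrite divr_ge0 ?exprn_ge0 ?mulr_ge0.
by rewrite !mxE.
Qed.

End Completeness.

(** * Riemann sums and Goursat's lemma *)

Section RiemannSums.
Variable R : realType.
Notation K := (C R).
Implicit Types (f g : K -> K) (a b c : K).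

(** Closedness under midpoints is what dyadic subdivisions of segments and
    triangles use of convexity. *)
Definition midconvex (A : set K) := forall x y, A x -> A y -> A ((x + y) / 2).

Definition midclosed (A : set K) := forall (u : nat -> K) z, (forall k, A (u k)) ->
  (forall e : R, 0 < e -> exists k, rn (z - u k) < e) -> A z.

(** The midpoint Riemann sum of f dz on the segment from a to b, for its
    subdivision into 2 ^ n parts; it stands for the path integral. *)
Fixpoint rsum f n a b : K :=
  if n is n'.+1 then rsum f n' a ((a + b) / 2) + rsum f n' ((a + b) / 2) b
  else f ((a + b) / 2) * (b - a).

Lemma rsumN f n a b : rsum f n b a = - rsum f n a b.
Proof.
elim: n a b => [|n IH] a b /=; first by rewrite [b + a]addrC -mulrN opprB.
rewrite (addrC b a) (IH ((a + b) / 2) b) (IH a ((a + b) / 2)) opprD.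
exact: addrC.
Qed.

Lemma rsumD f g n a b :
  rsum (fun z => f z + g z) n a b = rsum f n a b + rsum g n a b.
Proof.
elim: n a b => [|n IH] a b /=; first by rewrite mulrDl.
by rewrite !IH addrACA.
Qed.

Lemma rsumZ k f n a b : rsum (fun z => k * f z) n a b = k * rsum f n a b.
Proof.
elim: n a b => [|n IH] a b /=; first by rewrite mulrA.
by rewrite !IH mulrDr.
Qed.

(** The midpoint rule is exact on affine functions, so that the sums of an
    affine function along a closed polygon are zero. *)
Lemma rsum_affine p q n a b :
  rsum (fun z => p * z + q) n a b = p / 2 * (b ^+ 2 - a ^+ 2) + q * (b - a).
Proof.
elim: n a b => [|n IH] a b /=; first by field.
by rewrite !IH; field.
Qed.

Lemma rn_half (x : K) : rn (x / 2) = rn x / 2.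
Proof. by rewrite rnM rnV (rn_nat R 2). Qed.

Lemma rsum_bound (A : set K) f (M : R) n a b : midconvex A -> A a -> A b ->
  (forall z, A z -> rn (f z) <= M) -> rn (rsum f n a b) <= M * rn (b - a).
Proof.
move=> Am + + fM; elim: n a b => [|n IH] a b Aa Ab /=.
  by rewrite rnM ler_wpM2r ?rn_ge0 //; apply: fM; exact: Am.
have Ac := Am _ _ Aa Ab; apply: le_trans (rnD _ _) _.
apply: le_trans (lerD (IH _ _ Aa Ac) (IH _ _ Ac Ab)) _.
have -> : (a + b) / 2 - a = (b - a) / 2 by field.
have -> : b - (a + b) / 2 = (b - a) / 2 by field.
by rewrite rn_half; lra.
Qed.

Definition tri f n a b c := rsum f n a b + rsum f n b c + rsum f n c a.

(** The sums along the inner sides of the four triangles cancel exactly,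
    because the subdivisions of these sides agree. *)
Lemma tri_sub f n a b c : tri f n.+1 a b c =
  tri f n ((a + b) / 2) ((c + a) / 2) a + tri f n ((b + c) / 2) ((a + b) / 2) b
  + tri f n ((c + a) / 2) ((b + c) / 2) c
  + tri f n ((a + b) / 2) ((b + c) / 2) ((c + a) / 2).
Proof.
rewrite /tri /=; set x := (a + b) / 2; set y := (b + c) / 2; set z := (c + a) / 2.
by rewrite (rsumN f n x z) (rsumN f n x y) (rsumN f n y z); ring.
Qed.

Definition vanishing (u : nat -> K) :=
  forall e : R, 0 < e -> exists N, forall n, (N <= n)%N -> rn (u n) <= e.

Lemma vanishingD u v : vanishing u -> vanishing v ->
  vanishing (fun n => u n + v n).
Proof.
move=> u0 v0 e e0; have e2 : 0 < e / 2 by rewrite divr_gt0.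
have [[N uN] [N' vN]] := (u0 _ e2, v0 _ e2); exists (maxn N N') => n.
rewrite geq_max => /andP[/uN ? /vN ?]; have := rnD (u n) (v n); lra.
Qed.

Lemma vanishing_eq u v : (forall n, u n = v n) -> vanishing u -> vanishing v.
Proof. by move=> uv u0 e /u0[N uN]; exists N => n /uN; rewrite uv. Qed.

Lemma tri_bound (A : set K) f (M D : R) n a b c : midconvex A ->
  A a -> A b -> A c -> (forall z, A z -> rn (f z) <= M) ->
  rn (a - b) <= D -> rn (b - c) <= D -> rn (c - a) <= D ->
  rn (tri f n a b c) <= 3 * M * D.
Proof.
move=> Am Aa Ab Ac fM ab bc ca; rewrite /tri.
have M0 : 0 <= M by apply: le_trans (fM _ Aa); exact: rn_ge0.
have side x y : A x -> A y -> rn (x - y) <= D -> rn (rsum f n x y) <= M * D.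
  move=> Ax Ay xy; apply: le_trans (rsum_bound _ Am Ax Ay fM) _.
  by rewrite ler_wpM2l // rnB.
have := (side _ _ Aa Ab ab, side _ _ Ab Ac bc, side _ _ Ac Aa ca).
have := rnD (rsum f n a b + rsum f n b c) (rsum f n c a).
by have := rnD (rsum f n a b) (rsum f n b c); move=> ? ? [[]]; lra.
Qed.

Lemma ball_midconvex (z : K) (r : R) : midconvex [set w | rn (w - z) <= r].
Proof.
move=> x y /= xr yr.
have -> : (x + y) / 2 - z = ((x - z) + (y - z)) / 2 by field.
by rewrite rn_half; have := rnD (x - z) (y - z); lra.
Qed.

Lemma midconvexI A B : midconvex A -> midconvex B -> midconvex (A `&` B).
Proof. by move=> Am Bm x y [? ?] [? ?]; split; [exact: Am|exact: Bm]. Qed.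

Lemma geo_small (D r : R) : 0 < r -> exists k, D / 2 ^+ k < r.
Proof.
move=> r0; exists (Num.bound (`|D| / r)).
have := archi_boundP (divr_ge0 (normr_ge0 D) (ltW r0)).
set k := Num.bound _ => kP; rewrite ltr_pdivrMr ?exprn_gt0 //.
apply: le_lt_trans (ler_norm _) _; rewrite mulrC -ltr_pdivrMr //.
apply: lt_trans kP _; rewrite -natrX ltr_nat.
exact: ltn_expl.
Qed.

Lemma linear1E (L : {linear K -> K}) h : L h = h * L 1.
Proof.
by have := linearZ_LR L h 1; rewrite /GRing.scale /= mulr1.
Qed.

Section Goursat.
Variables (A : set K) (f : K -> K).
Hypotheses (Am : midconvex A) (Ac : midclosed A).
Hypothesis fd : forall z, A z -> differentiable f z.

Let bad (e : R) (t : K * K * K) :=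
  ~ exists N, forall n, (N <= n)%N -> rn (tri f n t.1.1 t.1.2 t.2) <= e.

Let sub (D : R) (t : K * K * K) :=
  [/\ A t.1.1, A t.1.2 & A t.2] /\
  [/\ rn (t.1.1 - t.1.2) <= D, rn (t.1.2 - t.2) <= D & rn (t.2 - t.1.1) <= D].

(** If the sums along all four quarters of a triangle were eventually at most
    e / 4, then those along the triangle would be at most e. *)
Lemma goursat_step D e t : sub D t -> bad e t -> exists t',
  [/\ sub (D / 2) t', bad (e / 4) t' & rn (t'.1.1 - t.1.1) <= D].
Proof.
case: t => [[a b] c] [[/= Aa Ab Acc] [/= Dab Dbc Dca]] badt.
set x := (a + b) / 2; set y := (b + c) / 2; set z := (c + a) / 2.
have Ax : A x by exact: Am.
have Ay : A y by exact: Am.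
have Az : A z by exact: Am.
have dxz : x - z = (b - c) / 2 by rewrite /x /z; field.
have dza : z - a = (c - a) / 2 by rewrite /z; field.
have dax : a - x = (a - b) / 2 by rewrite /x; field.
have dyx : y - x = (c - a) / 2 by rewrite /x /y; field.
have dxb : x - b = (a - b) / 2 by rewrite /x; field.
have dby : b - y = (b - c) / 2 by rewrite /y; field.
have dzy : z - y = (a - b) / 2 by rewrite /z /y; field.
have dyc : y - c = (b - c) / 2 by rewrite /y; field.
have dcz : c - z = (c - a) / 2 by rewrite /z; field.
have D0 : 0 <= D by apply: le_trans Dab; exact: rn_ge0.
have xaD : rn (x - a) <= D by rewrite rnB dax rn_half; lra.
have zaD : rn (z - a) <= D by rewrite dza rn_half; lra.
have yaD : rn (y - a) <= D.
  have -> : y - a = (y - x) + (x - a) by ring.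
  apply: le_trans (rnD _ _) _; rewrite dyx (rnB x) dax !rn_half; lra.
apply: contrapT => no.
have good p q r : A p -> A q -> A r -> rn (p - q) <= D / 2 ->
    rn (q - r) <= D / 2 -> rn (r - p) <= D / 2 -> rn (p - a) <= D ->
    exists N, forall n, (N <= n)%N -> rn (tri f n p q r) <= e / 4.
  move=> Ap Aq Ar pq qr rp pa; apply: contrapT => bs; apply: no.
  by exists (p, q, r).
have [N1 H1] : exists N, forall n, (N <= n)%N -> rn (tri f n x z a) <= e / 4.
  by apply: good => //; rewrite ?dxz ?dza ?dax rn_half; lra.
have [N2 H2] : exists N, forall n, (N <= n)%N -> rn (tri f n y x b) <= e / 4.
  by apply: good => //; rewrite ?dyx ?dxb ?dby rn_half; lra.
have [N3 H3] : exists N, forall n, (N <= n)%N -> rn (tri f n z y c) <= e / 4.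
  by apply: good => //; rewrite ?dzy ?dyc ?dcz rn_half; lra.
have [N4 H4] : exists N, forall n, (N <= n)%N -> rn (tri f n x y z) <= e / 4.
  by apply: good => //; rewrite rnB ?dyx ?dzy ?dxz rn_half; lra.
apply: badt; exists (maxn (maxn N1 N2) (maxn N3 N4)).+1 => -[//|n].
rewrite ltnS !geq_max => /andP[/andP[/H1 h1 /H2 h2] /andP[/H3 h3 /H4 h4]].
rewrite [X in rn X]tri_sub -/x -/y -/z.
do 3 (apply: le_trans (rnD _ _) _; rewrite -lerBrDr).
lra.
Qed.

(** Goursat's lemma. Nested triangles along which the sums stay large would
    shrink to a point z; near z the function f is affine up to an error that
    is small compared with the size of the triangle. *)
Lemma goursat a b c : A a -> A b -> A c -> vanishing (fun n => tri f n a b c).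
Proof.
move=> Aa Ab Acc e e0; apply: contrapT => bade.
pose D := rn (a - b) + rn (b - c) + rn (c - a) + 1.
have D0 : 0 < D.
  by have := (rn_ge0 (a - b), rn_ge0 (b - c), rn_ge0 (c - a)); rewrite /D => -[[]]; lra.
pose P k t := sub (D / 2 ^+ k) t /\ bad (e / 4 ^+ k) t.
have P0 : P 0%N (a, b, c).
  split; last by rewrite expr0 divr1.
  have := (rn_ge0 (a - b), rn_ge0 (b - c), rn_ge0 (c - a)).
  rewrite expr0 divr1 => -[[? ?] ?]; split=> //=; rewrite /D.
  by split; lra.
have /choice[g gP] (kt : nat * (K * K * K)) : exists t', P kt.1 kt.2 ->
    P kt.1.+1 t' /\ rn (t'.1.1 - kt.2.1.1) <= D / 2 ^+ kt.1.
  case: (pselect (P kt.1 kt.2)) => [[s1 s2]|?]; last by exists kt.2.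
  have [t' [h1 h2 h3]] := goursat_step s1 s2; exists t' => _; split=> //.
  by rewrite /P !exprSr !invfM !mulrA.
pose u := fix u k := if k is k'.+1 then g (k', u k') else (a, b, c).
have uP k : P k (u k) by elim: k => //= k IH; apply: (gP (k, u k) IH).1.
have [z zP] : exists z, forall k, rn (z - (u k).1.1) <= 4 * D / 2 ^+ k.
  by apply: complex_geo_lim => k; exact: (gP (k, u k) (uP k)).2.
have Az : A z.
  apply: (Ac (u := fun k => (u k).1.1)) => [k|r /(geo_small (4 * D))[k kr]].
    by have [[[]]] := uP k.
  by exists k; apply: le_lt_trans kr; exact: zP.
(* 15 = 3 * 5: there are three sides, at distance at most 5 s from z *)
have h0 : 0 < e / (15 * D ^+ 2) by rewrite divr_gt0 // mulr_gt0 // exprn_gt0.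
have [d d0 dP] := diff_rn (fd Az) h0.
have [k kd] := geo_small (5 * D) d0.
have [[[Ap Aq Ar] [pq qr rp]]] := uP k; apply.
have zp := zP k; set p := (u k).1.1 in Ap pq rp zp *.
set q := (u k).1.2 in Aq pq qr *; set r := (u k).2 in Ar qr rp *.
have Dk0 : 0 < D / 2 ^+ k by rewrite divr_gt0 // exprn_gt0.
have {}zp : rn (p - z) <= 4 * (D / 2 ^+ k) by rewrite rnB mulrA.
set s := D / 2 ^+ k in pq qr rp zp Dk0 *.
have {}kd : 5 * s < d by rewrite /s mulrA.
pose B := A `&` [set w | rn (w - z) <= 5 * s].
have Bm : midconvex B by apply: midconvexI => //; exact: ball_midconvex.
have Bp : B p by split=> //=; lra.
have Bq : B q.
  by split=> //=; have := rn_dist p q z; rewrite (rnB q p); lra.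
have Br : B r by split=> //=; have := rn_dist p r z; lra.
pose l := 'd f z (1 : K) : K; pose rem w := f w - (l * w + (f z - l * z)).
have fE w : f w = (l * w + (f z - l * z)) + rem w by rewrite /rem; ring.
have remB w : B w -> rn (rem w) <= e / (15 * D ^+ 2) * (5 * s).
  move=> [_ /= wz]; have := dP (w - z) (le_lt_trans wz kd).
  rewrite (linear1E ('d f z)) -/l [z + _]addrC subrK.
  have -> : f w - f z - (w - z) * l = rem w by rewrite /rem; ring.
  move=> H; apply: le_trans H _; by rewrite ler_wpM2l // ltW.
exists 0%N => n _; have -> : tri f n p q r = tri rem n p q r.
  have -> : tri f n p q r =
      tri (fun w => l * w + (f z - l * z)) n p q r + tri rem n p q r.
    have E := funext fE; rewrite {1}E /tri !rsumD; ring.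
  by rewrite /tri !rsum_affine; field.
apply: le_trans (tri_bound _ Bm Bp Bq Br remB pq qr rp) _.
have -> : 3 * (e / (15 * D ^+ 2) * (5 * s)) * s = e / D ^+ 2 * s ^+ 2 by field; lra.
have E4 : (4 : R) ^+ k = (2 ^+ k) ^+ 2 by rewrite -exprM mulnC exprM; congr (_ ^+ _); ring.
by rewrite /s expr_div_n E4 mulrA divfK // gt_eqF // exprn_gt0.
Qed.

End Goursat.
End RiemannSums.

(** * Cauchy's formula on a square *)

Section CauchyFormula.
Variable R : realType.
Notation K := (C R).
Notation Re := (@complex.Re R).
Notation Im := (@complex.Im R).

Definition imag : K := Complex 0 1.

Lemma sqr_imag : imag * imag = -1.
Proof. by rewrite -expr2; exact: sqr_i. Qed.

Lemma ReD (x y : K) : Re (x + y) = Re x + Re y.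
Proof. by case: x y => [? ?] [? ?]. Qed.

Lemma ReN (x : K) : Re (- x) = - Re x.
Proof. by case: x. Qed.

Lemma ReZ (t : R) (x : K) : Re (RtoC t * x) = t * Re x.
Proof. by case: x => a b; rewrite /RtoC /GRing.mul /= mul0r subr0. Qed.

Lemma ImD (x y : K) : Im (x + y) = Im x + Im y.
Proof. by case: x y => [? ?] [? ?]. Qed.

Lemma ImZ (t : R) (x : K) : Im (RtoC t * x) = t * Im x.
Proof. by case: x => a b; rewrite /RtoC /GRing.mul /= mul0r addr0. Qed.

Lemma RtoCN (x : R) : RtoC (- x) = - RtoC x.
Proof. exact: (rmorphN (real_complex R)). Qed.

Lemma RtoC_half : RtoC 2^-1 = 2^-1 :> K.
Proof. by rewrite RtoCV; congr (_^-1); rewrite /RtoC; exact: (rmorph_nat (real_complex R) 2). Qed.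

Lemma Re_imag (x : K) : Re (x * imag) = - Im x.
Proof. exact: ReiNIm. Qed.

Lemma rn_imag : rn imag = 1.
Proof.
have : rn imag ^+ 2 = 1 by rewrite -rnX expr2 sqr_imag rnN rn1.
move/eqP; rewrite sqrf_eq1 => /orP[/eqP //|/eqP E].
by have := rn_ge0 imag; rewrite E; lra.
Qed.

Lemma Im_inv (q : K) : q != 0 -> Im (q^-1) = - Im q / rn q ^+ 2.
Proof.
case: q => x y q0; rewrite /rn locked_withE normc_def /= sqr_sqrtr; last first.
  by rewrite addr_ge0 ?sqr_ge0.
by rewrite /GRing.inv /= mulNr.
Qed.

(** A real linear form whose level sets are parallel to the k-th side of the
    contour. *)
Definition height (k : nat) (z : K) : R := Re ((1 - imag) * (- imag) ^+ k * z).

Lemma heightD k x y : height k (x + y) = height k x + height k y.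
Proof. by rewrite /height mulrDr ReD. Qed.

Lemma heightN k x : height k (- x) = - height k x.
Proof. by rewrite /height mulrN ReN. Qed.

Lemma heightZ k t x : height k (RtoC t * x) = t * height k x.
Proof. by rewrite /height mulrCA ReZ. Qed.

Lemma height_le k z : `|height k z| <= 2 * rn z.
Proof.
apply: le_trans (rn_Re _) _; rewrite !rnM rnX rnN rn_imag expr1n mulr1.
rewrite ler_wpM2r ?rn_ge0 //.
by have := rn_triB (1 : K) imag; rewrite rn1 rn_imag; lra.
Qed.

Lemma imag_pow k : (- imag) ^+ k * imag ^+ k = 1.
Proof. by rewrite -exprMn mulNr sqr_imag opprK expr1n. Qed.

Lemma height_imag k : height k (imag ^+ k) = 1 /\ height k (imag ^+ k.+1) = 1.
Proof.
have E : (- imag) ^+ k * imag ^+ k.+1 = imag by rewrite exprSr mulrA imag_pow mul1r.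
rewrite /height -!mulrA imag_pow E mulr1 mulrBl mul1r sqr_imag opprK.
by split; rewrite ReD ?ReN /= ?subr0 ?add0r.
Qed.

(** A homothety with centre w scales the sums of a power of z - w; this
    relates a contour to its shrunk copies. *)
Lemma rsum_scale (w : K) (k j : nat) (s : K) n x y : s != 0 ->
  rsum (fun z => (z - w) ^- j.+1) n (w + s * (x - w)) (w + s * (y - w))
  = s ^- j * rsum (fun z => (z - w) ^- j.+1) n x y.
Proof.
move=> s0; elim: n x y => [|n IH] x y /=.
  have -> : (w + s * (x - w) + (w + s * (y - w))) / 2 - w
            = s * ((x + y) / 2 - w) by field.
  have -> : w + s * (y - w) - (w + s * (x - w)) = s * (y - x) by ring.
  rewrite exprMn invfM exprS invfM; set A := (_ - w) ^- _; set B := s ^- j.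
  by rewrite -[RHS]mul1r -(mulVf s0); ring.
have -> : (w + s * (x - w) + (w + s * (y - w))) / 2
          = w + s * ((x + y) / 2 - w) by field.
by rewrite !IH mulrDr.
Qed.

Lemma rsum_Im_ge (A : set K) (g : K -> K) (c : R) n x y e t : midconvex A ->
  A x -> A y -> (forall z, A z -> c <= Im (g z * e)) -> y - x = RtoC t * e ->
  0 <= t -> t * c <= Im (rsum g n x y).
Proof.
move=> Am + + gc; elim: n x y t => [|n IH] x y t Ax Ay yx t0 /=.
  by rewrite yx mulrCA ImZ ler_wpM2l //; apply: gc; exact: Am.
have Az := Am _ _ Ax Ay; rewrite ImD.
have h2 := esym RtoC_half.
have t2 : 0 <= t / 2 by rewrite divr_ge0.
have := IH _ _ (t / 2) Ax Az; have := IH _ _ (t / 2) Az Ay.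
have -> : y - (x + y) / 2 = RtoC (t / 2) * e.
  by rewrite RtoCM -h2 mulrAC -yx; field.
have -> : (x + y) / 2 - x = RtoC (t / 2) * e.
  by rewrite RtoCM -h2 mulrAC -yx; field.
move=> /(_ erefl t2) + /(_ erefl t2); lra.
Qed.

Section Contour.
Variables (a : K) (r : R).
Hypothesis r0 : 0 < r.

(** The contour is the square with these vertices; it is contained in the disc
    of radius r and encloses the disc of radius r / 4. *)
Definition corner k := a + RtoC r * imag ^+ k.

Definition contour (g : K -> K) n := \sum_(k < 4) rsum g n (corner k) (corner k.+1).

Definition shrunk w (s : R) k : K := w + RtoC s * (corner k - w).

Definition small_contour w s g n :=
  \sum_(k < 4) rsum g n (shrunk w s k) (shrunk w s k.+1).

(** A convex part of the disc that contains the k-th side of the contour and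
    stays away from w. *)
Definition slab w (c : R) k : set K :=
  [set z | rn (z - a) <= r] `&` [set z | c <= height k (z - w)].

Lemma slab_midconvex w c k : midconvex (slab w c k).
Proof.
apply: midconvexI; first exact: ball_midconvex.
move=> x y /= xc yc.
have h2 := esym RtoC_half.
have -> : (x + y) / 2 - w = RtoC 2^-1 * ((x - w) + (y - w)) by rewrite -h2; field.
by rewrite heightZ heightD; lra.
Qed.

Lemma slab_midclosed w c k : midclosed (slab w c k).
Proof.
move=> u z uP uz; split=> /=; rewrite leNgt; apply/negP => H.
  have [j zj] := uz (rn (z - a) - r) ltac:(lra); have [/= uj _] := uP j.
  by have := rn_dist (u j) z a; lra.
have [j zj] := uz ((c - height k (z - w)) / 2) ltac:(lra); have [_ /= uj] := uP j.
have := height_le k (u j - z); rewrite rnB ler_norml => /andP[_].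
by have := heightD k (u j - z) (z - w); rewrite addrA subrK; lra.
Qed.

Lemma corner_dist k : rn (corner k - a) = r.
Proof.
by rewrite /corner [a + _]addrC addrK rnM rn_real rnX rn_imag expr1n mulr1 gtr0_norm.
Qed.

Lemma corner_height w k : rn (w - a) <= r / 4 ->
  r / 2 <= height k (corner k - w) /\ r / 2 <= height k (corner k.+1 - w).
Proof.
move=> wr; have := height_le k (w - a); rewrite ler_norml => /andP[_ h].
have -> : corner k - w = RtoC r * imag ^+ k - (w - a) by rewrite /corner; ring.
have -> : corner k.+1 - w = RtoC r * imag ^+ k.+1 - (w - a).
  by rewrite /corner; ring.
by rewrite !heightD !heightN !heightZ; have [-> ->] := height_imag k; lra.
Qed.

Lemma corner4 : corner 4 = corner 0.
Proof.
by rewrite /corner (exprM imag 2 2) (expr2 imag) sqr_imag sqrrN expr1n expr0.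
Qed.

Lemma shrunk_slab w (s : R) k j : rn (w - a) <= r / 4 -> 0 < s <= 1 ->
  (j = k \/ j = k.+1) -> slab w (s * (r / 2)) k (shrunk w s j).
Proof.
move=> wr /andP[s0 s1] jk; split=> /=; rewrite /shrunk.
  have -> : w + RtoC s * (corner j - w) - a
            = RtoC s * (corner j - a) + RtoC (1 - s) * (w - a).
    have -> : RtoC (1 - s) = 1 - RtoC s :> K by rewrite RtoCD RtoC1 RtoCN.
    ring.
  apply: le_trans (rnD _ _) _; rewrite !rnM !rn_real corner_dist.
  rewrite !ger0_norm; [|lra..].
  have r_gt0 := r0.
  have : (1 - s) * rn (w - a) <= (1 - s) * r by rewrite ler_wpM2l //; lra.
  lra.
rewrite [w + _]addrC addrK heightZ ler_wpM2l ?(ltW s0) //.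
by have [h1 h2] := corner_height k wr; case: jk => ->.
Qed.

Lemma shrunk1 w k : shrunk w 1 k = corner k.
Proof. by rewrite /shrunk RtoC1 mul1r addrCA subrr addr0. Qed.

Lemma slab_far w c k z : slab w c k z -> c <= 2 * rn (z - w).
Proof. by move=> [_ /= h]; have := height_le k (z - w); rewrite ler_norml; lra. Qed.

Lemma vanishing_sum m (u : 'I_m -> nat -> K) : (forall k, vanishing (u k)) ->
  vanishing (fun n => \sum_(k < m) u k n).
Proof.
elim: m u => [|m IH] u u0.
  by apply: (@vanishing_eq _ (fun=> 0)) => [n|e e0]; rewrite ?big_ord0 //; exists 0%N => n _; rewrite rn0 ltW.
apply: (@vanishing_eq _ (fun n => u ord0 n + \sum_(k < m) u (lift ord0 k) n)).
  by move=> n; rewrite big_ord_recl.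
by apply: vanishingD => //; apply: IH.
Qed.

Lemma shrunk4 w s : shrunk w s 4 = shrunk w s 0.
Proof. by rewrite /shrunk corner4. Qed.

(** The region between the contour and its copy shrunk towards w is cut into
    triangles that avoid w, and Goursat's lemma applies to each of them. *)
Lemma contour_shrink w (s : R) g : rn (w - a) <= r / 4 -> 0 < s <= 1 ->
  (forall z, rn (z - a) <= r -> z != w -> differentiable g z) ->
  vanishing (fun n => contour g n - small_contour w s g n).
Proof.
move=> wr s01 gd.
pose T k n := tri g n (corner k) (corner k.+1) (shrunk w s k.+1)
  + tri g n (corner k) (shrunk w s k.+1) (shrunk w s k).
apply: (@vanishing_eq _ (fun n => \sum_(k < 4) T k n)).
  move=> n; rewrite /T /contour /small_contour !big_ord_recr !big_ord0 /= /tri.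
  rewrite corner4 shrunk4 !(rsumN g n (shrunk _ _ _) (corner _)).
  rewrite !(rsumN g n (shrunk w s 0) (shrunk w s 1)) !(rsumN g n (shrunk w s 1) (shrunk w s 2)).
  rewrite !(rsumN g n (shrunk w s 2) (shrunk w s 3)) !(rsumN g n (shrunk w s 3) (shrunk w s 0)).
  ring.
apply: vanishing_sum => k.
have [s0 s1] := andP s01; have r_gt0 := r0.
have c0 : 0 < s * (r / 2) by rewrite mulr_gt0 // divr_gt0.
have gdk z : slab w (s * (r / 2)) k z -> differentiable g z.
  move=> zs; apply: gd; first by case: zs.
  apply/eqP => zw; have := slab_far zs; rewrite zw subrr rn0; lra.
have one : 0 < (1 : R) <= 1 by rewrite ltr01 lexx.
have slab1 (j : nat) : j = k \/ j = k.+1 -> slab w (s * (r / 2)) k (corner j).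
  move=> jk; have := shrunk_slab wr one jk; rewrite shrunk1 => -[h1 /= h2].
  by split=> //=; apply: le_trans h2; rewrite mul1r ler_piMl // divr_ge0 // ltW.
have gour := goursat (@slab_midconvex w _ k) (@slab_midclosed w _ k) gdk.
have sh j jk := @shrunk_slab w s k j wr s01 jk.
by apply: vanishingD; apply: gour; by [apply: slab1; tauto|apply: sh; tauto].
Qed.

Lemma shrunk_dist w (s : R) k : rn (w - a) <= r / 4 -> 0 < s ->
  rn (shrunk w s k - w) <= 2 * s * r.
Proof.
move=> wr s0; rewrite /shrunk [w + _]addrC addrK rnM rn_real gtr0_norm //.
have r_gt0 := r0.
rewrite [2 * s]mulrC -mulrA ler_wpM2l ?ltW //.
by have := rn_dist a (corner k) w; rewrite corner_dist (rnB a); lra.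
Qed.

Lemma shrunk_side w (s : R) k : 0 < s ->
  rn (shrunk w s k.+1 - shrunk w s k) <= 2 * s * r.
Proof.
move=> s0; have r_gt0 := r0.
have -> : shrunk w s k.+1 - shrunk w s k
    = RtoC s * RtoC r * imag ^+ k * (imag - 1).
  by rewrite /shrunk /corner exprSr; ring.
rewrite !rnM !rn_real rnX rn_imag expr1n mulr1 !gtr0_norm //.
have := rn_triB imag (1 : K); rewrite rn_imag rn1 => h.
have sr : 0 <= s * r by rewrite mulr_ge0 // ltW.
have : s * r * rn (imag - 1) <= s * r * 2 by rewrite ler_wpM2l //; lra.
lra.
Qed.

Lemma small_contour_bound w (s : R) g (M : R) n : rn (w - a) <= r / 4 ->
  0 < s <= 1 ->
  (forall z, s * r / 4 <= rn (z - w) <= 2 * s * r -> rn (z - a) <= r ->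
     rn (g z) <= M) ->
  rn (small_contour w s g n) <= 4 * (M * (2 * s * r)).
Proof.
move=> wr s01 gM; have [s0 s1] := andP s01.
have side k : rn (rsum g n (shrunk w s k) (shrunk w s k.+1)) <= M * (2 * s * r).
  pose A := slab w (s * (r / 2)) k `&` [set z | rn (z - w) <= 2 * s * r].
  have Am : midconvex A.
    by apply: midconvexI; [exact: slab_midconvex|exact: ball_midconvex].
  have AM z : A z -> rn (g z) <= M.
    move=> [sz /= zw]; apply: gM; last by case: sz.
    by rewrite zw andbT; have := slab_far sz; lra.
  have As : A (shrunk w s k).
    by split; [apply: shrunk_slab => //; left|exact: shrunk_dist].
  have As' : A (shrunk w s k.+1).
    by split; [apply: shrunk_slab => //; right|exact: shrunk_dist].
  apply: le_trans (rsum_bound _ Am As As' AM) _.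
  apply: ler_wpM2l; last exact: shrunk_side.
  exact: le_trans (rn_ge0 _) (AM _ As).
rewrite /small_contour !big_ord_recr big_ord0 /= add0r.
do 3 (apply: le_trans (rnD _ _) _; rewrite -lerBrDr; have := side 3; move=> _).
have := (side 0%N, side 1%N, side 2%N, side 3%N) => -[[[]]]; lra.
Qed.

(** The form dz / (z - w) is invariant under homotheties with centre w. *)
Lemma small_kernel w (s : R) n : 0 < s ->
  small_contour w s (fun z => (z - w)^-1) n = contour (fun z => (z - w)^-1) n.
Proof.
move=> s0; apply: eq_bigr => k _.
have s0' : RtoC s != 0 by rewrite -RtoC0 (inj_eq (@RtoC_inj R)) gt_eqF.
by have := rsum_scale w k 0 n (corner k) (corner k.+1) s0'; rewrite invr1 mul1r.
Qed.

(** The sums of dz / (z - w) tend to 2 pi i. A lower bound for the imaginary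
    part of the contribution of each side is all that is used of this. *)
Lemma kernel_Im w n : rn (w - a) <= r / 4 ->
  4^-1 <= Im (contour (fun z => (z - w)^-1) n).
Proof.
move=> wr; have r_gt0 := r0.
have one : 0 < (1 : R) <= 1 by rewrite ltr01 lexx.
have side k : 16^-1 <= Im (rsum (fun z => (z - w)^-1) n (corner k) (corner k.+1)).
  pose A := slab w (r / 2) k.
  have As j : j = k \/ j = k.+1 -> A (corner j).
    by move=> jk; have := shrunk_slab wr one jk; rewrite shrunk1 mul1r.
  rewrite -[leLHS]mul1r.
  apply: (@rsum_Im_ge A _ _ _ _ _ (corner k.+1 - corner k)) => //;
    [exact: slab_midconvex|by apply: As; left|by apply: As; right| |
     by rewrite RtoC1 mul1r].
  move=> z Az; have zfar := slab_far Az; have [/= zr zh] := Az.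
  have zw0 : z - w != 0 by rewrite -rn_gt0; lra.
  pose e : K := corner k.+1 - corner k.
  have eE : e = RtoC r * imag ^+ k * (imag - 1) by rewrite /e /corner exprSr; ring.
  (* the modulus of q is bounded and its imaginary part is bounded away from
     0, which gives a lower bound for the imaginary part of its inverse *)
  pose q := (z - w) / e.
  have im1 : (imag - 1) * (- 1 - imag) = 2.
    by rewrite mulrBr mulrBl mulrBl sqr_imag; ring.
  have im0 : imag - 1 != 0.
    by apply/eqP => E; move: im1; rewrite E mul0r => /esym/eqP; rewrite (negPf (natK_neq0 R 1)).
  have r0' : RtoC r != 0 by rewrite -RtoC0 (inj_eq (@RtoC_inj R)) gt_eqF.
  have i0 : imag ^+ k != 0.
    by rewrite expf_neq0 // -rn_gt0 rn_imag.
  have e0 : e != 0 by rewrite eE !mulf_neq0.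
  have -> : (z - w)^-1 * e = q^-1 by rewrite /q invfM invrK mulrC.
  have q0 : q != 0 by rewrite /q mulf_neq0 ?invr_eq0.
  rewrite Im_inv //.
  have ImqE : Im q = - (height k (z - w) / (2 * r)).
    have -> : q = RtoC (2 * r)^-1 * ((- imag) ^+ k * (- 1 - imag) * (z - w)).
      apply: (mulIf e0); rewrite /q divfK // eE.
      rewrite invfM RtoCM RtoC_half RtoCV.
      transitivity ((RtoC r)^-1 * RtoC r * ((- imag) ^+ k * imag ^+ k) * ((imag - 1) * (- 1 - imag) / 2) * (z - w)).
        by rewrite mulVf // imag_pow im1 divff ?natK_neq0 // !mul1r.
      ring.
    rewrite ImZ /height mulrC -[in RHS]mulNr; congr (_ / _).
    rewrite -[LHS]opprK -Re_imag; congr (- Re _).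
    have -> : (1 - imag) = (- 1 - imag) * imag.
      by rewrite mulrBl mulN1r sqr_imag; ring.
    ring.
  have qle : rn q <= 2.
    rewrite /q rnM rnV ler_pdivrMr ?rn_gt0 // eE !rnM rn_real rnX rn_imag expr1n.
    rewrite mulr1 gtr0_norm //.
    have : 1 <= rn (imag - 1).
      by apply: le_trans (rn_Re _); rewrite ReD ReN /= sub0r normrN1.
    have : rn (z - w) <= 2 * r.
      by have := rn_dist a z w; rewrite (rnB a w); lra.
    by move=> h1 h2; have : 2 * r * 1 <= 2 * r * rn (imag - 1);
      [rewrite ler_wpM2l //; lra | lra].
  rewrite ImqE opprK ler_pdivlMr ?exprn_gt0 ?rn_gt0 //.
  have : rn q ^+ 2 <= 4.
    by rewrite (_ : 4 = 2 ^+ 2) ?ler_sqr ?nnegrE ?rn_ge0 //; ring.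
  have : 4^-1 <= height k (z - w) / (2 * r).
    by rewrite ler_pdivlMr; lra.
  lra.
have := (side 0%N, side 1%N, side 2%N, side 3%N) => -[[[]]].
rewrite /contour !big_ord_recr big_ord0 /= add0r !ImD; lra.
Qed.

Lemma small_contourB w (s : R) (c : K) (g h : K -> K) n :
  small_contour w s (fun z => g z - c * h z) n
  = small_contour w s g n - c * small_contour w s h n.
Proof.
rewrite /small_contour mulr_sumr -sumrB; apply: eq_bigr => k _.
by rewrite -mulNr -rsumZ -rsumD; congr rsum; apply/funext => z; rewrite mulNr.
Qed.

(** Cauchy's formula, with the sums of the kernel in place of 2 pi i. On a
    contour shrunk towards w the function f is close to f w, by continuity. *)
Theorem cauchy_formula w (f : K -> K) : rn (w - a) <= r / 4 ->
  (forall z, rn (z - a) <= r -> differentiable f z) ->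
  vanishing (fun n => contour (fun z => f z / (z - w)) n
                      - f w * contour (fun z => (z - w)^-1) n).
Proof.
move=> wr fd e e0; have r_gt0 := r0.
have e1 : 0 < e / 64 by rewrite divr_gt0.
have wa : rn (w - a) <= r by lra.
have /continuous_rn/(_ _ e1)[d d0 dP] : {for w, continuous f}.
  by apply: differentiable_continuous; exact: fd.
pose s := Num.min 1 (d / (3 * r)).
have s0 : 0 < s by rewrite lt_min ltr01 divr_gt0 // mulr_gt0.
have s1 : s <= 1 by rewrite ge_min lexx.
have s01 : 0 < s <= 1 by rewrite s0.
have sd : 3 * s * r <= d.
  have : s <= d / (3 * r) by rewrite ge_min lexx orbT.
  by rewrite ler_pdivlMr; lra.
have gd z : rn (z - a) <= r -> z != w -> differentiable (fun z => f z / (z - w)) z.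
  move=> za zw.
  apply: differentiableM; first exact: fd.
  apply: differentiableV; last by rewrite subr_eq0.
  by apply: differentiableB => //; exact: differentiable_cst.
have e2 : 0 < e / 2 by rewrite divr_gt0.
have [N HN] := contour_shrink wr s01 gd e2; exists N => n /HN {}HN.
rewrite -(small_kernel w n s0).
set A := contour _ n in HN *; set B := small_contour w s _ n in HN.
have -> : A - f w * small_contour w s (fun z => (z - w)^-1) n
  = (A - B) + small_contour w s (fun z => f z / (z - w) - f w * (z - w)^-1) n.
  by rewrite small_contourB -/B; ring.
apply: le_trans (rnD _ _) _.
have sr0 : 0 < s * r by rewrite mulr_gt0.
have : rn (small_contour w s (fun z => f z / (z - w) - f w * (z - w)^-1) n)
    <= 4 * ((e / 64 / (s * r / 4)) * (2 * s * r)).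
  apply: small_contour_bound => // z /andP[z1 z2] za.
  have zw : 0 < rn (z - w) by lra.
  rewrite -mulrBl rnM rnV ler_pdivrMr //.
  have : rn (f w - f z) < e / 64 by apply: dP; rewrite rnB; lra.
  rewrite rnB => /ltW h; apply: le_trans h _.
  rewrite mulrAC ler_pdivlMr; last lra.
  by rewrite ler_wpM2l // ltW.
have -> : 4 * ((e / 64 / (s * r / 4)) * (2 * s * r)) = e / 2.
  by field; rewrite !gt_eqF.
lra.
Qed.

End Contour.
End CauchyFormula.

(** * Difference quotients of holomorphic functions *)

Section DifferenceQuotient.
Variable R : realType.
Notation K := (C R).

(** The values along a sequence tending to 0 form a Cauchy sequence, with a
    geometric rate. *)
Lemma punctured_lim (g : K -> K) (rho B : R) : 0 < rho ->
  (forall x y, 0 < rn x <= rho -> 0 < rn y <= rho ->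
     rn (g x - g y) <= B * (rn x + rn y)) ->
  exists l, forall x, 0 < rn x <= rho -> rn (g x - l) <= B * rn x.
Proof.
move=> rho0 gB; pose t k : K := RtoC (rho / 2 ^+ k).
have t0 k : 0 < rho / 2 ^+ k by rewrite divr_gt0 // exprn_gt0.
have tE k : rn (t k) = rho / 2 ^+ k by rewrite rn_real gtr0_norm.
have tP k : 0 < rn (t k) <= rho.
  rewrite tE t0 ler_pdivrMr ?exprn_gt0 // ler_peMr ?(ltW rho0) //.
  by rewrite exprn_ege1 // ler1n.
have B0 : 0 <= B.
  by have := gB _ _ (tP 0%N) (tP 0%N); rewrite subrr rn0 pmulr_lge0 // addr_gt0 ?(andP (tP _)).1.
have [l lP] : exists l, forall k, rn (l - g (t k)) <= 4 * (2 * B * rho) / 2 ^+ k.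
  apply: complex_geo_lim => k; apply: le_trans (gB _ _ (tP _) (tP _)) _.
  have -> : 2 * B * rho / 2 ^+ k = B * (rho / 2 ^+ k + rho / 2 ^+ k) by ring.
  rewrite ler_wpM2l // !tE lerD2r ler_wpM2l ?(ltW rho0) // lef_pV2 ?posrE ?exprn_gt0 //.
  by rewrite ler_weXn2l // ler1n.
exists l => x xP; rewrite -[leRHS]addr0; apply/ler_addgt0Pr => e e0; rewrite addr0.
have [k kP] := geo_small (9 * B * rho) e0.
have := rn_dist (g (t k)) (g x) l; rewrite (rnB (g (t k)) l).
have := gB _ _ xP (tP k); rewrite tE mulrDr; have := lP k.
have E : 9 * B * rho / 2 ^+ k = 4 * (2 * B * rho) / 2 ^+ k + B * (rho / 2 ^+ k) by ring.
move: kP; rewrite E; lra.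
Qed.

(** The coefficients c2 and c3 of the expansion need not converge; they are
    eliminated by comparing the expansions at two values of x. *)
Lemma quotient_lim (Q : K -> K) (k0 c2 c3 : nat -> K) (l : K) (rho B M : R) :
  0 < rho ->
  (forall n, 4^-1 <= rn (k0 n) <= B) -> (forall n, rn (c3 n) <= B) ->
  (forall x, 0 < rn x <= rho -> forall e, 0 < e -> exists N, forall n,
     (N <= n)%N -> rn (k0 n * Q x - c2 n - x * c3 n) <= M * rn x ^+ 2 + e) ->
  (forall e, 0 < e -> exists2 d, 0 < d & forall x, 0 < rn x < d -> rn (Q x - l) <= e) ->
  exists p, forall x, 0 < rn x <= rho -> rn ((Q x - l) / x - p) <= 4 * M * rn x.
Proof.
move=> rho0 k0B c3B QE Ql.
have B0 : 0 < B by have /andP[h1 h2] := k0B 0%N; lra.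
have M0 : 0 <= M.
  rewrite leNgt; apply/negP => M0; pose x : K := RtoC rho.
  have xE : rn x = rho by rewrite rn_real gtr0_norm.
  have x1 : 0 < rn x <= rho by rewrite xE rho0 lexx.
  have h : 0 < - (M * rho ^+ 2) / 2 by rewrite divr_gt0 // oppr_gt0 pmulr_llt0 // exprn_gt0.
  have [N /(_ N (leqnn _))] := QE _ x1 _ h.
  by rewrite xE; have := rn_ge0 (k0 N * Q x - c2 N - x * c3 N); lra.
have L e : 0 < e -> exists N, forall n, (N <= n)%N -> rn (k0 n * l - c2 n) <= e.
  move=> e0; have eB : 0 < e / (4 * B) by rewrite divr_gt0 // mulr_gt0.
  have [d d0 dP] := Ql _ eB.
  (* small enough for every error term to be at most e / 4 *)
  pose s := Num.min (Num.min (d / 2) rho) (Num.min (e / (4 * B)) (Num.min 1 (e / (4 * (M + 1))))).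
  have s0 : 0 < s by rewrite !lt_min rho0 ltr01 eB !divr_gt0 // mulr_gt0 // ltr_wpDl.
  have [sd srho seB s1 sM] : [/\ s <= d / 2, s <= rho, s <= e / (4 * B), s <= 1 & s <= e / (4 * (M + 1))].
    by split; rewrite /s !ge_min lexx ?orbT.
  pose x : K := RtoC s; have xE : rn x = s by rewrite rn_real gtr0_norm.
  have x1 : 0 < rn x <= rho by rewrite xE s0.
  have e4 : 0 < e / 4 by rewrite divr_gt0.
  have [N HN] := QE _ x1 _ e4; exists N => n /HN; rewrite xE => Hn.
  have -> : k0 n * l - c2 n
    = (k0 n * Q x - c2 n - x * c3 n) + (x * c3 n - k0 n * (Q x - l)) by ring.
  apply: le_trans (rnD _ _) _; apply: le_trans (lerD Hn (rn_triB _ _)) _.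
  rewrite !rnM xE; have /andP[_ k0n] := k0B n.
  have h1 : s * rn (c3 n) <= e / 4.
    apply: (@le_trans _ _ (e / (4 * B) * B)); last by rewrite invfM mulrA divfK ?gt_eqF.
    by apply: ler_pM; rewrite ?rn_ge0 ?(ltW s0).
  have h2 : rn (k0 n) * rn (Q x - l) <= e / 4.
    apply: (@le_trans _ _ (B * (e / (4 * B)))); last by rewrite mulrC invfM mulrA divfK ?gt_eqF.
    by apply: ler_pM; rewrite ?rn_ge0 //; apply: dP; rewrite xE s0; lra.
  have h3 : M * s ^+ 2 <= e / 4.
    have : (M + 1) * s <= e / 4 by move: sM; rewrite invfM mulrA ler_pdivlMr ?ltr_wpDl //; lra.
    have : M * s ^+ 2 <= M * s by rewrite ler_wpM2l // expr2 ler_piMr // ltW.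
    by lra.
  lra.
have P x : 0 < rn x <= rho -> forall e, 0 < e -> exists N, forall n,
    (N <= n)%N -> rn (k0 n * ((Q x - l) / x) - c3 n) <= M * rn x + e.
  move=> xP e e0; have x0 : 0 < rn x by case/andP: xP.
  have ex : 0 < e * rn x / 2 by rewrite divr_gt0 // mulr_gt0.
  have [N HN] := QE _ xP _ ex; have [N' HN'] := L _ ex.
  exists (maxn N N') => n; rewrite geq_max => /andP[/HN h1 /HN' h2].
  rewrite -(ler_pM2r x0) -rnM.
  have -> : (k0 n * ((Q x - l) / x) - c3 n) * x
      = (k0 n * Q x - c2 n - x * c3 n) - (k0 n * l - c2 n).
    by field; rewrite -rn_gt0.
  apply: le_trans (rn_triB _ _) _; apply: le_trans (lerD h1 h2) _.
  by rewrite le_eqVlt; apply/orP; left; apply/eqP; field.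
apply: punctured_lim rho0 _ => x y xP yP.
apply/ler_addgt0Pr => e e0; have e8 : 0 < e / 8 by rewrite divr_gt0.
have [[N HN] [N' HN']] := (P _ xP _ e8, P _ yP _ e8).
have := HN _ (leq_maxl N N'); have := HN' _ (leq_maxr N N').
set n := maxn N N'; set px := (Q x - l) / x; set py := (Q y - l) / y => hy hx.
have := rn_triB (k0 n * px - c3 n) (k0 n * py - c3 n).
have -> : k0 n * px - c3 n - (k0 n * py - c3 n) = k0 n * (px - py) by ring.
rewrite rnM => h; have /andP[k0n _] := k0B n.
have : 4^-1 * rn (px - py) <= rn (k0 n) * rn (px - py).
  by rewrite ler_wpM2r ?rn_ge0.
rewrite mulrDr; lra.
Qed.

(** A maximum principle up to a constant: Cauchy's formula bounds f a by the
    values of f on the contour, which lies in the annulus. *)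
Lemma weak_maximum (f : K -> K) (a : K) (r M : R) : 0 < r ->
  (forall z, rn (z - a) <= r -> differentiable f z) ->
  (forall z, r / 4 <= rn (z - a) <= r -> rn (f z) <= M) ->
  rn (f a) <= 128 * M.
Proof.
move=> r0 fd fM; have aa : rn (a - a) <= r / 4 by rewrite subrr rn0 divr_ge0 ?ltW.
have one : 0 < (1 : R) <= 1 by rewrite ltr01 lexx.
apply/ler_addgt0Pr => e e0; have e4 : 0 < e / 4 by rewrite divr_gt0.
have [N /(_ N (leqnn _))] := cauchy_formula r0 aa fd e4.
have k0 := kernel_Im r0 N aa.
set A := contour _ _ _ _; set k := contour _ _ _ _ in k0 *.
have AM : rn A <= 4 * (M / (r / 4) * (2 * 1 * r)).
  have -> : A = small_contour a r a 1 (fun z => f z / (z - a)) N.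
    by apply: eq_bigr => j _; rewrite !shrunk1.
  apply: small_contour_bound => // z; rewrite !mul1r => /andP[z1 _] zr.
  have z0 : 0 < rn (z - a) by lra.
  have fzM : rn (f z) <= M by apply: fM; rewrite zr andbT.
  have M0 : 0 <= M by apply: le_trans fzM; exact: rn_ge0.
  rewrite rnM rnV ler_pM ?rn_ge0 ?invr_ge0 ?rn_ge0 // lef_pV2 ?posrE //; lra.
have {}AM : rn A <= 32 * M.
  by apply: le_trans AM _; rewrite le_eqVlt; apply/orP; left; apply/eqP; field; lra.
have kr : 4^-1 <= rn k.
  by apply: le_trans k0 _; apply: le_trans (ler_norm _) _; exact: rn_Im.
have := rn_subl (f a * k) A; rewrite rnB rnM => h1 h2.
have : rn (f a) * 4^-1 <= rn (f a) * rn k by rewrite ler_wpM2l ?rn_ge0.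
lra.
Qed.

Lemma contour_eq (a : K) (r : R) (g h : K -> K) n : 0 < r ->
  (forall z, r / 4 <= rn (z - a) <= r -> g z = h z) ->
  contour a r g n = contour a r h n.
Proof.
move=> r0 gh; apply/eqP; rewrite -subr_eq0 -rn_eq0 eq_le rn_ge0 andbT.
have aa : rn (a - a) <= r / 4 by rewrite subrr rn0 divr_ge0 ?ltW.
have one : 0 < (1 : R) <= 1 by rewrite ltr01 lexx.
have E f : contour a r f n = small_contour a r a 1 f n.
  by apply: eq_bigr => j _; rewrite !shrunk1.
rewrite !E -[X in _ - X]mul1r -small_contourB.
have := @small_contour_bound _ a r r0 a 1 (fun z => g z - 1 * h z) 0 n aa one.
rewrite mul0r mulr0; apply => z; rewrite mul1r => /andP[z1 _] zr.
by rewrite gh ?mul1r ?subrr ?rn0 // z1.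
Qed.

Lemma contour_bound (a : K) (r M : R) (g : K -> K) n : 0 < r ->
  (forall z, r / 4 <= rn (z - a) <= r -> rn (g z) <= M) ->
  rn (contour a r g n) <= 8 * r * M.
Proof.
move=> r0 gM; have aa : rn (a - a) <= r / 4 by rewrite subrr rn0 divr_ge0 ?ltW.
have one : 0 < (1 : R) <= 1 by rewrite ltr01 lexx.
have -> : contour a r g n = small_contour a r a 1 g n.
  by apply: eq_bigr => j _; rewrite !shrunk1.
have -> : 8 * r * M = 4 * (M * (2 * 1 * r)) by ring.
apply: small_contour_bound => // z; rewrite mul1r => /andP[z1 _] zr.
by apply: gM; rewrite z1.
Qed.

Lemma contour_lin (a : K) (r : R) (c : K) (g h : K -> K) n :
  contour a r (fun z => g z + c * h z) n = contour a r g n + c * contour a r h n.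
Proof.
rewrite /contour mulr_sumr -big_split; apply: eq_bigr => k _.
by rewrite /= -rsumZ -rsumD.
Qed.

(** The contour is invariant under a quarter turn, which multiplies
    (z - a)^-2 dz by - i. *)
Lemma contour_square (a : K) (r : R) n :
  contour a r (fun z => (z - a) ^- 2) n = 0.
Proof.
rewrite /contour; pose S k := rsum (fun z : K => (z - a) ^- 2) n (corner a r k) (corner a r k.+1).
have i0 : imag R != 0 by rewrite -rn_gt0 rn_imag.
have SE k : S k.+1 = (imag R)^-1 * S k.
  rewrite /S; have cE j : corner a r j.+1 = a + imag R * (corner a r j - a).
    by rewrite /corner exprS; ring.
  by rewrite (cE k.+1) (cE k) rsum_scale // -(cE k).
have iV : (imag R)^-1 = - imag R.
  by apply: (mulfI i0); rewrite divff // mulrN sqr_imag opprK.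
rewrite !big_ord_recr big_ord0 /= -!/(S _) !SE iV !mulrA mulrNN sqr_imag.
ring.
Qed.

(** Extended to a by the derivative, so that it is holomorphic when f is. *)
Definition quotient (f : K -> K) (a z : K) : K :=
  if z == a then 'd f a (1 : K) else (f z - f a) / (z - a).

Lemma quotientE (f : K -> K) (a z : K) : f z = f a + (z - a) * quotient f a z.
Proof.
rewrite /quotient; case: eqVneq => [->|za]; first by rewrite subrr mul0r addr0.
by rewrite mulrC divfK ?subr_eq0 // addrC subrK.
Qed.

Lemma quotient_cvg (f : K -> K) (a : K) : differentiable f a ->
  forall e, 0 < e -> exists2 d, 0 < d & forall z, rn (z - a) < d ->
    rn (quotient f a z - quotient f a a) <= e.
Proof.
move=> fd e e0; have [d d0 dP] := diff_rn fd e0; exists d => // z zd.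
rewrite /quotient eqxx; case: eqVneq => [_|za]; first by rewrite subrr rn0 ltW.
have := dP _ zd; rewrite (linear1E ('d f a)) [a + _]addrC subrK.
have -> : f z - f a - (z - a) * 'd f a 1
   = ((f z - f a) / (z - a) - 'd f a 1) * (z - a) by field; rewrite subr_eq0.
by rewrite rnM ler_pM2r // rn_gt0 subr_eq0.
Qed.

Definition mul_by (l x : K) : K := x * l.

Fact mul_by_linear l : linear (mul_by l).
Proof. by move=> k x y; rewrite /mul_by mulrDl /GRing.scale /= mulrA. Qed.

HB.instance Definition _ l :=
  GRing.isLinear.Build K K K _ (mul_by l) (mul_by_linear l).

Lemma mul_by_continuous l : continuous (mul_by l).
Proof.
move=> x; apply/continuous_rn => e e0.
have l0 : 0 < rn l + 1 by rewrite ltr_wpDl ?rn_ge0.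
exists (e / (rn l + 1)); first by rewrite divr_gt0.
move=> y; rewrite /mul_by -mulrBl rnM ltr_pdivlMr // => h.
by apply: le_lt_trans h; rewrite ler_wpM2l ?rn_ge0 // lerDl.
Qed.

Lemma differentiable_K (q : K -> K) (a l : K) :
  (forall e, 0 < e -> exists2 d, 0 < d & forall x, rn x < d ->
     rn (q (a + x) - q a - x * l) <= e * rn x) ->
  differentiable q a /\ 'd q a (1 : K) = l.
Proof.
move=> ql; have [] := @rn_diff R K K q (mul_by l) a (@mul_by_continuous l).
  exact: ql.
move=> dq E; split=> //; have := congr1 (fun h : K -> K => h 1) E.
by move=> ->; exact: mul1r.
Qed.

(** The difference quotient is differentiable at a itself. Cauchy's formula at
    a + x and at a expresses it by contour sums, and expanding 1 / (z - a - x)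
    in powers of x gives its Taylor expansion; the term of first order of the
    kernel vanishes by [contour_square]. *)
Lemma quotient_differentiable (f : K -> K) (a : K) (r : R) : 0 < r ->
  (forall z, rn (z - a) <= r -> differentiable f z) ->
  differentiable (quotient f a) a.
Proof.
move=> r0 fd0; pose l : K := 'd f a 1.
have ra : rn (a - a) <= r by rewrite subrr rn0 ltW.
have [d d0 dP] := quotient_cvg (fd0 _ ra) ltr01.
(* on this disc the difference quotient is within 1 of its value at a *)
pose s := Num.min r (d / 2).
have s0 : 0 < s by rewrite lt_min r0 divr_gt0.
have fd z : rn (z - a) <= s -> differentiable f z.
  by move=> zs; apply: fd0; apply: le_trans zs _; rewrite ge_min lexx.
have qs z : rn (z - a) <= s -> rn (quotient f a z) <= rn l + 1.
  move=> zs; have /dP : rn (z - a) < d.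
    apply: le_lt_trans zs _; apply: le_lt_trans (_ : d / 2 < d); last lra.
    by rewrite ge_min lexx orbT.
  by have := rn_subl (quotient f a z) l; rewrite /quotient eqxx -/l; lra.
pose Q := rn l + 1; have Q0 : 0 < Q by rewrite ltr_wpDl ?rn_ge0.
pose g z := f z - f a.
have gE z : g z = (z - a) * quotient f a z.
  by rewrite /g [f z](quotientE f a) addrC addKr.
have gd z : rn (z - a) <= s -> differentiable g z.
  by move=> zs; apply: differentiableB; [exact: fd|exact: differentiable_cst].
have gQ z : rn (z - a) <= s -> rn (g z) <= s * Q.
  by move=> zs; rewrite gE rnM ler_pM ?rn_ge0 // qs.
pose ker w n := contour a s (fun z => (z - w)^-1) n.
pose c p n := contour a s (fun z => g z / (z - a) ^+ p) n.
have aa : rn (a - a) <= s / 4 by rewrite subrr rn0 divr_ge0 ?ltW.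
pose M : R := 8 * s * ((4 / s) ^+ 2 * (8 / s)) * Q + 8 * s * (s * Q * ((4 / s) ^+ 3 * (8 / s))).
have far z w : s / 4 <= rn (z - a) <= s -> rn (w - a) <= s / 8 ->
    [/\ z - a != 0, z - w != 0 & rn (z - w)^-1 <= 8 / s].
  move=> /andP[z1 z2] w1; have := rn_dist w z a => h.
  have zw : s / 8 <= rn (z - w) by lra.
  split; rewrite -?rn_gt0; [clear -z1 r0 s0; lra|clear -zw s0; lra|].
  by rewrite rnV -[leRHS]invf_div lef_pV2 ?posrE //; lra.
have inva z : s / 4 <= rn (z - a) <= s -> rn (z - a)^-1 <= 4 / s.
  move=> /andP[z1 z2]; rewrite rnV -[leRHS]invf_div lef_pV2 ?posrE //; lra.
have main x : 0 < rn x <= s / 8 -> forall e, 0 < e -> exists N, forall n,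
    (N <= n)%N -> rn (ker a n * quotient f a (a + x) - c 2%N n - x * c 3%N n)
                  <= M * rn x ^+ 2 + e.
  move=> /andP[x0 x1] e e0; set w := a + x.
  have wx : w - a = x by rewrite /w [a + x]addrC addrK.
  have w8 : rn (w - a) <= s / 8 by rewrite wx.
  have w4 : rn (w - a) <= s / 4 by rewrite wx; lra.
  have ex : 0 < e * rn x / 2 by rewrite divr_gt0 // mulr_gt0.
  have [N1 H1] := cauchy_formula s0 w4 gd ex.
  have [N2 H2] := cauchy_formula s0 aa gd ex.
  exists (maxn N1 N2) => n; rewrite geq_max => /andP[/H1 {}H1 /H2 {}H2].
  rewrite {2}/g subrr mul0r subr0 in H2.
  (* E1 and E2 are expansions in x of the kernel at w = a + x *)
  have E1 : contour a s (fun z => g z / (z - w)) n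
     = c 1%N n + x * c 2%N n + x ^+ 2 * c 3%N n
       + x ^+ 3 * contour a s (fun z => g z / ((z - a) ^+ 3 * (z - w))) n.
    rewrite -!contour_lin; apply: contour_eq => // z za.
    have [za0 zw0 _] := far z w za w8.
    have xE : x = w - a by rewrite wx.
    by rewrite xE; field; rewrite za0 zw0.
  have E2 : ker w n = ker a n
       + x ^+ 2 * contour a s (fun z => ((z - a) ^+ 2 * (z - w))^-1) n.
    have -> : ker a n = ker a n + x * contour a s (fun z => (z - a) ^- 2) n.
      by rewrite contour_square mulr0 addr0.
    rewrite -!contour_lin; apply: contour_eq => // z za.
    have [za0 zw0 _] := far z w za w8.
    have xE : x = w - a by rewrite wx.
    by rewrite xE; field; rewrite za0 zw0.
  have B1 : rn (contour a s (fun z => g z / ((z - a) ^+ 3 * (z - w))) n)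
      <= 8 * s * (s * Q * ((4 / s) ^+ 3 * (8 / s))).
    apply: contour_bound => // z za; have [za0 zw0 zw] := far z w za w8.
    have iza := inva z za; have /andP[_ zs] := za.
    rewrite invfM !rnM; apply: ler_pM; rewrite ?rn_ge0 ?mulr_ge0 ?rn_ge0 ?gQ //.
    by rewrite -exprVn rnX ler_pM ?exprn_ge0 ?rn_ge0 // lerXn2r ?nnegrE ?rn_ge0 // divr_ge0 // ltW.
  have B2 : rn (contour a s (fun z => ((z - a) ^+ 2 * (z - w))^-1) n)
      <= 8 * s * ((4 / s) ^+ 2 * (8 / s)).
    apply: contour_bound => // z za; have [za0 zw0 zw] := far z w za w8.
    have iza := inva z za; have /andP[_ zs] := za.
    rewrite invfM !rnM.
    by rewrite -exprVn rnX ler_pM ?exprn_ge0 ?rn_ge0 // lerXn2r ?nnegrE ?rn_ge0 // divr_ge0 // ltW.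
  rewrite -(ler_pM2r x0) -rnM; set q := quotient f a w.
  pose b1 := contour a s (fun z => g z / ((z - a) ^+ 3 * (z - w))) n.
  pose b2 := contour a s (fun z => ((z - a) ^+ 2 * (z - w))^-1) n.
  rewrite -/b1 in E1 B1; rewrite -/b2 in E2 B2.
  have -> : (ker a n * q - c 2%N n - x * c 3%N n) * x
    = c 1%N n + x ^+ 3 * b1 - (q * (x ^+ 3 * b2))
      - (contour a s (fun z => g z / (z - w)) n - g w * ker w n).
    by rewrite E1 E2 gE -/q wx; ring.
  have {}H2 : rn (c 1%N n) <= e * rn x / 2.
    apply: le_trans H2; rewrite le_eqVlt; apply/orP; left; apply/eqP.
    by congr rn; apply: contour_eq => // z _; rewrite expr1.
  apply: le_trans (rn_triB _ _) _; rewrite -/(ker w n) in H1.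
  have h3 : rn (x ^+ 3 * b1) <= rn x ^+ 3 * (8 * s * (s * Q * ((4 / s) ^+ 3 * (8 / s)))).
    by rewrite rnM rnX ler_wpM2l // exprn_ge0 // ltW.
  have h4 : rn (q * (x ^+ 3 * b2)) <= Q * (rn x ^+ 3 * (8 * s * ((4 / s) ^+ 2 * (8 / s)))).
    rewrite (rnM q) (rnM (x ^+ 3)) rnX ler_pM ?rn_ge0 ?mulr_ge0 ?exprn_ge0 ?rn_ge0 //.
      by apply: qs; clear -s0 w4; lra.
    by rewrite ler_wpM2l // exprn_ge0 // ltW.
  have := rn_triB (c 1%N n + x ^+ 3 * b1) (q * (x ^+ 3 * b2)).
  have := rnD (c 1%N n) (x ^+ 3 * b1) => h5 h6.
  have -> : (M * rn x ^+ 2 + e) * rn x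
    = rn x ^+ 3 * (8 * s * (s * Q * ((4 / s) ^+ 3 * (8 / s))))
      + Q * (rn x ^+ 3 * (8 * s * ((4 / s) ^+ 2 * (8 / s)))) + e * rn x by rewrite /M; ring.
  by clear -h3 h4 h5 h6 H1 H2; lra.
have s8 : 0 < s / 8 by rewrite divr_gt0.
have c3B n : rn (c 3%N n) <= 8 * s * (s * Q * (4 / s) ^+ 3).
  apply: contour_bound => // z za; have iza := inva z za; have /andP[_ zs] := za.
  rewrite rnM -exprVn rnX ler_pM ?exprn_ge0 ?rn_ge0 ?gQ //.
  by rewrite lerXn2r ?nnegrE ?rn_ge0 // divr_ge0 // ltW.
have k0B n : rn (ker a n) <= 8 * s * (4 / s).
  by apply: contour_bound => // z za; exact: inva.
have k0ge n : 4^-1 <= rn (ker a n).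
  apply: le_trans (kernel_Im s0 n aa) _; apply: le_trans (ler_norm _) _.
  exact: rn_Im.
pose B := 8 * s * (s * Q * (4 / s) ^+ 3) + 8 * s * (4 / s).
have c3B0 : 0 <= 8 * s * (s * Q * (4 / s) ^+ 3) := le_trans (rn_ge0 _) (c3B 0%N).
have k0B0 : 0 <= 8 * s * (4 / s) := le_trans (rn_ge0 _) (k0B 0%N).
have [p pP] : exists p, forall x, 0 < rn x <= s / 8 ->
    rn ((quotient f a (a + x) - l) / x - p) <= 4 * M * rn x.
  apply: (@quotient_lim (fun x => quotient f a (a + x)) (ker a) (c 2%N) (c 3%N) l _ B M) => //.
  - by move=> n; rewrite k0ge; apply: le_trans (k0B n) _; rewrite /B lerDr.
  - by move=> n; apply: le_trans (c3B n) _; rewrite /B lerDl.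
  - move=> e e0; have [d' d'0 dP'] := quotient_cvg (fd0 _ ra) e0.
    exists d' => // x /andP[_ xd]; have := dP' (a + x).
    by rewrite [a + x]addrC addrK /quotient eqxx; apply.
have [] // := @differentiable_K (quotient f a) a p.
move=> e e0; have M0 : 0 <= M.
  by rewrite /M addr_ge0 // !mulr_ge0 // ?exprn_ge0 // ?mulr_ge0 ?invr_ge0 // ltW.
exists (Num.min (s / 8) (e / (4 * M + 1))).
  by rewrite lt_min s8 divr_gt0 // ltr_wpDl // mulr_ge0.
move=> x; rewrite lt_min => /andP[x1 x2].
have [->|x0] := eqVneq x 0; first by rewrite addr0 mul0r subr0 subrr !rn0 mulr0.
have rx0 : 0 < rn x by rewrite rn_gt0.
have xP : 0 < rn x <= s / 8 by rewrite rx0 ltW.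
have -> : quotient f a (a + x) - quotient f a a - x * p
   = ((quotient f a (a + x) - l) / x - p) * x.
  by rewrite {2}/quotient eqxx -/l; field.
rewrite rnM ler_pM2r //; apply: le_trans (pP _ xP) _.
move: x2; rewrite ltr_pdivlMr ?ltr_wpDl ?mulr_ge0 //.
by move: (rn_ge0 x); clear; lra.
Qed.

End DifferenceQuotient.

(** * Estimates in one variable *)

Section OneVariable.
Variable R : realType.
Notation K := (C R).

Lemma eq_diff_near (V W : normedModType K) (f g : V -> W) (x : V) (d : R) :
  0 < d -> (forall y, rn (x - y) < d -> f y = g y) -> differentiable f x ->
  differentiable g x /\ 'd g x = 'd f x :> (V -> W).
Proof.
move=> d0 fg fd; have xx : rn (x - x) < d by rewrite subrr rn0.
apply: rn_diff; first exact: diff_continuous.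
move=> e e0; have [d' d'0 dP] := diff_rn fd e0.
exists (Num.min d d'); first by rewrite lt_min d0.
move=> h; rewrite lt_min => /andP[h1 h2]; rewrite -!fg //; first exact: dP.
by rewrite opprD addrA subrr add0r rnN.
Qed.

Lemma quotient_holomorphic (f : K -> K) (a : K) (r : R) : 0 < r ->
  (forall z, rn (z - a) < r -> differentiable f z) ->
  forall z, rn (z - a) < r -> differentiable (quotient f a) z.
Proof.
move=> r0 fd z zr; have [->|za] := eqVneq z a.
  have r2 : 0 < r / 2 by rewrite divr_gt0.
  by apply: (quotient_differentiable r2) => w wr; apply: fd; lra.
have za0 : 0 < rn (z - a) by rewrite rn_gt0 subr_eq0.
apply: (proj1 (@eq_diff_near _ _ (fun w => (f w - f a) / (w - a)) _ z _ za0 _ _)).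
  move=> w; rewrite /quotient; case: (eqVneq w a) => [->|//].
  by rewrite ltxx.
apply: differentiableM.
  by apply: differentiableB; [exact: fd|exact: differentiable_cst].
apply: differentiableV; last by rewrite subr_eq0.
by apply: differentiableB => //; exact: differentiable_cst.
Qed.

(** The constant of the Cauchy estimates: 128 comes from the maximum principle
    and 32 from the difference quotient on the annulus in [quotient_bound]. *)
Definition Cq : R := locked (128 * 32).

Lemma Cq_ge1 : 1 <= Cq. Proof. rewrite /Cq -lock; lra. Qed.

Lemma Cq_gt0 : 0 < Cq. Proof. have := Cq_ge1; lra. Qed.

(** Away from a the bound is immediate. Close to a it follows from the maximum
    principle, since the difference quotient is holomorphic. *)
Lemma quotient_bound (f : K -> K) (a : K) (r M : R) : 0 < r ->
  (forall z, rn (z - a) < r -> differentiable f z) ->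
  (forall z, rn (z - a) < r -> rn (f z) <= M) ->
  forall z, rn (z - a) < r -> rn (quotient f a z) <= Cq / r * M.
Proof.
move=> r0 fd fM z zr.
have aa : rn (a - a) < r by rewrite subrr rn0.
have far w : rn (w - a) < r -> r / 16 <= rn (w - a) ->
    rn (quotient f a w) <= 32 / r * M.
  move=> w1 w2; have w0 : 0 < rn (w - a) by lra.
  have wa : w != a by move: w0; rewrite rn_gt0 subr_eq0.
  rewrite /quotient (negPf wa) rnM rnV ler_pdivrMr //.
  have := rn_triB (f w) (f a); have := fM _ w1; have := fM _ aa => h1 h2 h3.
  have M0 : 0 <= M by apply: le_trans h1; exact: rn_ge0.
  have : 32 / r * M * (r / 16) <= 32 / r * M * rn (w - a).
    by rewrite ler_wpM2l // !mulr_ge0 // invr_ge0 ltW.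
  have -> : 32 / r * M * (r / 16) = 2 * M by field; rewrite gt_eqF.
  lra.
have M0 : 0 <= M / r by rewrite divr_ge0 ?(ltW r0) //; apply: le_trans (fM _ aa); exact: rn_ge0.
have -> : Cq / r * M = Cq * (M / r) by ring.
have [z1|z1] := leP (r / 16) (rn (z - a)).
  apply: le_trans (far _ zr z1) _; have -> : 32 / r * M = 32 * (M / r) by ring.
  by rewrite /Cq -lock; lra.
have r2 : 0 < r / 2 by rewrite divr_gt0.
have near w : rn (w - z) <= r / 2 -> rn (w - a) < r.
  by move=> h; have := rn_dist z w a; lra.
have := @weak_maximum R (quotient f a) z (r / 2) (32 / r * M) r2.
have -> : 128 * (32 / r * M) = Cq * (M / r) by rewrite /Cq -lock; ring.
apply.
- by move=> w wz; apply: (quotient_holomorphic r0 fd); exact: near.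
- move=> w /andP[w1 w2]; apply: far; first exact: near.
  by have := rn_dist a w z; rewrite (rnB a z); lra.
Qed.

Section Bounded.
Variables (f : K -> K) (a : K) (r M : R).
Hypothesis r0 : 0 < r.
Hypothesis fd : forall z, rn (z - a) < r -> differentiable f z.
Hypothesis fM : forall z, rn (z - a) < r -> rn (f z) <= M.

Let aa : rn (a - a) < r. Proof. by rewrite subrr rn0. Qed.

Lemma derivative_bound : rn ('d f a (1 : K) : K) <= Cq / r * M.
Proof.
by have := quotient_bound r0 fd fM aa; rewrite /quotient eqxx.
Qed.

Lemma lipschitz_bound z : rn (z - a) < r ->
  rn (f z - f a) <= Cq / r * M * rn (z - a).
Proof.
move=> zr; rewrite [f z](quotientE f a) addrC addKr rnM mulrC.
by rewrite ler_wpM2r ?rn_ge0 //; exact: quotient_bound.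
Qed.

(** The remainder is (z - a) ^+ 2 times a difference quotient of a difference
    quotient. *)
Lemma taylor_bound z : rn (z - a) < r ->
  rn (f z - f a - (z - a) * 'd f a (1 : K)) <= (Cq / r) ^+ 2 * M * rn (z - a) ^+ 2.
Proof.
move=> zr; set q := quotient f a.
have qd := quotient_holomorphic r0 fd; have qM := quotient_bound r0 fd fM.
have -> : f z - f a - (z - a) * 'd f a (1 : K)
   = (z - a) * ((z - a) * quotient q a z).
  rewrite [f z](quotientE f a) -/q [q z](quotientE q a).
  by rewrite {1}/q /quotient eqxx; ring.
rewrite !rnM mulrA -expr2 mulrC ler_wpM2r ?exprn_ge0 ?rn_ge0 //.
by rewrite expr2 -mulrA; exact: (quotient_bound r0 qd qM).
Qed.

Definition iter_quotient k := iter k (fun g => quotient g a) f.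

Lemma iter_quotientP k : (forall z, rn (z - a) < r ->
    differentiable (iter_quotient k) z) /\
  (forall z, rn (z - a) < r -> rn (iter_quotient k z) <= (Cq / r) ^+ k * M).
Proof.
elim: k => [|k [IH1 IH2]]; first by split=> // z /fM; rewrite expr0 mul1r.
split; first exact: quotient_holomorphic.
by move=> z zr; rewrite exprS -mulrA; exact: (quotient_bound r0 IH1 IH2).
Qed.

Lemma iter_quotientE k : (forall j, (j < k)%N -> iter_quotient j a = 0) ->
  forall z, f z = (z - a) ^+ k * iter_quotient k z.
Proof.
elim: k => [|k IH] q0 z; first by rewrite expr0 mul1r.
rewrite IH => [|j jk]; last by apply: q0; exact: ltnW.
by rewrite [iter_quotient k z](quotientE _ a) q0 // add0r mulrA -exprSr.
Qed.

(** If no iterated difference quotient is nonzero at a, then f is divisible by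
    every power of z - a, with quotients bounded by a geometric progression;
    so f vanishes on a disc of definite size. *)
Lemma zero_order :
  (exists k g, [/\ forall z, rn (z - a) < r -> differentiable g z,
     g a != 0 & forall z, f z = (z - a) ^+ k * g z]) \/
  (forall z, rn (z - a) <= r / (2 * Cq) -> f z = 0).
Proof.
have [[k qk]|no] := pselect (exists k, iter_quotient k a != 0).
  left; have [m qm mP] := ex_minnP (ex_intro (fun k => iter_quotient k a != 0) k qk).
  exists m, (iter_quotient m); split=> //; first exact: (iter_quotientP m).1.
  apply: iter_quotientE => j jm; apply/eqP; apply: contraTT jm => /mP.
  by rewrite leqNgt.
right=> z za; have r_gt0 := r0; have C0 := Cq_gt0.
have q0 k : iter_quotient k a = 0.
  by apply/eqP; apply: contraPT no => h; case; exists k.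
have zr : rn (z - a) < r.
  apply: le_lt_trans za _; rewrite ltr_pdivrMr ?mulr_gt0 // ltr_pMr //.
  by have := Cq_ge1; lra.
apply/eqP; rewrite -rn_eq0 eq_le rn_ge0 andbT leNgt; apply/negP => fz0.
have [k] := geo_small M fz0; apply/negP; rewrite -leNgt.
rewrite {1}(@iter_quotientE k _ z) => [|j _]; last exact: q0.
have M0 : 0 <= M by apply: le_trans (fM aa); exact: rn_ge0.
rewrite rnM rnX; apply: le_trans (_ : (r / (2 * Cq)) ^+ k * ((Cq / r) ^+ k * M) <= _).
  rewrite ler_pM ?exprn_ge0 ?rn_ge0 //; last exact: (iter_quotientP k).2.
  by rewrite lerXn2r ?nnegrE ?rn_ge0 // divr_ge0 // ?ltW // mulr_gt0.
rewrite mulrA -exprMn (_ : r / (2 * Cq) * (Cq / r) = 2^-1); last first.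
  by field; rewrite !gt_eqF.
by rewrite exprVn mulrC.
Qed.

End Bounded.
End OneVariable.

(** * Holomorphic functions on a normed space *)

Section SeveralVariables.
Variable R : realType.
Notation K := (C R).
Variable V : normedModType K.
Implicit Types (f : V -> K) (x y v : V).

Lemma line_diff f x y (s : K) : differentiable f (x + s *: y) ->
  differentiable (fun t : K => f (x + t *: y)) s /\
  'd (fun t : K => f (x + t *: y)) s (1 : K) = 'd f (x + s *: y) y.
Proof.
move=> fd; apply: differentiable_K => e e0.
have y0 : 0 < rn y + 1 by rewrite ltr_wpDl ?rn_ge0.
have [d d0 dP] := diff_rn fd (divr_gt0 e0 y0).
exists (d / (rn y + 1)); first exact: divr_gt0.
move=> t; rewrite ltr_pdivlMr // => td.
have ty : rn (t *: y) <= rn t * (rn y + 1).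
  by rewrite rnZ ler_wpM2l ?rn_ge0 // lerDl.
have := dP (t *: y) (le_lt_trans ty td).
have -> : x + s *: y + t *: y = x + (s + t) *: y by rewrite scalerDl addrA.
rewrite linearZ_LR => h; apply: le_trans h _.
rewrite mulrAC ler_pdivrMr // -mulrA ler_wpM2l //; exact: ltW.
Qed.

Lemma line_in x y (r : R) (s : K) : 0 < r -> y != 0 -> rn (s - 0) < r / rn y ->
  rn (x + s *: y - x) < r.
Proof.
move=> r0 y0; rewrite subr0 ltr_pdivlMr ?rn_gt0 //.
by rewrite (addrC x) addrK rnZ.
Qed.

Section Bounds.
Variables (f : V -> K) (x : V) (r M : R).
Hypothesis r0 : 0 < r.
Hypothesis fd : forall z, rn (z - x) < r -> differentiable f z.
Hypothesis fM : forall z, rn (z - x) < r -> rn (f z) <= M.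

Let line y (t : K) := f (x + t *: y).

Let M0 : 0 <= M.
Proof.
have := @fM x; rewrite subrr rn0 => /(_ r0); apply: le_trans; exact: rn_ge0.
Qed.

Let line_d y s : y != 0 -> rn (s - 0) < r / rn y ->
  differentiable (line y) s.
Proof. by move=> y0 sr; apply: (proj1 (line_diff _)); apply: fd; exact: line_in. Qed.

Let line_M y s : y != 0 -> rn (s - 0) < r / rn y -> rn (line y s) <= M.
Proof. by move=> y0 sr; apply: fM; exact: line_in. Qed.

Let line_D y : 'd (line y) 0 (1 : K) = 'd f x y.
Proof.
have := @line_diff f x y 0; rewrite scale0r addr0 => /(_ _)[|_ //].
by apply: fd; rewrite subrr rn0.
Qed.

(** The bounds on V follow from those in one variable by restriction to
    complex lines. *)
Lemma differential_bound y : rn ('d f x y : K) <= Cq R / r * M * rn y.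
Proof.
have [->|y0] := eqVneq y 0; first by rewrite linear0 !rn0 mulr0.
have ry : 0 < r / rn y by rewrite divr_gt0 // rn_gt0.
have := derivative_bound ry (fun s => line_d y0) (fun s => line_M y0).
have E : Cq R / (r / rn y) * M = Cq R / r * M * rn y by field; rewrite !gt_eqF // rn_gt0.
by rewrite line_D E.
Qed.

Let line1 y : y != 0 -> rn y < r -> rn ((1 : K) - 0) < r / rn y.
Proof. by move=> y0 yr; rewrite subr0 rn1 ltr_pdivlMr ?rn_gt0 // mul1r. Qed.

Lemma lipschitz_at y : rn y < r -> rn (f (x + y) - f x) <= Cq R / r * M * rn y.
Proof.
move=> yr; have [->|y0] := eqVneq y 0; first by rewrite addr0 subrr !rn0 mulr0.
have ry : 0 < r / rn y by rewrite divr_gt0 // rn_gt0.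
have := lipschitz_bound ry (fun s => line_d y0) (fun s => line_M y0) (line1 y0 yr).
rewrite /line scale1r scale0r addr0 subr0 rn1 mulr1.
have E : Cq R / (r / rn y) * M = Cq R / r * M * rn y by field; rewrite !gt_eqF // rn_gt0.
by rewrite E.
Qed.

Lemma taylor_at y : rn y < r ->
  rn (f (x + y) - f x - 'd f x y) <= (Cq R / r) ^+ 2 * M * rn y ^+ 2.
Proof.
move=> yr; have [->|y0] := eqVneq y 0.
  by rewrite addr0 subrr linear0 subr0 !rn0 expr0n mulr0.
have ry : 0 < r / rn y by rewrite divr_gt0 // rn_gt0.
have := taylor_bound ry (fun s => line_d y0) (fun s => line_M y0) (line1 y0 yr).
rewrite line_D /line scale1r scale0r addr0 subr0 mul1r rn1 expr1n mulr1.
have E : (Cq R / (r / rn y)) ^+ 2 * M = (Cq R / r) ^+ 2 * M * rn y ^+ 2 by field; rewrite !gt_eqF // rn_gt0.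
by rewrite E.
Qed.

End Bounds.

Lemma taylor_lim (f : V -> K) (x : V) (L : {linear V -> K}) (r A B : R) : 0 < r ->
  (forall y, rn (L y : K) <= A * rn y) ->
  (forall y, rn y < r -> rn (f (x + y) - f x - L y) <= B * rn y ^+ 2) ->
  differentiable f x /\ 'd f x = L :> (V -> K).
Proof.
move=> r0 LA fB; apply: rn_diff.
  have A1 : 0 < `|A| + 1 by rewrite ltr_wpDl.
  move=> z; apply/continuous_rn => e e0; exists (e / (`|A| + 1)).
    exact: divr_gt0.
  move=> y; rewrite ltr_pdivlMr // => h; rewrite -linearB; apply: le_lt_trans h.
  apply: le_trans (LA _) _; rewrite mulrC ler_wpM2l ?rn_ge0 //.
  by apply: le_trans (ler_norm _) _; rewrite lerDl.
move=> e e0; have B1 : 0 < `|B| + 1 by rewrite ltr_wpDl.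
exists (Num.min r (e / (`|B| + 1))); first by rewrite lt_min r0 divr_gt0.
move=> y; rewrite lt_min ltr_pdivlMr // => /andP[yr ye].
apply: le_trans (fB _ yr) _; rewrite expr2 mulrA ler_wpM2r ?rn_ge0 //.
apply: le_trans (ltW ye); rewrite mulrC ler_wpM2l ?rn_ge0 //.
by apply: le_trans (ler_norm _) _; rewrite lerDl.
Qed.

Lemma diff_subE (f g : V -> K) x y : differentiable f x -> differentiable g x ->
  'd (fun z => f z - g z) x y = 'd f x y - 'd g x y :> K.
Proof.
by move=> fd gd; have := congr1 (fun h : V -> K => h y) (diffB fd gd).
Qed.

Lemma differential_dist (f g : V -> K) x y (r M : R) : 0 < r ->
  (forall z, rn (z - x) < r -> differentiable f z) ->
  (forall z, rn (z - x) < r -> differentiable g z) ->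
  (forall z, rn (z - x) < r -> rn (f z - g z) <= M) ->
  rn ('d f x y - 'd g x y : K) <= Cq R / r * M * rn y.
Proof.
move=> r0 fd gd fgM; have xx : rn (x - x) < r by rewrite subrr rn0.
rewrite -(diff_subE y (fd x xx) (gd x xx)).
have dif z : rn (z - x) < r -> differentiable (fun z => f z - g z) z.
  by move=> zr; apply: differentiableB; [exact: fd|exact: gd].
exact: (differential_bound r0 dif fgM y).
Qed.

Lemma shift_diff f z w : differentiable f (z + w) ->
  differentiable (fun u => f (u + w)) z.
Proof.
move=> fd; apply: (proj1 (@rn_diff _ _ _ _ ('d f (z + w)) _ _ _)).
  exact: diff_continuous.
move=> e e0; have [d d0 dP] := diff_rn fd e0; exists d => // h /dP.
by rewrite (addrAC z w h).
Qed.

Lemma ler_small (p q B rho : R) : 0 < rho ->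
  (forall t : K, 0 < rn t <= rho -> p <= q + B * rn t) -> p <= q.
Proof.
move=> rho0 H; apply/ler_addgt0Pr => e e0.
have B1 : 0 < `|B| + 1 by rewrite ltr_wpDl.
pose s := Num.min rho (e / (`|B| + 1)).
have s0 : 0 < s by rewrite lt_min rho0 divr_gt0.
have := H (RtoC s); rewrite rn_real gtr0_norm // s0 ge_min lexx => /(_ isT) h.
apply: le_trans h _; rewrite lerD2l.
have : s <= e / (`|B| + 1) by rewrite ge_min lexx orbT.
rewrite ler_pdivlMr // => h; apply: le_trans h; rewrite mulrC ler_wpM2l ?(ltW s0) //.
by apply: le_trans (ler_norm _) _; rewrite lerDl.
Qed.

Lemma eq0_small (p : K) (B rho : R) : 0 < rho ->
  (forall t : K, 0 < rn t <= rho -> rn p <= B * rn t) -> p = 0.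
Proof.
move=> rho0 H; apply/eqP; rewrite -rn_eq0 eq_le rn_ge0 andbT.
by apply: (ler_small rho0) => t /H; rewrite add0r; apply.
Qed.

(** The difference quotients of f in the direction v converge uniformly, and a
    uniform limit of differentiable functions is differentiable because the
    bounds above control their second order remainders. *)
Theorem differential_differentiable f x v (r M : R) : 0 < r ->
  (forall z, rn (z - x) < 4 * r -> differentiable f z) ->
  (forall z, rn (z - x) < 4 * r -> rn (f z) <= M) ->
  differentiable (fun z => 'd f z v : K) x.
Proof.
move=> r0 fd fM; set G := fun z => 'd f z v : K.
have [v0|v0] := eqVneq v 0.
  have -> : G = cst 0 by apply/funext => z; rewrite /G v0 linear0.
  exact: differentiable_cst.
have rv : 0 < rn v by rewrite rn_gt0.
pose t0 := r / rn v; have t00 : 0 < t0 by rewrite divr_gt0.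
pose g (t : K) z := t^-1 * (f (z + t *: v) - f z).
have inb z w (p q : R) : rn (z - x) < p -> rn (w - z) < q -> rn (w - x) < p + q.
  by move=> h1 h2; have := rn_dist z w x; lra.
have tv (t : K) : rn t <= t0 / 2 -> rn (t *: v) < r.
  by rewrite /t0 rnZ => h; have : rn t * rn v <= r / rn v / 2 * rn v;
    [rewrite ler_wpM2r ?rn_ge0 //|rewrite mulrAC divfK ?gt_eqF //; lra].
have M0 : 0 <= M by apply: le_trans (fM x _); [exact: rn_ge0|rewrite subrr rn0 mulr_gt0].
pose A := (Cq R / r) ^+ 2 * M * rn v ^+ 2.
have gG (t : K) z : 0 < rn t <= t0 / 2 -> rn (z - x) < 3 * r ->
    rn (g t z - G z) <= A * rn t.
  move=> /andP[tp tt] zx; have td := tv _ tt.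
  have bd w : rn (w - z) < r -> rn (w - x) < 4 * r.
    by move=> wz; have := inb _ _ _ _ zx wz; lra.
  have := @taylor_at f z r M r0 (fun w h => fd w (bd w h)) (fun w h => fM w (bd w h)) _ td.
  rewrite linearZ /= -/(G z).
  have tn : t != 0 by rewrite -rn_gt0.
  have -> : f (z + t *: v) - f z - t *: (G z) = t * (g t z - G z).
    by rewrite /g /GRing.scale /=; field.
  rewrite rnM rnZ exprMn => h; rewrite -(ler_pM2l tp); apply: le_trans h _.
  by rewrite le_eqVlt; apply/orP; left; apply/eqP; rewrite /A; ring.
have gd (t : K) z : rn t <= t0 / 2 -> rn (z - x) < 3 * r -> differentiable (g t) z.
  move=> tt zx; have td := tv _ tt.
  have zx4 : rn (z - x) < 4 * r by clear -zx r0; lra.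
  have ztx4 : rn (z + t *: v - x) < 4 * r.
    have : rn (z + t *: v - z) < r by rewrite [z + _]addrC addrK.
    by move=> h; have := inb _ _ _ _ zx h; lra.
  rewrite /g; apply: differentiableM; first exact: differentiable_cst.
  by apply: differentiableB; [apply: shift_diff; exact: fd|exact: fd].
have Cr0 : 0 < Cq R / r by rewrite divr_gt0 // Cq_gt0.
have A0 : 0 <= A by rewrite /A mulr_ge0 ?exprn_ge0 ?rn_ge0 // mulr_ge0 ?exprn_ge0 // ltW.
have t2 : 0 < t0 / 2 by rewrite divr_gt0.
have in3 z : rn (z - x) < r -> rn (z - x) < 3 * r by move=> h; lra.
have L1 y : exists l : K, forall t : K, 0 < rn t <= t0 / 2 ->
    rn ('d (g t) x y - l) <= Cq R / r * A * rn y * rn t.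
  apply: punctured_lim => // t s tP sP.
  have xx : rn (x - x) < r by rewrite subrr rn0.
  have td := gd t _ (proj2 (andP tP)); have sd := gd s _ (proj2 (andP sP)).
  have bnd z : rn (z - x) < r -> rn (g t z - g s z) <= A * (rn t + rn s).
    move=> /in3 zx; have := gG _ _ tP zx; have := gG _ _ sP zx.
    have := rn_dist (G z) (g t z) (g s z); rewrite (rnB (G z) (g s z)) mulrDr.
    clear; lra.
  have := differential_dist y r0 (fun z h => td z (in3 z h)) (fun z h => sd z (in3 z h)) bnd.
  move=> h; apply: le_trans h _.
  by rewrite le_eqVlt; apply/orP; left; apply/eqP; ring.
have [L0 L0P] := choice L1.
have Llin : linear L0.
  move=> k y z; apply/eqP; rewrite -subr_eq0; apply/eqP.
  pose B := Cq R / r * A * (rn (k *: y + z) + rn k * rn y + rn z).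
  apply: (@eq0_small _ B _ t2) => t tP.
  have h1 := L0P (k *: y + z) t tP; have h2 := L0P y t tP; have h3 := L0P z t tP.
  have E : L0 (k *: y + z) - (k *: L0 y + L0 z)
     = k * ('d (g t) x y - L0 y) + ('d (g t) x z - L0 z)
       - ('d (g t) x (k *: y + z) - L0 (k *: y + z)).
    have E1 : 'd (g t) x (k *: y + z) = k * 'd (g t) x y + 'd (g t) x z.
      exact: linearP.
    by rewrite E1 -[k *: L0 y]/(k * L0 y); ring.
  rewrite [X in rn X]E; apply: le_trans (rn_triB _ _) _.
  have h4 := rnD (k * ('d (g t) x y - L0 y)) ('d (g t) x z - L0 z).
  have h5 : rn (k * ('d (g t) x y - L0 y)) <= rn k * (Cq R / r * A * rn y * rn t).
    by rewrite rnM ler_wpM2l ?rn_ge0.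
  have -> : B * rn t = rn k * (Cq R / r * A * rn y * rn t)
     + Cq R / r * A * rn z * rn t + Cq R / r * A * rn (k *: y + z) * rn t.
    by rewrite /B; ring.
  by clear -h1 h2 h3 h4 h5; lra.
have [L LE] : exists L : {linear V -> K}, L = L0 :> (V -> K).
  pose L : {linear V -> K} := HB.pack L0 (GRing.isLinear.Build K V K _ L0 Llin).
  by exists L.
have GM z : rn (z - x) < 3 * r -> rn (G z) <= Cq R / r * M * rn v.
  move=> zx; have bd w : rn (w - z) < r -> rn (w - x) < 4 * r.
    by move=> wz; have := inb _ _ _ _ zx wz; lra.
  exact: (@differential_bound f z r M r0 (fun w h => fd w (bd w h)) (fun w h => fM w (bd w h))).
pose M' := Cq R / r * M * rn v + A * t0.
have gM (t : K) z : 0 < rn t <= t0 / 2 -> rn (z - x) < 3 * r -> rn (g t z) <= M'.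
  move=> tP zx; have := gG _ _ tP zx; have := GM _ zx.
  have := rn_subl (g t z) (G z).
  have : A * rn t <= A * t0 by rewrite ler_wpM2l //; case/andP: tP; lra.
  by rewrite /M'; lra.
have Lg (t : K) y : 0 < rn t <= t0 / 2 -> rn (L y) <= Cq R / r * M' * rn y + Cq R / r * A * rn y * rn t.
  rewrite LE => tP; have := L0P y t tP.
  have := @differential_bound (g t) x r M' r0 (fun z h => gd t z (proj2 (andP tP)) (in3 z h))
     (fun z h => gM t z tP (in3 z h)) y.
  by have := rn_subl (L0 y) ('d (g t) x y); rewrite (rnB (L0 y)); lra.
have LB y : rn (L y) <= Cq R / r * M' * rn y by apply: (ler_small t2) => t; exact: Lg.
apply: (proj1 (@taylor_lim G x L r _ ((Cq R / r) ^+ 2 * M') r0 LB _)) => y yr.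
apply: (@ler_small _ _ (A + A + Cq R / r * A * rn y) _ t2) => t tP.
have yx : rn (x + y - x) < 3 * r by rewrite [x + y]addrC addrK; lra.
have xx : rn (x - x) < 3 * r by rewrite subrr rn0 mulr_gt0.
have h1 := gG _ _ tP yx; have h2 := gG _ _ tP xx; have h3 := L0P y t tP.
have h4 := @taylor_at (g t) x r M' r0 (fun z h => gd t z (proj2 (andP tP)) (in3 z h))
     (fun z h => gM t z tP (in3 z h)) y yr.
have E : G (x + y) - G x - L y = (g t (x + y) - g t x - 'd (g t) x y)
  - (g t (x + y) - G (x + y)) + (g t x - G x) + ('d (g t) x y - L0 y).
  by rewrite LE; ring.
rewrite [X in rn X]E; apply: le_trans (rnD _ _) _.
have h5 := rnD (g t (x + y) - g t x - 'd (g t) x y - (g t (x + y) - G (x + y))) (g t x - G x).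
have h6 := rn_triB (g t (x + y) - g t x - 'd (g t) x y) (g t (x + y) - G (x + y)).
have -> : (Cq R / r) ^+ 2 * M' * rn y ^+ 2 + (A + A + Cq R / r * A * rn y) * rn t
  = (Cq R / r) ^+ 2 * M' * rn y ^+ 2 + A * rn t + A * rn t + Cq R / r * A * rn y * rn t by ring.
by clear -h1 h2 h3 h4 h5 h6; lra.
Qed.

End SeveralVariables.

(** * Differentials and the identity theorem *)

Section Differentials.
Variable R : realType.
Notation K := (C R).

(** Differentiability and the value of the differential are sealed, so that
    from here on they are used only through the rules below. *)
Inductive dif (V W : normedModType K) (f : V -> W) (x : V) : Prop :=
  Dif of differentiable f x.

Fact D_key : unit. Proof. exact: tt. Qed.

Definition D (V W : normedModType K) (f : V -> W) (x v : V) : W :=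
  locked_with D_key ('d f x v).

Lemma DE (V W : normedModType K) (f : V -> W) (x v : V) : D f x v = 'd f x v.
Proof. by rewrite /D locked_withE. Qed.

Section Basics.
Variables (V W : normedModType K).
Implicit Types (f g : V -> W) (x y v w : V).

Lemma D_rn f x : dif f x -> forall e : R, 0 < e -> exists2 d : R, 0 < d &
  forall h, rn h < d -> rn (f (x + h) - f x - D f x h) <= e * rn h.
Proof.
case=> fd e e0; have [d d0 dP] := diff_rn fd e0; exists d => // h hd.
by rewrite DE; exact: dP.
Qed.

Lemma D_sub f x v w : D f x (v - w) = D f x v - D f x w.
Proof. by rewrite !DE linearB. Qed.

Lemma D_add f x v w : D f x (v + w) = D f x v + D f x w.
Proof. by rewrite !DE linearD. Qed.

Lemma D_scale f x k v : D f x (k *: v) = k *: D f x v.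
Proof. by rewrite !DE linearZ. Qed.

Lemma D0 f x : D f x 0 = 0.
Proof. by rewrite DE linear0. Qed.

Lemma D_sum f x m (v : 'I_m -> V) : D f x (\sum_(i < m) v i) = \sum_(i < m) D f x (v i).
Proof. by rewrite DE linear_sum; apply: eq_bigr => i _; rewrite DE. Qed.

Lemma rn_dif f (L : {linear V -> W}) x : continuous L ->
  (forall e : R, 0 < e -> exists2 d : R, 0 < d &
    forall h, rn h < d -> rn (f (x + h) - f x - L h) <= e * rn h) ->
  dif f x /\ forall v, D f x v = L v.
Proof.
move=> Lc fL; have [fd E] := rn_diff Lc fL; split; first by split.
by move=> v; rewrite DE; exact: (congr1 (fun h : V -> W => h v) E).
Qed.

Lemma eq_dif_near f g x (d : R) : 0 < d ->
  (forall y, rn (x - y) < d -> f y = g y) -> dif f x ->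
  dif g x /\ forall v, D g x v = D f x v.
Proof.
move=> d0 fg [fd]; have [gd E] := eq_diff_near d0 fg fd; split; first by split.
by move=> v; rewrite !DE; exact: (congr1 (fun h : V -> W => h v) E).
Qed.

Lemma dif_cst (c : W) x : dif (fun=> c) x /\ forall v, D (fun=> c) x v = 0.
Proof.
split; first by split; exact: differentiable_cst.
by move=> v; rewrite DE; have E := diff_cst c x; exact: (congr1 (fun h : V -> W => h v) E).
Qed.

Lemma difD f g x : dif f x -> dif g x ->
  dif (fun z => f z + g z) x /\ forall v, D (fun z => f z + g z) x v = D f x v + D g x v.
Proof.
move=> [fd] [gd]; split; first by split; exact: (differentiableD fd gd).
move=> v; rewrite !DE; have E := diffD fd gd.
exact: (congr1 (fun h : V -> W => h v) E).
Qed.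

Lemma difZ (k : K) f x : dif f x ->
  dif (fun z => k *: f z) x /\ forall v, D (fun z => k *: f z) x v = k *: D f x v.
Proof.
move=> [fd]; split; first by split; exact: (differentiableZ k fd).
move=> v; rewrite !DE; have E := diffZ k fd.
exact: (congr1 (fun h : V -> W => h v) E).
Qed.

Lemma dif_continuous f x : dif f x ->
  forall e : R, 0 < e -> exists2 d : R, 0 < d & forall y, rn (x - y) < d -> rn (f x - f y) < e.
Proof. by move=> [fd]; apply/continuous_rn; exact: differentiable_continuous. Qed.

End Basics.

Lemma dif_comp (U V W : normedModType K) (g : U -> V) (f : V -> W) (x : U) :
  dif g x -> dif f (g x) ->
  dif (fun z => f (g z)) x /\ forall v, D (fun z => f (g z)) x v = D f (g x) (D g x v).
Proof.
move=> [gd] [fd]; split; first by split; exact: (differentiable_comp gd fd).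
move=> v; rewrite !DE; have E := diff_comp gd fd.
exact: (congr1 (fun h : U -> W => h v) E).
Qed.

Lemma difM (V : normedModType K) (f g : V -> K) x : dif f x -> dif g x ->
  dif (fun z => f z * g z) x /\
  forall v, D (fun z => f z * g z) x v = f x * D g x v + g x * D f x v.
Proof.
move=> [fd] [gd]; split; first by split; exact: (differentiableM fd gd).
move=> v; rewrite !DE; have E := diffM fd gd.
exact: (congr1 (fun h : V -> K => h v) E).
Qed.

Lemma difV (V : normedModType K) (f : V -> K) x : dif f x -> f x != 0 ->
  dif (fun z => (f z)^-1) x.
Proof. by move=> [fd] f0; split; exact: (differentiableV fd f0). Qed.

Lemma dif_line (V : normedModType K) (f : V -> K) x y (s : K) :
  dif f (x + s *: y) ->
  dif (fun t : K => f (x + t *: y)) s /\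
  D (fun t : K => f (x + t *: y)) s (1 : K) = D f (x + s *: y) y.
Proof. by move=> [fd]; rewrite !DE; have [h1 h2] := line_diff fd; split; first by split. Qed.

Definition dif_on (V W : normedModType K) (x : V) (e : R) (f : V -> W) :=
  forall z, rn (z - x) < e -> dif f z.

Section Bounds.
Variables (V : normedModType K) (f : V -> K) (x : V) (r M : R).
Hypothesis r0 : 0 < r.
Hypothesis fd : dif_on x r f.
Hypothesis fM : forall z, rn (z - x) < r -> rn (f z) <= M.

Let fd' z : rn (z - x) < r -> differentiable f z.
Proof. by move=> /fd[]. Qed.

Lemma dif_lipschitz y : rn y < r -> rn (f (x + y) - f x) <= Cq R / r * M * rn y.
Proof. exact: (lipschitz_at r0 fd' fM). Qed.

Lemma dif_taylor y : rn y < r ->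
  rn (f (x + y) - f x - D f x y) <= (Cq R / r) ^+ 2 * M * rn y ^+ 2.
Proof. by rewrite DE; exact: (taylor_at r0 fd' fM). Qed.

End Bounds.

Lemma dif_order (f : K -> K) (a : K) (r M : R) : 0 < r -> dif_on a r f ->
  (forall z, rn (z - a) < r -> rn (f z) <= M) ->
  (exists k g, [/\ dif_on a r g, g a != 0 & forall z, f z = (z - a) ^+ k * g z]) \/
  (forall z, rn (z - a) <= r / (2 * Cq R) -> f z = 0).
Proof.
move=> r0 fd fM; have fd' z : rn (z - a) < r -> differentiable f z by move=> /fd[].
have [[k [g [gd ga gE]]]|H] := zero_order r0 fd' fM; [left|by right].
by exists k, g; split=> // z /gd h; split.
Qed.

Lemma dif_weak_maximum (f : K -> K) (a : K) (r M : R) : 0 < r ->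
  (forall z, rn (z - a) <= r -> dif f z) ->
  (forall z, r / 4 <= rn (z - a) <= r -> rn (f z) <= M) ->
  rn (f a) <= 128 * M.
Proof. by move=> r0 fd; apply: weak_maximum => // z /fd[]. Qed.

Lemma locally_bounded (V : normedModType K) (f : V -> K) x (e : R) : 0 < e -> dif_on x e f ->
  exists2 r : R, 0 < r & exists M, forall z, rn (z - x) < r -> rn (f z) <= M.
Proof.
move=> e0 fd; have xx : rn (x - x) < e by rewrite subrr rn0.
have [d d0 dP] := dif_continuous (fd _ xx) ltr01; exists d => //.
exists (rn (f x) + 1) => z; rewrite rnB => /dP h.
by have := rn_subl (f z) (f x); rewrite rnB; lra.
Qed.

Lemma ball_sub (V : normedModType K) (x z : V) (e : R) : rn (z - x) < e ->
  exists2 d : R, 0 < d & forall w, rn (w - z) < d -> rn (w - x) < e.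
Proof.
move=> h; exists (e - rn (z - x)); first by lra.
by move=> w wz; have := rn_dist z w x; lra.
Qed.

Lemma dif_D (V : normedModType K) (f : V -> K) x v (e : R) : dif_on x e f ->
  dif_on x e (fun u => D f u v).
Proof.
move=> fd z zx; have [d d0 dP] := ball_sub zx.
have fdz : dif_on z d f by move=> w /dP/fd.
have [r r0 [M fM]] := locally_bounded d0 fdz.
pose s := Num.min d r / 4.
have s0 : 0 < s by rewrite divr_gt0 // lt_min d0.
have s4 : 4 * s = Num.min d r by rewrite /s mulrC divfK.
split; have -> : (fun u => D f u v) = (fun u => 'd f u v : K).
  by apply/funext => u; rewrite DE.
apply: (@differential_differentiable R V f z v s M) => // w; rewrite s4 lt_min.
  by move=> /andP[/fdz[]].
by move=> /andP[_ /fM].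
Qed.

Lemma eq_on_dif (V W : normedModType K) (x : V) (e : R) (f g : V -> W) :
  dif_on x e f -> (forall z, rn (z - x) < e -> f z = g z) ->
  dif_on x e g /\ forall z v, rn (z - x) < e -> D g z v = D f z v.
Proof.
move=> fd fg; have H z : rn (z - x) < e -> dif g z /\ forall v, D g z v = D f z v.
  move=> zx; have [d d0 dP] := ball_sub zx.
  apply: (eq_dif_near d0); last exact: fd.
  by move=> w; rewrite rnB => /dP/fg.
by split=> z => [zx|v zx]; have [] := H z zx.
Qed.

Lemma dif_lincomb (V : normedModType K) m (c : 'I_m -> K) (f : 'I_m -> V -> K) x :
  (forall i, dif (f i) x) ->
  dif (fun z => \sum_(i < m) c i * f i z) x /\
  forall v, D (fun z => \sum_(i < m) c i * f i z) x v = \sum_(i < m) c i * D (f i) x v.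
Proof.
elim: m c f => [|m IH] c f fd.
  have -> : (fun z => \sum_(i < 0) c i * f i z) = (fun=> 0) :> (V -> K).
    by apply/funext => z; rewrite big_ord0.
  have [h1 h2] := @dif_cst V K 0 x; split; first exact: h1.
  by move=> v; rewrite h2 big_ord0.
have [IH1 IH2] := IH (fun i => c (lift ord0 i)) (fun i => f (lift ord0 i)) (fun i => fd _).
have [h1 h2] := difZ (c ord0) (fd ord0).
have [h3 h4] := difD h1 IH1.
have -> : (fun z => \sum_(i < m.+1) c i * f i z)
   = (fun z => c ord0 *: f ord0 z + \sum_(i < m) c (lift ord0 i) * f (lift ord0 i) z).
  by apply/funext => z; rewrite big_ord_recl.
split; first exact: h3.
by move=> v; rewrite h4 h2 IH2 big_ord_recl.
Qed.

Definition has_derivative (f : K -> K) (s l : K) :=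
  dif f s /\ D f s (1 : K) = l.

Lemma has_derivativeM (f g : K -> K) s l m :
  has_derivative f s l -> has_derivative g s m ->
  has_derivative (fun t => f t * g t) s (f s * m + g s * l).
Proof.
by move=> [fd <-] [gd <-]; have [h1 h2] := difM fd gd; split.
Qed.

Lemma has_derivative_id s : has_derivative (fun t => t) s 1.
Proof.
have [|h1 h2] := @differentiable_K R (fun t => t) s 1; last first.
  by split; [split|rewrite DE].
move=> e e0; exists 1 => // x _.
by rewrite mulr1 (addrC s) addrK subrr rn0 mulr_ge0 ?rn_ge0 // ltW.
Qed.

Lemma has_derivativeX s k :
  has_derivative (fun t => t ^+ k.+1) s (k.+1%:R * s ^+ k).
Proof.
elim: k => [|k IH].
  have -> : (fun t : K => t ^+ 1) = (fun t : K => t).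
    by apply/funext => t; rewrite expr1.
  by rewrite expr0 mulr1; exact: has_derivative_id.
have -> : (fun t : K => t ^+ k.+2) = (fun t : K => t * t ^+ k.+1).
  by apply/funext => t; rewrite exprS.
have -> : k.+2%:R * s ^+ k.+1 = s * (k.+1%:R * s ^+ k) + s ^+ k.+1 * 1.
  by rewrite exprS -[in LHS]natr1; ring.
exact: has_derivativeM (has_derivative_id s) IH.
Qed.

Lemma has_derivative_near (f g : K -> K) s l (d : R) : 0 < d ->
  (forall t, rn (s - t) < d -> f t = g t) ->
  has_derivative f s l -> has_derivative g s l.
Proof.
move=> d0 fg [fd <-]; have [gd E] := eq_dif_near d0 fg fd.
by split; [exact: gd|exact: E].
Qed.

Section Order.
Variables (V : normedModType K) (x y : V).

Fixpoint flat_along n (f : V -> K) : Prop :=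
  if n is n'.+1 then f x = 0 /\ flat_along n' (fun z => D f z y)
  else f x = 0.

(** Differentiating a zero of order k + 1 along the line gives a zero of order
    k with the value of h at 0 multiplied by k + 1. *)
Lemma flat_along_order (e r : R) k (f : V -> K) (h : K -> K) : 0 < e -> 0 < r ->
  dif_on x e f ->
  dif_on 0 r h ->
  (forall s : K, rn (s - 0) < r -> rn (x + s *: y - x) < e) ->
  (forall s : K, rn (s - 0) < r -> f (x + s *: y) = s ^+ k * h s) ->
  flat_along k f -> h 0 = 0.
Proof.
move=> e0 r0 + + inb; elim: k f h => [|k IH] f h fd hd fh /=.
  by have := fh 0; rewrite subrr rn0 scale0r addr0 expr0 mul1r => /(_ r0) ->.
move=> [_ fl]; pose h2 s := k.+1%:R * h s + s * D h s (1 : K).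
have h2d (s : K) : rn (s - 0) < r -> dif h2 s.
  move=> sr; have dh := hd s sr; have [h1 _] := difM (proj1 (dif_cst (k.+1%:R : K) s)) dh.
  have [h2' _] := difM (has_derivative_id s).1 (@dif_D _ h 0 (1 : K) r hd s sr).
  by have [] := difD h1 h2'.
have E (s : K) : rn (s - 0) < r -> D f (x + s *: y) y = s ^+ k * h2 s.
  move=> sr; have hds : has_derivative h s (D h s (1 : K)) by split; first exact: hd.
  have [d d0 dP] := ball_sub sr.
  have fE t : rn (s - t) < d -> t ^+ k.+1 * h t = f (x + t *: y).
    by rewrite rnB => /dP/fh ->.
  have [_ h3] := has_derivative_near d0 fE (has_derivativeM (has_derivativeX s k) hds).
  have [_ h4] := dif_line (fd _ (inb _ sr)).
  by rewrite -h4 h3 /h2 exprSr; ring.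
have := IH _ _ (@dif_D _ f x y e fd) h2d E fl.
rewrite /h2 mul0r addr0 => /eqP; rewrite mulf_eq0 (negPf (natK_neq0 R k)).
by move=> /eqP.
Qed.

End Order.

Section Coordinates.
Variable n : nat.
Notation V := 'rV[K]_n.
Implicit Types (f g : V -> K) (x y z v : V) (s : seq 'I_n).

Definition pd i f : V -> K := fun z => D f z (delta_mx 0 i).

Definition pds s f : V -> K := foldr pd f s.

Lemma pds_dif x e s f : dif_on x e f -> dif_on x e (pds s f).
Proof. by elim: s => [//|i s IH] fd; apply: dif_D; exact: IH. Qed.

Lemma eq_pds x e s f g : dif_on x e f ->
  (forall z, rn (z - x) < e -> f z = g z) ->
  forall z, rn (z - x) < e -> pds s f z = pds s g z.
Proof.
move=> fd fg; elim: s => [//|i s IH] z zx.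
have [_ E] := eq_on_dif (pds_dif s fd) IH.
by rewrite /= /pd E.
Qed.

Lemma pds_lincomb x e s m (c : 'I_m -> K) (f : 'I_m -> V -> K) :
  (forall i, dif_on x e (f i)) -> forall z, rn (z - x) < e ->
  pds s (fun z => \sum_(i < m) c i * f i z) z = \sum_(i < m) c i * pds s (f i) z.
Proof.
move=> fd; elim: s => [//|j s IH] z zx.
have fsd i : dif_on x e (pds s (f i)) by exact: pds_dif.
have gd : dif_on x e (fun z => \sum_(i < m) c i * f i z).
  by move=> w wx; apply: (proj1 (dif_lincomb c _)) => i; exact: fd.
have [_ E] := eq_on_dif (pds_dif s gd) IH.
have [_ L] := dif_lincomb c (fun i => fsd i z zx).
by rewrite /= /pd -E // L.
Qed.

Lemma D_coord f z y : D f z y = \sum_(i < n) y 0 i * pd i f z.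
Proof.
rewrite {1}(row_sum_delta y) D_sum; apply: eq_bigr => i _.
by rewrite D_scale.
Qed.

Definition flat f x := forall s, pds s f x = 0.

Lemma flat_D x e f y : 0 < e -> dif_on x e f -> flat f x ->
  flat (fun z => D f z y) x.
Proof.
move=> e0 fd fl s; have xx : rn (x - x) < e by rewrite subrr rn0.
have -> : (fun z => D f z y) = (fun z => \sum_(i < n) y 0 i * pd i f z).
  by apply/funext => z; exact: D_coord.
rewrite (@pds_lincomb x e) // => [|i]; last exact: (@pds_dif x e [:: i]).
rewrite big1 // => i _; have := fl (rcons s i).
by rewrite /pds foldr_rcons => ->; rewrite mulr0.
Qed.

Lemma flat_flat_along x e f y k : 0 < e -> dif_on x e f -> flat f x ->
  flat_along x y k f.
Proof.
move=> e0; elim: k f => [|k IH] f fd fl /=; first exact: (fl [::]).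
split; first exact: (fl [::]).
by apply: IH; [exact: dif_D|exact: (flat_D _ e0 fd fl)].
Qed.

(** On every complex line through x a flat function has no finite order of
    vanishing, so it is zero on a disc of definite size. *)
Lemma flat_zero x r M f : 0 < r -> dif_on x r f ->
  (forall z, rn (z - x) < r -> rn (f z) <= M) -> flat f x ->
  forall y, rn y <= r / (2 * Cq R) -> f (x + y) = 0.
Proof.
move=> r0 fd fM fl y; have [->|y0] := eqVneq y 0.
  by rewrite addr0 => _; exact: (fl [::]).
have C0 := Cq_gt0 R; rewrite ler_pdivlMr ?mulr_gt0 // => yr.
have ry : 0 < r / rn y by rewrite divr_gt0 // rn_gt0.
have inb (s : K) : rn (s - 0) < r / rn y -> rn (x + s *: y - x) < r.
  exact: line_in.
have ld : dif_on (0 : K) (r / rn y) (fun t : K => f (x + t *: y)).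
  by move=> s /inb/fd h; have [] := dif_line h.
have lM (s : K) : rn (s - 0) < r / rn y -> rn (f (x + s *: y)) <= M.
  by move=> /inb/fM.
have [[k [g [gd g0 gE]]]|H] := dif_order ry ld lM; last first.
  have := H 1; rewrite scale1r subr0 rn1; apply.
  by rewrite ler_pdivlMr ?mulr_gt0 // mul1r ler_pdivlMr ?rn_gt0 // mulrC.
case/eqP: g0; apply: (flat_along_order r0 ry fd gd inb _ (flat_flat_along y k r0 fd fl)).
by move=> s _; rewrite gE subr0.
Qed.

Lemma flat_near x e f : 0 < e -> dif_on x e f -> flat f x ->
  exists2 d : R, 0 < d & forall z, rn (z - x) < d -> f z = 0.
Proof.
move=> e0 fd fl; have [r r0 [M fM]] := locally_bounded e0 fd.
have m0 : 0 < Num.min e r by rewrite lt_min e0.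
exists (Num.min e r / (2 * Cq R)); first by rewrite divr_gt0 // mulr_gt0 // Cq_gt0.
move=> z zx; rewrite -(subrK x z) addrC; apply: (@flat_zero _ (Num.min e r) M) => //.
- by move=> w; rewrite lt_min => /andP[/fd].
- by move=> w; rewrite lt_min => /andP[_ /fM].
- exact: ltW.
Qed.

Lemma near_flat x d f : 0 < d -> (forall z, rn (z - x) < d -> f z = 0) -> flat f x.
Proof.
move=> d0 f0 s; have xx : rn (x - x) < d by rewrite subrr rn0.
have cd : dif_on x d (fun=> 0 : K) by move=> z _; exact: (proj1 (dif_cst _ _)).
rewrite -(@eq_pds x d s (fun=> 0)) //; last by move=> z /f0 ->.
have E z : pds s (fun=> 0) z = 0; last exact: E.
elim: s z => [//|i s IH] z /=; rewrite /pd.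
have -> : pds s (fun=> 0) = (fun=> 0) by apply/funext.
by have [_ ->] := dif_cst (0 : K) z.
Qed.

(** Together with [flat_near] this is the identity theorem: flatness is an
    open and closed condition. *)
Lemma flat_closed x e f : 0 < e -> dif_on x e f ->
  (forall d : R, 0 < d -> exists2 z, rn (z - x) < d & flat f z) -> flat f x.
Proof.
move=> e0 fd H s; apply/eqP; apply: contraT => s0.
have xx : rn (x - x) < e by rewrite subrr rn0.
have sd : dif (pds s f) x := pds_dif s fd xx.
rewrite -rn_gt0 in s0; have [d d0 dP] := dif_continuous sd s0.
have [z zx fl] := H d d0; have := dP z; rewrite rnB => /(_ zx).
by rewrite (fl s) subr0 ltxx.
Qed.

End Coordinates.
End Differentials.

(** * The inverse function theorem *)

Section InverseFunction.
Variable R : realType.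
Notation K := (C R).

Lemma dif_intro (V W : normedModType K) (f : V -> W) (x : V) (L : V -> W) (A : R) :
  linear L -> (forall v, rn (L v) <= A * rn v) ->
  (forall e : R, 0 < e -> exists2 d : R, 0 < d &
    forall h, rn h < d -> rn (f (x + h) - f x - L h) <= e * rn h) ->
  dif f x /\ forall v, D f x v = L v.
Proof.
move=> Ll LA; have [L' L'E] : exists L' : {linear V -> W}, L' = L :> (V -> W).
  pose L' : {linear V -> W} := HB.pack L (GRing.isLinear.Build K V W _ L Ll).
  by exists L'.
rewrite -L'E => H; apply: rn_dif H => z; apply/continuous_rn => e e0.
have A1 : 0 < `|A| + 1 by rewrite ltr_wpDl.
exists (e / (`|A| + 1)); first exact: divr_gt0.
move=> y; rewrite ltr_pdivlMr // => h; rewrite -linearB L'E; apply: le_lt_trans h.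
apply: le_trans (LA _) _; rewrite mulrC ler_wpM2l ?rn_ge0 //.
by apply: le_trans (ler_norm _) _; rewrite lerDl.
Qed.

Lemma D_bounded (V W : normedModType K) (f : V -> W) (x : V) : dif f x ->
  exists2 A : R, 0 < A & forall v, rn (D f x v) <= A * rn v.
Proof.
move=> [fd]; have /continuous_rn/(_ _ ltr01)[d d0 dP] : {for 0, continuous 'd f x}.
  exact: (diff_continuous fd).
exists (2 / d); first by rewrite divr_gt0.
move=> v; have [->|v0] := eqVneq v 0; first by rewrite D0 !rn0 mulr0.
have rv : 0 < rn v by rewrite rn_gt0.
pose t := d / (2 * rn v); have t0 : 0 < t by rewrite divr_gt0 // mulr_gt0.
have := dP (RtoC t *: v); rewrite sub0r rnN rnZ rn_real gtr0_norm // -!DE => H.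
have : t * rn v < d by rewrite /t invfM mulrA divfK ?gt_eqF //; lra.
move=> /H; rewrite D0 sub0r rnN D_scale rnZ rn_real gtr0_norm // mulrC.
rewrite -ltr_pdivlMr // div1r /t invf_div => /ltW h; apply: le_trans h _.
by rewrite mulrAC.
Qed.

Lemma mulmx_bounded n m (M : 'M[K]_(n, m)) :
  exists2 A : R, 0 < A & forall v : 'rV[K]_n, rn (v *m M) <= A * rn v.
Proof.
pose A := 1 + \sum_(i < n) \sum_(j < m) rn (M i j : K).
have S0 : 0 <= \sum_(i < n) \sum_(j < m) rn (M i j : K).
  by apply: sumr_ge0 => i _; apply: sumr_ge0 => j _; exact: rn_ge0.
exists A; first by rewrite /A; lra.
move=> v; apply: rn_rV => [|j]; first by rewrite mulr_ge0 ?rn_ge0 // /A; lra.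
rewrite mxE; apply: (@le_trans _ _ (\sum_(i < n) rn (M i j : K) * rn v)).
  elim/big_ind2: _ => [|x1 x2 y1 y2 h1 h2|i _]; first by rewrite rn0.
    by apply: le_trans (rnD _ _) _; exact: lerD.
  by rewrite rnM mulrC ler_wpM2l ?rn_ge0 // rn_coord.
rewrite -mulr_suml ler_wpM2r ?rn_ge0 //.
apply: (@le_trans _ _ (\sum_(i < n) \sum_(j < m) rn (M i j : K))); last by rewrite /A lerDr.
apply: ler_sum => i _; rewrite (bigD1 j) //= lerDl.
by apply: sumr_ge0 => k _; exact: rn_ge0.
Qed.

Section VectorValued.
Variables n m : nat.
Implicit Types (F : 'rV[K]_n -> 'rV[K]_m) (x : 'rV[K]_n).

Lemma dif_coord F x j : dif F x ->
  dif (fun z => F z 0 j : K) x /\ forall v, D (fun z => F z 0 j : K) x v = D F x v 0 j.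
Proof.
move=> Fd; have [A A0 AP] := D_bounded Fd.
apply: (@dif_intro _ _ (fun z => F z 0 j : K) x (fun v => D F x v 0 j) A).
- by move=> k u v; rewrite D_add D_scale !mxE.
- by move=> v; apply: le_trans (rn_coord _ _) (AP v).
- move=> e e0; have [d d0 dP] := D_rn Fd e0; exists d => // h /dP H.
  apply: le_trans H; apply: le_trans (rn_coord _ j).
  by rewrite !mxE.
Qed.

(** The Jacobian matrix acts on row vectors from the right. *)
Definition Jmx F x : 'M[K]_(n, m) := \matrix_(i, j) D F x (delta_mx 0 i) 0 j.

Lemma JmxE F x v : D F x v = v *m Jmx F x.
Proof.
rewrite {1}(row_sum_delta v) D_sum mulmx_sum_row; apply: eq_bigr => i _.
by rewrite D_scale; congr (_ *: _); apply/rowP => j; rewrite !mxE.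
Qed.

End VectorValued.

(** Near a, the remainder of f after its linear part at a has a small Lipschitz
    constant, because it is of second order. *)
Lemma strict_scalar (V : normedModType K) (f : V -> K) a (e c : R) : 0 < e -> 0 < c ->
  dif_on a e f -> exists2 s : R, 0 < s & forall x x', rn (x - a) < s -> rn (x' - a) < s ->
    rn (f x' - f x - D f a (x' - x)) <= c * rn (x' - x).
Proof.
move=> e0 c0 fd; have [r0 r00 [M fM0]] := locally_bounded e0 fd.
pose r := Num.min e r0; have r_gt0 : 0 < r by rewrite lt_min e0.
have fdr : dif_on a r f by move=> z; rewrite lt_min => /andP[/fd].
have fM z : rn (z - a) < r -> rn (f z) <= M by rewrite lt_min => /andP[_ /fM0].
have M0 : 0 <= M by apply: le_trans (fM a _); [exact: rn_ge0|rewrite subrr rn0].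
have aa : rn (a - a) < r by rewrite subrr rn0.
pose B := (Cq R / r) ^+ 2 * M.
have B0 : 0 <= B by rewrite mulr_ge0 // exprn_ge0 // divr_ge0 ?(ltW r_gt0) // ltW // Cq_gt0.
pose g z := f z - f a - D f a (z - a).
have gB z : rn (z - a) < r -> rn (g z) <= B * rn (z - a) ^+ 2.
  by move=> zr; have := dif_taylor r_gt0 fdr fM zr; rewrite (addrC a) subrK.
have fa : dif f a := fdr _ aa.
have [A A0 AP] := D_bounded fa.
have Ld z : dif (fun z => D f a (z - a)) z.
  apply: (proj1 (@dif_intro _ _ _ z (D f a) A _ _ _)).
  - by move=> k u v; rewrite D_add D_scale.
  - exact: AP.
  - move=> eps eps0; exists 1 => // h _.
    have -> : D f a (z + h - a) - D f a (z - a) - D f a h = 0.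
      by rewrite -!D_sub opprB addrA subrK (addrC z) addrK subrr D0.
    by rewrite rn0 mulr_ge0 ?rn_ge0 // ltW.
have gd : dif_on a r g.
  move=> z zr; have [h1 _] := difZ (-1) (Ld z); have [h2 _] := dif_cst (- f a) z.
  have [h3 _] := difD (fdr z zr) h2; have [h4 _] := difD h3 h1.
  have -> : g = (fun z => f z + - f a + -1 *: D f a (z - a)); last exact: h4.
  by apply/funext => w; rewrite scaleN1r.
pose C0 := 4 * Cq R * B + 1.
have C1 := Cq_gt0 R.
have C00 : 0 < C0 by have := mulr_ge0 (mulr_ge0 (ler0n R 4) (ltW C1)) B0; rewrite /C0; lra.
pose s := Num.min (r / 2) (c / C0).
have s0 : 0 < s by rewrite lt_min !divr_gt0.
have sr : 2 * s <= r by have : s <= r / 2 by [rewrite ge_min lexx]; lra.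
have sc : C0 * s <= c.
  have : s <= c / C0 by rewrite ge_min lexx orbT.
  by rewrite ler_pdivlMr // mulrC.
have s2 : 0 < s / 2 by rewrite divr_gt0.
exists (s / 2) => // x x' xs xs'.
have xx' : rn (x' - x) < s by have := rn_dist a x' x; rewrite (rnB a x); lra.
have xin z : rn (z - x) < s -> rn (z - a) < 2 * s.
  by move=> zx; have := rn_dist x z a; lra.
have gx : dif_on x s g by move=> z /xin zs; apply: gd; lra.
have gxB z : rn (z - x) < s -> rn (g z) <= B * (2 * s) ^+ 2.
  move=> /xin zs; apply: le_trans (gB z _) _; first lra.
  by rewrite ler_wpM2l // lerXn2r ?nnegrE ?rn_ge0 ?ltW // mulr_gt0.
have := dif_lipschitz s0 gx gxB xx'; rewrite (addrC x) subrK.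
have -> : g x' - g x = f x' - f x - D f a (x' - x).
  have -> : D f a (x' - x) = D f a (x' - a) - D f a (x - a).
    by rewrite -D_sub opprB addrA subrK.
  by rewrite /g; ring.
move=> h; apply: le_trans h _; rewrite ler_wpM2r ?rn_ge0 //.
apply: le_trans sc; have -> : Cq R / s * (B * (2 * s) ^+ 2) = 4 * Cq R * B * s.
  by field; rewrite gt_eqF.
by rewrite ler_wpM2r ?(ltW s0) // /C0 lerDl.
Qed.

Lemma strict_rV n m (F : 'rV[K]_n -> 'rV[K]_m) a (e c : R) : 0 < e -> 0 < c ->
  dif_on a e F -> exists2 s : R, 0 < s & forall x x', rn (x - a) < s -> rn (x' - a) < s ->
    rn (F x' - F x - D F a (x' - x)) <= c * rn (x' - x).
Proof.
move=> e0 c0 Fd; have aa : rn (a - a) < e by rewrite subrr rn0.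
have /choice[s sP] (j : 'I_m) : exists s : R, 0 < s /\ forall x x', rn (x - a) < s ->
    rn (x' - a) < s -> rn (F x' 0 j - F x 0 j - D F a (x' - x) 0 j) <= c * rn (x' - x).
  have fd : dif_on a e (fun z => F z 0 j : K).
    by move=> z ze; have [] := dif_coord j (Fd z ze).
  have [s s0 sP] := strict_scalar e0 c0 fd; exists s; split=> // x x' xs xs'.
  by have [_ <-] := dif_coord j (Fd a aa); exact: sP.
exists (\big[Num.min/1]_(j < m) s j).
  by apply: lt_bigmin => // j _; exact: (sP j).1.
move=> x x' xs xs'; apply: rn_rV => [|j]; first by rewrite mulr_ge0 ?rn_ge0 // ltW.
rewrite !mxE; apply: (sP j).2.
  by apply: lt_le_trans xs _; exact: bigmin_le_cond.
by apply: lt_le_trans xs' _; exact: bigmin_le_cond.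
Qed.

Lemma Jmx_inverse n (F : 'rV[K]_n -> 'rV[K]_n) x : (forall v, D F x v = 0 -> v = 0) ->
  Jmx F x \in unitmx.
Proof.
move=> Finj; rewrite -row_free_unit -kermx_eq0; apply/eqP/row_matrixP => i.
rewrite row0; apply: Finj; rewrite JmxE.
by apply/sub_kermxP; exact: row_sub.
Qed.

Section Newton.
Variables (V : normedModType K) (F : V -> V).
Hypothesis complete : forall (u : nat -> V) (d : R),
  (forall k, rn (u k.+1 - u k) <= d / 2 ^+ k) ->
  exists z, forall k, rn (z - u k) <= 4 * d / 2 ^+ k.
Hypothesis inverse : forall x, (forall v, D F x v = 0 -> v = 0) ->
  exists (B : V -> V) (A : R), [/\ linear B, 0 < A, forall v, rn (B v) <= A * rn v,
    forall v, B (D F x v) = v & forall v, D F x (B v) = v].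

Let linB (B : V -> V) : linear B -> forall u v, B (u - v) = B u - B v.
Proof. by move=> Bl u v; rewrite addrC -scaleN1r Bl scaleN1r addrC. Qed.

(** The solution of F x = y is the limit of the iteration of
    x |-> x - B (F x - y), where B is the inverse of the differential at a; strict
    differentiability makes this map a contraction. *)
Lemma newton a (e : R) : 0 < e -> dif_on a e F ->
  (forall c : R, 0 < c -> exists2 s : R, 0 < s & forall x x', rn (x - a) < s ->
     rn (x' - a) < s -> rn (F x' - F x - D F a (x' - x)) <= c * rn (x' - x)) ->
  (forall v, D F a v = 0 -> v = 0) ->
  exists (s t : R) (G : V -> V), [/\ 0 < s <= e, 0 < t,
    dif_on (F a) t G,
    forall y, rn (y - F a) < t -> rn (G y - a) < s /\ F (G y) = y &
    forall x, rn (x - a) < s -> rn (F x - F a) < t -> G (F x) = x].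
Proof.
move=> e0 Fd strict Finj; have [B [A [Bl A0 AP BJ JB]]] := inverse Finj.
have c0 : 0 < (2 * A)^-1 by rewrite invr_gt0 mulr_gt0.
have Ac : A * (2 * A)^-1 = 2^-1 by field; rewrite gt_eqF.
have [s' s'0 sP'] := strict _ c0.
have [s [s0 se ss']] : exists s, [/\ 0 < s, s <= e & s <= s'].
  exists (Num.min e s'); rewrite lt_min e0 s'0 !ge_min !lexx orbT.
  by split.
have sP x x' : rn (x - a) < s -> rn (x' - a) < s ->
    rn (F x' - F x - D F a (x' - x)) <= (2 * A)^-1 * rn (x' - x).
  move=> h1 h2; apply: sP'; first exact: lt_le_trans h1 ss'.
  exact: lt_le_trans h2 ss'.
have half x x' : rn (x - a) < s -> rn (x' - a) < s ->
    rn (B (F x' - F x - D F a (x' - x))) <= 2^-1 * rn (x' - x).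
  move=> xs xs'; apply: le_trans (AP _) _; rewrite -Ac -mulrA.
  by rewrite ler_wpM2l ?(ltW A0) // sP.
have expand x x' : rn (x - a) < s -> rn (x' - a) < s ->
    rn (x' - x) <= 2 * A * rn (F x' - F x).
  move=> xs xs'; have h1 := half x x' xs xs'; have h2 := AP (F x' - F x).
  have h3 := rn_triB (B (F x' - F x)) (B (F x' - F x - D F a (x' - x))).
  rewrite -linB // subKr BJ in h3.
  by clear -h1 h2 h3; lra.
(* the first step from a has length at most s / 4, and each further step is
   at most half as long as the previous one *)
have [t t0 tE] : exists2 t, 0 < t & s / 4 = A * t.
  exists (s / (4 * A)); first by rewrite divr_gt0 // mulr_gt0.
  by field; rewrite gt_eqF.
have aa : rn (a - a) < s by rewrite subrr rn0.
have sol y : rn (y - F a) < t -> exists x, rn (x - a) < s /\ F x = y.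
  move=> yt.
  have [T TE] : exists T : V -> V, forall x, T x = x - B (F x - y).
    by eexists.
  have Th x x' : rn (x - a) < s -> rn (x' - a) < s ->
      rn (T x' - T x) <= 2^-1 * rn (x' - x).
    move=> xs xs'; apply: le_trans (half x x' xs xs').
    suff -> : T x' - T x = - B (F x' - F x - D F a (x' - x)) by rewrite rnN.
    have E : F x' - F x = (F x' - y) - (F x - y) by rewrite opprB addrA subrK.
    rewrite E (linB Bl _ (D F a _)) BJ (linB Bl (F x' - y) (F x - y)) !TE.
    move: (B (F x' - y)) (B (F x - y)) => p' p.
    by rewrite !opprB addrACA [RHS]addrACA (addrC (- p')).
  have T1 : rn (T a - a) <= s / 4.
    rewrite TE addrAC subrr add0r rnN; apply: le_trans (AP _) _.
    by rewrite tE ler_wpM2l ?(ltW A0) // rnB ltW.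
  have [u [u0 uS]] : exists u : nat -> V, u 0%N = a /\ forall k, u k.+1 = T (u k).
    by exists (fun k => iter k T a).
  have u2 k : rn (u k - a) <= s / 2 - s / 2 / 2 ^+ k /\
      rn (u k.+1 - u k) <= s / 4 / 2 ^+ k.
    elim: k => [|k [IH1 IH2]]; first by rewrite !expr0 !divr1 uS u0 !subrr rn0; split.
    have p0 : 0 < s / 2 ^+ k by rewrite divr_gt0 // exprn_gt0.
    have E1 : s / 4 / 2 ^+ k = s / 2 ^+ k / 4 by rewrite mulrAC.
    have E2 : s / 2 / 2 ^+ k = s / 2 ^+ k / 2 by rewrite mulrAC.
    have E3 : s / 2 / 2 ^+ k.+1 = s / 2 ^+ k / 4.
      by rewrite exprSr; field; rewrite gt_eqF // exprn_gt0.
    have E4 : s / 4 / 2 ^+ k.+1 = s / 2 ^+ k / 8.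
      by rewrite exprSr; field; rewrite gt_eqF // exprn_gt0.
    rewrite E1 E2 in IH1 IH2; rewrite E3 E4.
    have h1 : rn (u k.+1 - a) <= s / 2 - s / 2 ^+ k / 4.
      by have h := rn_dist (u k) (u k.+1) a; clear -h IH1 IH2; lra.
    split; first exact: h1.
    have h2 : rn (u k - a) < s by clear -IH1 p0 s0; lra.
    have h3 : rn (u k.+1 - a) < s by clear -h1 p0 s0; lra.
    by have h4 := Th _ _ h2 h3; rewrite -!uS in h4; clear -h4 IH2; lra.
  have [z zP] := complete (fun k => (u2 k).2).
  have za : rn (z - a) < s.
    have h1 := rn_dist (u 2%N) z a; have h2 := zP 2%N; have h3 := (u2 2%N).1.
    rewrite (_ : 2 ^+ 2 = 4 :> R) in h2 h3; last by ring.
    by clear -h1 h2 h3 s0; lra.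
  have us k : rn (u k - a) < s.
    have p0 : 0 < s / 2 / 2 ^+ k by rewrite !divr_gt0 // exprn_gt0.
    by have h := (u2 k).1; clear -h p0 s0; lra.
  exists z; split=> //.
  suff Tz : T z - z = 0.
    have /(congr1 (D F a)) : B (F z - y) = 0.
      by move/eqP: Tz; rewrite TE addrAC subrr add0r oppr_eq0 => /eqP.
    by rewrite JB D0 => /eqP; rewrite subr_eq0 => /eqP.
  apply/eqP; rewrite -rn_eq0 eq_le rn_ge0 andbT leNgt; apply/negP => pos.
  have [k kP] := geo_small (2 * s) pos.
  have h1 := Th _ _ (us k) za; have h2 := zP k; have h3 := zP k.+1.
  have h4 := rn_dist (u k.+1) (T z) z; rewrite -uS in h1.
  rewrite (rnB (u k.+1) z) in h4.
  have p0 : 0 < s / 2 ^+ k by rewrite divr_gt0 // exprn_gt0.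
  have E1 : 4 * (s / 4) / 2 ^+ k = s / 2 ^+ k by field; rewrite gt_eqF // exprn_gt0.
  have E2 : 4 * (s / 4) / 2 ^+ k.+1 = s / 2 ^+ k / 2.
    by rewrite exprSr; field; rewrite gt_eqF // exprn_gt0.
  have E3 : 2 * s / 2 ^+ k = 2 * (s / 2 ^+ k) by rewrite mulrA.
  by rewrite E1 in h2; rewrite E2 in h3; rewrite E3 in kP; clear -h1 h2 h3 h4 kP p0; lra.
have /choice[G GP] y : exists x, rn (y - F a) < t -> rn (x - a) < s /\ F x = y.
  by have [/sol[x]|/negP yt] := pselect (rn (y - F a) < t); [exists x|exists a => /(negP yt)].
exists s, t, G; split=> //.
- by rewrite s0.
- move=> y yt; have [Gs FG] := GP y yt.
  have [d0 d00 dP0] := ball_sub yt.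
  have Fz : dif F (G y) by apply: Fd; exact: lt_le_trans Gs se.
  (* near a the map F expands distances, up to a factor *)
  have DG v : D F (G y) v = 0 -> v = 0.
    move=> v0; apply/eqP; apply: contraT => vn.
    have rv : 0 < rn v by rewrite rn_gt0.
    have e2 : 0 < (4 * A)^-1 by rewrite invr_gt0 mulr_gt0.
    have [d d_gt0 dP] := D_rn Fz e2; have [d1 d1_gt0 dP1] := ball_sub Gs.
    pose m := Num.min d d1 / (2 * rn v).
    have mm0 : 0 < Num.min d d1 by rewrite lt_min d_gt0.
    have m0 : 0 < m by rewrite divr_gt0 // mulr_gt0.
    pose h := RtoC m *: v; have hE : rn h = Num.min d d1 / 2.
      by rewrite rnZ rn_real gtr0_norm // /m invfM mulrA divfK ?gt_eqF.
    have hd : rn h < d.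
      by rewrite hE; have : Num.min d d1 <= d by [rewrite ge_min lexx]; lra.
    have hd1 : rn (G y + h - a) < s.
      have E : G y + h - G y = h by rewrite (addrC (G y)) addrK.
      apply: dP1; rewrite E hE.
      by have : Num.min d d1 <= d1 by [rewrite ge_min lexx orbT]; lra.
    have Dh : D F (G y) h = 0 by rewrite /h D_scale v0 scaler0.
    have := dP h hd; rewrite Dh subr0.
    have := expand _ _ Gs hd1; rewrite (addrC (G y)) addrK => h1.
    have h0 : 0 < rn h by rewrite hE divr_gt0.
    move=> h2; have : 2 * A * rn (F (h + G y) - F (G y)) <= 2 * A * ((4 * A)^-1 * rn h).
      by rewrite ler_wpM2l // mulr_ge0 // ltW.
    have -> : 2 * A * ((4 * A)^-1 * rn h) = rn h / 2 by field; rewrite gt_eqF.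
    by move=> h3; exfalso; move: h0; rewrite ltNge => /negP; apply; lra.
  have [B' [A' [Bl' A'0 AP' BJ' _]]] := inverse DG.
  apply: (proj1 (@dif_intro _ _ G y B' A' Bl' AP' _)).
  move=> eps eps0; have e3 : 0 < eps / (2 * A * A') by rewrite divr_gt0 // !mulr_gt0.
  have [d d_gt0 dP] := D_rn Fz e3.
  exists (Num.min d0 (d / (2 * A))); first by rewrite lt_min d00 divr_gt0 // mulr_gt0.
  move=> k; rewrite lt_min ltr_pdivlMr ?mulr_gt0 // => /andP[k1 k2].
  have yk : rn (y + k - F a) < t by apply: dP0; rewrite (addrC y) addrK.
  have [Gs' FG'] := GP _ yk; pose h := G (y + k) - G y.
  have hk : rn h <= 2 * A * rn k.
    have := expand _ _ Gs Gs'; rewrite FG FG'.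
    by have -> : y + k - y = k by rewrite (addrC y) addrK.
  have hd : rn h < d by apply: le_lt_trans hk _; rewrite mulrC.
  have := dP h hd; have -> : G y + h = G (y + k) by rewrite /h addrC subrK.
  rewrite FG FG'; have -> : y + k - y = k by rewrite (addrC y) addrK.
  move=> h1; have -> : G (y + k) - G y - B' k = B' (D F (G y) h - k).
    by rewrite linB // BJ'.
  apply: le_trans (AP' _) _; rewrite rnB.
  apply: le_trans (_ : A' * (eps / (2 * A * A') * (2 * A * rn k)) <= _).
    rewrite ler_wpM2l ?(ltW A'0) //; apply: le_trans h1 _.
    by rewrite ler_wpM2l // ltW.
  by rewrite le_eqVlt; apply/orP; left; apply/eqP; field; rewrite !gt_eqF.
- move=> x xs Fx; have [Gs FG] := GP _ Fx.
  apply/eqP; rewrite -subr_eq0 -rn_eq0 eq_le rn_ge0 andbT.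
  by have := expand _ _ xs Gs; rewrite FG subrr rn0 mulr0.
Qed.

End Newton.

Theorem inverse_function n (F : 'rV[K]_n -> 'rV[K]_n) a (e : R) : 0 < e ->
  dif_on a e F -> (forall v, D F a v = 0 -> v = 0) ->
  exists (s t : R) (G : 'rV[K]_n -> 'rV[K]_n), [/\ 0 < s <= e, 0 < t,
    dif_on (F a) t G,
    forall y, rn (y - F a) < t -> rn (G y - a) < s /\ F (G y) = y &
    forall x, rn (x - a) < s -> rn (F x - F a) < t -> G (F x) = x].
Proof.
move=> e0 Fd Finj; apply: (newton _ _ e0 Fd _ Finj).
- exact: rV_geo_lim.
- move=> x xinj; have [A A0 AP] := mulmx_bounded (invmx (Jmx F x)).
  exists (fun v => v *m invmx (Jmx F x)), A.
  have Ju := Jmx_inverse xinj.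
  split=> // [k u v|v|v]; first by rewrite mulmxDl scalemxAl.
    by rewrite JmxE mulmxK.
  by rewrite JmxE mulmxKV.
- by move=> c c0; exact: (strict_rV e0 c0 Fd).
Qed.

(** Besides inverting F, the map G is open: every point close to G y is the
    image of a point close to y. *)
Lemma local_inverse n (F : 'rV[K]_n -> 'rV[K]_n) x (e : R) : 0 < e -> dif_on x e F ->
  (forall v, D F x v = 0 -> v = 0) ->
  exists (t : R) (G : 'rV[K]_n -> 'rV[K]_n), [/\ 0 < t, dif_on (F x) t G,
    forall y, rn (y - F x) < t -> rn (G y - x) < e /\ F (G y) = y, G (F x) = x &
    forall y (r : R), rn (y - F x) < t -> 0 < r -> exists2 d : R, 0 < d &
      forall z, rn (z - G y) < d -> exists2 w, rn (w - y) < r & G w = z].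
Proof.
move=> e0 Fd Finj.
have [s [t [G [/andP[s0 se] t0 Gd GP GF]]]] := inverse_function e0 Fd Finj.
exists t, G; split=> // [y /GP[h1 h2]||y r yt r0].
- by split=> //; exact: lt_le_trans h1 se.
- by apply: GF; rewrite subrr rn0.
have [Gs FG] := GP y yt; have [d d0 dP] := ball_sub Gs; have [d1 d10 dP1] := ball_sub yt.
have m0 : 0 < Num.min r d1 by rewrite lt_min r0.
have [d2 d20 dP2] := dif_continuous (Fd _ (lt_le_trans Gs se)) m0.
exists (Num.min d d2); first by rewrite lt_min d0.
move=> z; rewrite lt_min => /andP[/dP zs]; rewrite rnB => /dP2.
rewrite FG rnB lt_min => /andP[h1 /dP1 h2].
by exists (F z) => //; exact: GF.
Qed.

End InverseFunction.

(** * Meagre sets *)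

Section Category.
Variable R : realType.
Notation K := (C R).

Section Thin.
Variable V : normedModType K.
Implicit Types A X : set V.

Definition rclosed A := forall x, ~ A x ->
  exists2 e : R, 0 < e & forall y, rn (y - x) < e -> ~ A y.

Definition no_interior A :=
  forall x (e : R), 0 < e -> exists2 y, rn (y - x) < e & ~ A y.

Definition thin A := rclosed A /\ no_interior A.

Definition meagre X := exists A : nat -> set V,
  (forall k, thin (A k)) /\ X `<=` \bigcup_k A k.

Lemma thin0 : thin set0.
Proof.
split=> [x _|x e e0]; first by exists 1 => // y _ [].
by exists x; [rewrite subrr rn0|case].
Qed.

Lemma meagre_family (I : countType) (A : I -> set V) X :
  (forall i, thin (A i)) -> (forall x, X x -> exists i, A i x) -> meagre X.
Proof.
move=> Ath XA; exists (fun k => if unpickle k is Some i then A i else set0).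
split=> [k|x /XA[i Aix]]; first by case: unpickle => [i|] //; exact: thin0.
by exists (pickle i) => //; rewrite /= pickleK.
Qed.

Lemma sub_meagre X Y : X `<=` Y -> meagre Y -> meagre X.
Proof. by move=> XY [A [Ath YA]]; exists A; split=> // x /XY/YA. Qed.

Lemma meagre_thin X : thin X -> meagre X.
Proof. by move=> Xth; exists (fun=> X); split=> // x Xx; exists 0%N. Qed.

Lemma meagre_bigcup (I : countType) (X : I -> set V) Y :
  (forall i, meagre (X i)) -> (forall x, Y x -> exists i, X i x) -> meagre Y.
Proof.
move=> /choice[A AP] YX; apply: (@meagre_family (I * nat)%type (fun p => A p.1 p.2)).
  by move=> [i k]; exact: (AP i).1.
by move=> x /YX[i /(AP i).2[k _ Aik]]; exists (i, k).
Qed.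

Lemma meagre0 : meagre set0.
Proof. exact: meagre_thin thin0. Qed.

Hypothesis complete : forall (u : nat -> V) (d : R),
  (forall k, rn (u k.+1 - u k) <= d / 2 ^+ k) ->
  exists z, forall k, rn (z - u k) <= 4 * d / 2 ^+ k.

(** Nested balls, the k-th of which avoids the k-th thin set, have a common
    point. *)
Lemma baire X x (e : R) : meagre X -> 0 < e -> exists2 y, rn (y - x) < e & ~ X y.
Proof.
move=> [A [Ath XA]] e0.
have step (p : nat * (V * R)) : exists q : V * R, 0 < p.2.2 ->
    [/\ 0 < q.2, q.2 <= p.2.2 / 4, rn (q.1 - p.2.1) <= p.2.2 / 4 &
        forall y, rn (y - q.1) < q.2 -> ~ A p.1 y].
  case: p => k [c r] /=; have [r0|r0] := ltP 0 r; last by exists (c, r).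
  have r4 : 0 < r / 4 by rewrite divr_gt0.
  have [y yc yA] := (Ath k).2 c (r / 4) r4.
  have [d d0 dP] := (Ath k).1 y yA.
  exists (y, Num.min d (r / 4)) => _; split=> //=.
  - by rewrite lt_min d0.
  - by rewrite ge_min lexx orbT.
  - exact: ltW.
  - by move=> z; rewrite lt_min => /andP[/dP].
have [g gP] := choice step.
(* the k-th ball has centre (s k).1 and radius (s k).2 *)
pose s := fix s k : V * R := if k is k'.+1 then g (k', s k') else (x, e).
have s0 k : 0 < (s k).2 by elim: k => //= k IH; have [] := gP (k, s k) IH.
have sP k := gP (k, s k) (s0 k).
have dist k j : rn ((s (k + j)%N).1 - (s k).1) <= (s k).2 / 2 - (s (k + j)%N).2 / 2.
  elim: j => [|j IH]; first by rewrite addn0 !subrr rn0.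
  have [_ /= h1 h2 _] := sP (k + j)%N; rewrite addnS /=.
  have := rn_dist (s (k + j)%N).1 (g ((k + j)%N, s (k + j)%N)).1 (s k).1.
  have := s0 (k + j)%N; lra.
have re k : (s k).2 <= e / 2 ^+ k.
  elim: k => [|k IH]; first by rewrite expr0 divr1.
  have [_ /= h1 _ _] := sP k; rewrite exprSr invfM mulrA; have := s0 k; lra.
have [z zP] : exists z, forall k, rn (z - (s k).1) <= 4 * (e / 4) / 2 ^+ k.
  apply: complete => k; have [_ _ /= h _] := sP k; apply: le_trans h _.
  have := re k; have -> : e / 4 / 2 ^+ k = e / 2 ^+ k / 4 by rewrite mulrAC.
  lra.
have zs k : rn (z - (s k).1) < (s k).2.
  have sk := s0 k; have s4 : 0 < (s k).2 / 4 by rewrite divr_gt0.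
  have [j jP] := geo_small e s4.
  have h1 := dist k j; have h2 := zP (k + j)%N; have h3 := s0 (k + j)%N.
  have h4 := rn_dist (s (k + j)%N).1 z (s k).1.
  have h5 : 4 * (e / 4) / 2 ^+ (k + j) <= e / 2 ^+ j.
    rewrite mulrCA divff // mulr1 ler_wpM2l ?(ltW e0) // lef_pV2 ?posrE ?exprn_gt0 //.
    by rewrite ler_weXn2l ?ler1n // leq_addl.
  lra.
exists z; first exact: (zs 0%N).
by move=> /XA[k _]; have [_ _ _ /= H] := sP k; apply: H; exact: (zs k.+1).
Qed.

End Thin.

Lemma baire_rV n (X : set 'rV[K]_n) x (e : R) : meagre X -> 0 < e ->
  exists2 y, rn (y - x) < e & ~ X y.
Proof. exact: (baire (@rV_geo_lim R n)). Qed.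

(** Countably many basic neighbourhoods are enough to cover A. *)
Lemma meagre_local (T : Type) (V : normedModType K) (I : countType) (U : I -> set T)
    (nb : T -> set T -> Prop) (F : T -> V) (A : set T) :
  (forall x N, nb x N -> exists2 i, U i x & U i `<=` N) ->
  (forall x, A x -> exists2 N, nb x N & meagre (F @` (A `&` N))) ->
  meagre (F @` A).
Proof.
move=> Ub loc; pose X i : set V := [set w | (F @` (A `&` U i)) w /\ meagre (F @` (A `&` U i))].
apply: (@meagre_bigcup V I X) => [i|w [x Ax <-]].
  have [h|h] := pselect (meagre (F @` (A `&` U i))).
    by apply: sub_meagre h => w [].
  by apply: sub_meagre (@meagre0 V) => w [_ /h].
have [N xN mN] := loc x Ax; have [i Uix UN] := Ub x N xN.
exists i; split; first by exists x.
by apply: sub_meagre mN => w' [y [Ay Uy] <-]; exists y => //; split=> //; exact: UN.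
Qed.

Lemma rational_ball n (x : 'rV[K]_n) (e : R) : 0 < e ->
  exists q : 'I_n -> rat * rat, forall i, rn (x 0 i - Complex (ratr (q i).1) (ratr (q i).2) : K) < e.
Proof.
move=> e0; have e2 : 0 < e / 2 by rewrite divr_gt0.
have near (a : R) : exists q : rat, `|a - ratr q| < e / 2.
  have [|q] := @rat_in_itvoo R (a - e / 2) (a + e / 2); first by lra.
  by rewrite in_itv /= => /andP[h1 h2]; exists q; rewrite ltr_norml; lra.
have /choice[q qP] (i : 'I_n) : exists q : rat * rat,
    rn (x 0 i - Complex (ratr q.1) (ratr q.2) : K) < e.
  have [q1 h1] := near (complex.Re (x 0 i)); have [q2 h2] := near (complex.Im (x 0 i)).
  exists (q1, q2); apply: le_lt_trans (rn_ReIm _) _.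
  rewrite !ReD ImD ReN /=; move: h1 h2; case: (x 0 i) => a b /= h1 h2.
  lra.
by exists q.
Qed.

Lemma meagre_local_rV n (V : normedModType K) (F : 'rV[K]_n -> V) (A : set 'rV[K]_n) :
  (forall x, A x -> exists2 e : R, 0 < e &
     meagre (F @` (A `&` [set y | rn (y - x) < e]))) ->
  meagre (F @` A).
Proof.
move=> loc.
pose U (p : {ffun 'I_n -> rat * rat} * nat) : set 'rV[K]_n :=
  [set y | forall i, rn (y 0 i - Complex (ratr (p.1 i).1) (ratr (p.1 i).2) : K) < 1 / 2 ^+ p.2].
apply: (@meagre_local _ V _ U (fun x N => exists2 e : R, 0 < e & [set y | rn (y - x) < e] `<=` N)).
  move=> x N [e e0 eN]; have e2 : 0 < e / 4 by rewrite divr_gt0.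
  have [k kP] := geo_small 1 e2.
  have k0 : 0 < 1 / 2 ^+ k :> R by rewrite divr_gt0 // exprn_gt0.
  have [q qP] := rational_ball x k0.
  exists ([ffun i => q i], k) => [i|y /= Uy]; first by rewrite ffunE; exact: qP.
  apply: eN => /=; apply: (@le_lt_trans _ _ (e / 2)); last by lra.
  apply: rn_rV => [|i]; first by rewrite divr_ge0 // ltW.
  rewrite !mxE; have := Uy i; rewrite /= ffunE; have := qP i.
  move: (Complex _ _ : K) => c; have := rn_dist c (y 0 i) (x 0 i).
  by rewrite (rnB c); lra.
move=> x /loc[e e0 h]; exists [set y | rn (y - x) < e] => //.
by exists e.
Qed.

Lemma second_countable_family (T : topologicalType) : @second_countable T ->
  exists U : nat -> set T, forall x N, nbhs x N -> exists2 k, U k x & U k `<=` N.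
Proof.
move=> [B Bc [Bo Bb]].
have bas x N : nbhs x N -> exists2 W, B W & W x /\ W `<=` N.
  by move=> /Bb[W /= [BW Wx] WN]; exists W.
have /pfcard_geP[B0|[f]] : (B #<= [set: nat])%card by [].
  exists (fun=> set0) => x N /bas[W]; by rewrite B0.
exists f => x N /bas[W BW [Wx WN]].
have [k _ fk] : (f @` [set: nat]) W by rewrite image_eq.
by exists k; rewrite fk.
Qed.

Lemma rclosedP (V : normedModType K) (A : set V) : rclosed A <-> closed A.
Proof.
split=> [Ac|Ac x Ax].
  rewrite -[A]setCK; apply: open_closedC; rewrite openE => x /Ac[e e0 eP].
  by apply/nbhs_rn; exists e => // y; rewrite rnB; exact: eP.
have : open (~` A) by exact: closed_openC.
rewrite openE => /(_ _ Ax)/nbhs_rn[e e0 eP]; exists e => // y; rewrite rnB.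
exact: eP.
Qed.

Lemma disc_compact (M : R) : compact [set z : K | rn z <= M].
Proof.
pose B := `[- M, M]%classic : set R.
pose f (p : R * R) : K := Complex p.1 p.2.
have fc : continuous f.
  move=> [x y] A /nbhs_rn[e e0 eA].
  have e2 : 0 < e / 2 by rewrite divr_gt0.
  exists (ball x (e / 2), ball y (e / 2)); first by split; exact: nbhsx_ballx.
  move=> [x' y'] [/= h1 h2]; apply: eA; apply: le_lt_trans (rn_ReIm _) _.
  have -> : f (x, y) - f (x', y') = Complex (x - x') (y - y') by [].
  by rewrite /=; move: h1 h2; rewrite -!ball_normE /=; lra.
have Bc : compact (f @` (B `*` B)).
  apply: continuous_compact.
    by apply: continuous_in_subspaceT => p _; exact: fc.
  by apply: compact_setX; exact: segment_compact.
apply: subclosed_compact Bc _; last first.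
  move=> [x y] /= h; exists (x, y) => //; split=> /=; rewrite /B /= in_itv /= -ler_norml.
    exact: le_trans (rn_Re _) h.
  exact: le_trans (rn_Im _) h.
apply/rclosedP => z /= /negP; rewrite -ltNge => zM; exists (rn z - M); first lra.
by move=> y yz /=; have := rn_subl z y; rewrite rnB; lra.
Qed.

Lemma ball_compact n (c : 'rV[K]_n) (r : R) : compact [set v | rn (v - c) <= r].
Proof.
have BC : compact [set v : 'rV[K]_n | forall i, rn (v 0 i : K) <= r + rn c].
  apply: (@rV_compact K n (fun=> [set z : K | rn z <= r + rn c])) => _.
  exact: disc_compact.
apply: subclosed_compact BC _; last first.
  move=> v /= vc i; apply: le_trans (rn_coord _ _) _.
  by have := rn_subl v c; lra.
apply/rclosedP => v /= /negP; rewrite -ltNge => h; exists (rn (v - c) - r); first lra.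
by move=> y /rn_far.
Qed.

(** A relatively closed part of a closed ball is compact, hence its
    image is closed. *)
Lemma image_rclosed n (V : normedModType K) (F : 'rV[K]_n -> V) (c : 'rV[K]_n)
    (r : R) (P : set 'rV[K]_n) :
  (forall v, rn (v - c) <= r -> dif F v) ->
  (forall v, rn (v - c) <= r -> ~ P v ->
     exists2 e : R, 0 < e & forall w, rn (w - v) < e -> ~ P w) ->
  rclosed (F @` [set v | rn (v - c) <= r /\ P v]).
Proof.
move=> Fd Pc; apply/rclosedP; apply: compact_closed; first exact: norm_hausdorff.
apply: continuous_compact.
  apply: continuous_in_subspaceT => v; rewrite inE => -[vc _].
  by have [h] := Fd v vc; exact: differentiable_continuous.
apply: subclosed_compact (@ball_compact n c r) _; last by move=> v [].
apply/rclosedP => v /= nv; have [vc|vc] := leP (rn (v - c)) r.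
  have [|e e0 eP] := Pc v vc; first by move=> Pv; apply: nv.
  by exists e => // w /eP nP [].
exists (rn (v - c) - r); first lra.
by move=> y /rn_far yv [].
Qed.

End Category.

(** * Changes of coordinates *)

Section Insertion.
Variable R : realType.
Notation K := (C R).

Lemma dif_affine (V W : normedModType K) (f : V -> W) (x : V) (L : V -> W) (A : R) :
  linear L -> (forall v, rn (L v) <= A * rn v) ->
  (forall h, f (x + h) = f x + L h) -> dif f x /\ forall v, D f x v = L v.
Proof.
move=> Ll LA fE; apply: (dif_intro Ll LA) => e e0; exists 1 => // h _.
by rewrite fE (addrC (f x)) addrK subrr rn0 mulr_ge0 ?rn_ge0 // ltW.
Qed.

Lemma dif_id (V : normedModType K) (x : V) : dif id x /\ forall v, D id x v = v.
Proof.
by apply: (@dif_affine V V id x id 1) => // v; rewrite mul1r.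
Qed.

Lemma dif_proj n (i : 'I_n) (x : 'rV[K]_n) :
  dif (fun z : 'rV[K]_n => z 0 i : K) x /\
  forall v, D (fun z : 'rV[K]_n => z 0 i : K) x v = v 0 i.
Proof.
have [h1 h2] := dif_id x; have [h3 h4] := dif_coord i h1.
by split=> // v; rewrite h4 h2.
Qed.

Lemma dif_sum (V : normedModType K) (I : Type) (r : seq I) (P : pred I) (f : I -> V -> K) x :
  (forall i, dif (f i) x) -> dif (fun z => \sum_(i <- r | P i) f i z) x.
Proof.
move=> fd; elim: r => [|i r IH].
  have -> : (fun z => \sum_(i <- [::] | P i) f i z) = (fun=> 0).
    by apply/funext => z; rewrite big_nil.
  exact: (proj1 (dif_cst _ _)).
have -> : (fun z => \sum_(i <- i :: r | P i) f i z) =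
    (fun z => (if P i then f i z else 0) + \sum_(i <- r | P i) f i z).
  by apply/funext => z; rewrite big_cons; case: (P i) => //; rewrite add0r.
apply: (proj1 (difD _ IH)); case: (P i) => //; exact: (proj1 (dif_cst _ _)).
Qed.

Lemma dif_prod (V : normedModType K) (I : Type) (r : seq I) (f : I -> V -> K) x :
  (forall i, dif (f i) x) -> dif (fun z => \prod_(i <- r) f i z) x.
Proof.
move=> fd; elim: r => [|i r IH].
  have -> : (fun z => \prod_(i <- [::]) f i z) = (fun=> 1).
    by apply/funext => z; rewrite big_nil.
  exact: (proj1 (dif_cst _ _)).
have -> : (fun z => \prod_(i <- i :: r) f i z) = (fun z => f i z * \prod_(i <- r) f i z).
  by apply/funext => z; rewrite big_cons.
exact: (proj1 (difM (fd i) IH)).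
Qed.

Lemma dif_det (V : normedModType K) n (A : V -> 'M[K]_n) x :
  (forall i j, dif (fun z => A z i j : K) x) -> dif (fun z => \det (A z) : K) x.
Proof.
move=> Ad; apply: dif_sum => s; apply: (proj1 (difM (proj1 (dif_cst _ _)) _)).
by apply: dif_prod => i; exact: Ad.
Qed.

Section Ins.
Variable n : nat.
Implicit Types (i : 'I_n.+1) (u : 'rV[K]_n) (v w : 'rV[K]_n.+1) (t : K).

(** The inverse of the splitting of a vector into its i-th entry and [col' i]. *)
Definition ins i t u : 'rV[K]_n.+1 :=
  \row_k if unlift i k is Some k' then u 0 k' else t.

Lemma ins_at i t u : ins i t u 0 i = t.
Proof. by rewrite mxE unlift_none. Qed.

Lemma ins_lift i t u k : ins i t u 0 (lift i k) = u 0 k.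
Proof. by rewrite mxE liftK. Qed.

Lemma col'_ins i t u : col' i (ins i t u) = u.
Proof. by apply/rowP => k; rewrite mxE ins_lift. Qed.

Lemma ins_eta i v : ins i (v 0 i) (col' i v) = v.
Proof. by apply/rowP => k; rewrite mxE; case: unliftP => [k' ->|->] //; rewrite mxE. Qed.

Lemma insP i v w : v 0 i = w 0 i -> col' i v = col' i w -> v = w.
Proof. by move=> h1 h2; rewrite -(ins_eta i v) h1 h2 ins_eta. Qed.

Lemma ins_lin i : linear (ins i 0).
Proof.
move=> k u w; apply: (@insP i); first by rewrite !mxE !unlift_none mulr0 addr0.
by rewrite col'_ins; apply/rowP => l; rewrite !mxE !liftK.
Qed.

Lemma rn_ins i t u (e : R) : rn t <= e -> rn u <= e -> rn (ins i t u) <= e.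
Proof.
move=> te ue; apply: rn_rV => [|k]; first exact: le_trans (rn_ge0 t) te.
by rewrite mxE; case: unliftP => [k' _|_] //; exact: le_trans (rn_coord _ _) ue.
Qed.

Lemma ins_sub i t t' u u' : ins i t u - ins i t' u' = ins i (t - t') (u - u').
Proof.
apply: (@insP i); first by rewrite !mxE !unlift_none.
by rewrite col'_ins; apply/rowP => l; rewrite !mxE !liftK.
Qed.

Lemma rn_col' i v : rn (col' i v) <= rn v.
Proof. by apply: rn_rV => [|k]; [exact: rn_ge0|rewrite mxE; exact: rn_coord]. Qed.

Lemma dif_ins i t u : dif (ins i t) u /\ forall h, D (ins i t) u h = ins i 0 h.
Proof.
apply: (@dif_affine _ _ (ins i t) u (ins i 0) 1); first exact: ins_lin.
  by move=> v; rewrite mul1r; apply: rn_ins; rewrite ?rn0 ?rn_ge0.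
move=> h; apply: (@insP i); first by rewrite !mxE !unlift_none addr0.
by rewrite col'_ins; apply/rowP => l; rewrite !mxE !liftK.
Qed.

Lemma dif_col' i v : dif (@col' K 1 n.+1 i) v /\ forall w, D (@col' K 1 n.+1 i) v w = col' i w.
Proof.
apply: (@dif_affine _ _ _ v (@col' K 1 n.+1 i) 1).
- by move=> k u w; apply/rowP => l; rewrite !mxE.
- by move=> w; rewrite mul1r; exact: rn_col'.
- by move=> h; apply/rowP => l; rewrite !mxE.
Qed.

End Ins.

Lemma dif_ins_fun (V : normedModType K) n (i : 'I_n.+1) (g : V -> K) (F : V -> 'rV[K]_n) x :
  dif g x -> dif F x -> dif (fun y => ins i (g y) (F y)) x /\
  forall v, D (fun y => ins i (g y) (F y)) x v = ins i (D g x v) (D F x v).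
Proof.
move=> gd Fd; have [A A0 AP] := D_bounded gd; have [B B0 BP] := D_bounded Fd.
apply: (@dif_intro _ _ _ _ _ (fun v => ins i (D g x v) (D F x v)) (A + B)).
- move=> k u v; rewrite !D_add !D_scale; apply: (@insP _ i); first by rewrite !mxE !unlift_none.
  by rewrite col'_ins; apply/rowP => l; rewrite !mxE !liftK.
- move=> v; apply: rn_ins; rewrite mulrDl.
    by apply: le_trans (AP v) _; rewrite lerDl mulr_ge0 ?rn_ge0 // ltW.
  by apply: le_trans (BP v) _; rewrite lerDr mulr_ge0 ?rn_ge0 // ltW.
- move=> e e0; have [d1 d10 dP1] := D_rn gd e0; have [d2 d20 dP2] := D_rn Fd e0.
  exists (Num.min d1 d2); first by rewrite lt_min d10.
  by move=> h; rewrite lt_min !ins_sub => /andP[/dP1 h1 /dP2 h2]; exact: rn_ins.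
Qed.

(** A function with a nonzero partial derivative can take the place of a
    coordinate. *)
Lemma straighten n (f : 'rV[K]_n.+1 -> K) (x : 'rV[K]_n.+1) (e : R) (i : 'I_n.+1) :
  0 < e -> dif_on x e f -> pd i f x != 0 ->
  exists (a : 'rV[K]_n.+1) (t : R) (G : 'rV[K]_n.+1 -> 'rV[K]_n.+1),
  [/\ 0 < t, dif_on a t G,
      forall y, rn (y - a) < t -> rn (G y - x) < e /\ f (G y) = y 0 ord0 &
      forall r : R, 0 < r -> exists2 d : R, 0 < d &
        forall z, rn (z - x) < d -> exists2 y, rn (y - a) < r & G y = z].
Proof.
move=> e0 fd fi; pose H y := ins ord0 (f y) (col' i y).
have Hd z : rn (z - x) < e -> dif H z /\ forall v, D H z v = ins ord0 (D f z v) (col' i v).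
  move=> zx; have [h1 h2] := dif_col' i z; have [h3 h4] := dif_ins_fun ord0 (fd z zx) h1.
  by split=> [|v]; [exact: h3|rewrite h4 h2].
have xx : rn (x - x) < e by rewrite subrr rn0.
have [|t [G [t0 Gd GP Gx Gsur]]] := local_inverse e0 (fun z zx => (Hd z zx).1).
  move=> v; rewrite (Hd x xx).2 => v0.
  have v1 : col' i v = 0.
    by rewrite -(col'_ins ord0 (D f x v) (col' i v)) v0; apply/rowP => k; rewrite !mxE.
  have vE : v = v 0 i *: delta_mx 0 i.
    apply: (@insP _ i); first by rewrite !mxE !eqxx mulr1.
    rewrite v1; apply/rowP => k; rewrite !mxE eqxx /= (_ : lift i k == i = false) ?mulr0 //.
    by rewrite eq_sym (negPf (neq_lift i k)).
  have := ins_at ord0 (D f x v) (col' i v); rewrite v0 mxE vE D_scale.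
  move=> /esym/eqP; rewrite mulf_eq0 (negPf fi) orbF => /eqP ->.
  by rewrite scale0r.
exists (H x), t, G; split=> // [y yt|r r0].
  by have [h1 h2] := GP y yt; split; [exact: h1|rewrite -[in RHS]h2 ins_at].
by have := Gsur (H x) r; rewrite Gx subrr rn0; exact.
Qed.

End Insertion.

(** * Sard's theorem *)

Section Sard.
Variable R : realType.
Notation K := (C R).

Definition critical (V W : normedModType K) (F : V -> W) x :=
  ~ forall w, exists v, D F x v = w.

Lemma critical_comp (U V W : normedModType K) (G : U -> V) (F : V -> W) y :
  dif G y -> dif F (G y) -> critical F (G y) -> critical (fun z => F (G z)) y.
Proof.
move=> Gd Fd cF sur; apply: cF => w; have [v <-] := sur w.
by have [_ ->] := dif_comp Gd Fd; exists (D G y v).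
Qed.

Lemma critical0 (V W : normedModType K) (F : V -> W) x (w : W) :
  (forall v, D F x v = 0) -> w != 0 -> critical F x.
Proof. by move=> F0 w0 sur; have [v] := sur w; rewrite F0 => E; rewrite -E eqxx in w0. Qed.

Lemma dif_neq0 (V : normedModType K) (f : V -> K) x : dif f x -> f x != 0 ->
  exists2 d : R, 0 < d & forall y, rn (y - x) < d -> f y != 0.
Proof.
move=> fd; rewrite -rn_gt0 => p0; have [d d0 dP] := dif_continuous fd p0.
exists d => // y; rewrite rnB => /dP; apply: contraTneq => ->.
by rewrite subr0 ltxx.
Qed.

Lemma det_unitmx (F : fieldType) n (A : 'M[F]_n) : \det A != 0 -> A \in unitmx.
Proof. by rewrite unitmxE unitfE. Qed.

(** A right inverse B of the Jacobian matrix at x witnesses surjectivity near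
    x, as long as the determinant of the product does not vanish. *)
Lemma critical_closed n m (F : 'rV[K]_n -> 'rV[K]_m) x (e : R) : 0 < e -> dif_on x e F ->
  ~ critical F x -> exists2 d : R, 0 < d & forall y, rn (y - x) < d -> ~ critical F y.
Proof.
move=> e0 Fd /contrapT sur.
have [B BJ] : exists B : 'M[K]_(m, n), B *m Jmx F x = 1%:M.
  have /choice[b bP] (j : 'I_m) : exists b : 'rV[K]_n, b *m Jmx F x = delta_mx 0 j.
    by have [v vE] := sur (delta_mx 0 j); exists v; rewrite -JmxE.
  exists (\matrix_j b j); apply/row_matrixP => j.
  by rewrite row_mul rowK bP row1.
have xx : rn (x - x) < e by rewrite subrr rn0.
have dd : dif (fun y => \det (B *m Jmx F y) : K) x.
  apply: dif_det => i j.
  have -> : (fun y => (B *m Jmx F y) i j : K) = (fun y => \sum_k B i k * D F y (delta_mx 0 k) 0 j).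
    by apply/funext => y; rewrite mxE; apply: eq_bigr => k _; rewrite mxE.
  apply: (proj1 (dif_lincomb _ _)) => k.
  have fd : dif_on x e (fun z => F z 0 j : K).
    by move=> z ze; exact: (proj1 (dif_coord j (Fd z ze))).
  have gd := dif_D (delta_mx 0 k) fd.
  apply: (proj1 (eq_dif_near e0 _ (gd x xx))) => y; rewrite rnB => ye.
  by have [_ ->] := dif_coord j (Fd y ye).
have [|d d0 dP] := dif_neq0 dd; first by rewrite BJ det1 oner_neq0.
exists d => // y /dP/det_unitmx u.
move=> c; apply: c => w; exists (w *m invmx (B *m Jmx F y) *m B).
by rewrite JmxE -mulmxA mulmxKV.
Qed.

Lemma meagre1 n (w : 'rV[K]_n.+1) : meagre [set w].
Proof.
apply: meagre_thin; split=> [x xw|x e e0].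
  have xw0 : 0 < rn (w - x) by rewrite rn_gt0 subr_eq0; apply/eqP => E; apply: xw.
  by exists (rn (w - x)) => // y + yw; rewrite yw ltxx.
have [->|/eqP xw] := eqVneq x w; last by exists x => //; rewrite subrr rn0.
have e2 : 0 < e / 2 by rewrite divr_gt0.
exists (w + const_mx (RtoC (e / 2))).
  rewrite (addrC w) addrK; apply: le_lt_trans (_ : e / 2 < e); last by lra.
  by apply: rn_rV => [|k]; [exact: ltW|rewrite mxE rn_real gtr0_norm].
move=> /= /eqP; rewrite -subr_eq0 (addrC w) addrK => /eqP/rowP/(_ ord0).
rewrite !mxE => E; have := congr1 (fun z : K => rn z) E; rewrite rn_real rn0 gtr0_norm //.
by move: e2 => /[swap] ->; rewrite ltxx.
Qed.

Lemma meagreU (V : normedModType K) (X Y Z : set V) : meagre X -> meagre Y ->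
  (forall z, Z z -> X z \/ Y z) -> meagre Z.
Proof.
move=> Xm Ym ZXY; apply: (@meagre_bigcup _ V bool (fun b => if b then X else Y)).
  by case.
by move=> z /ZXY[]; [exists true|exists false].
Qed.

(** Sard's theorem in source dimension n, for all targets: the hypothesis of
    an induction on n. *)
Definition sard_at n := forall m (F : 'rV[K]_n -> 'rV[K]_m) (A : set 'rV[K]_n),
  (forall x, A x -> critical F x /\ exists2 e : R, 0 < e & dif_on x e F) -> meagre (F @` A).

(** One component of G is a coordinate. On the level sets of this coordinate,
    which have dimension n, the critical points of G are critical for the
    other components; so every slice of the image has empty interior. *)
Lemma sard_slices n m (G : 'rV[K]_n.+1 -> 'rV[K]_m.+1) j a (t r : R) : sard_at n ->
  0 < t -> r < t -> dif_on a t G ->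
  (forall y, rn (y - a) < t -> G y 0 j = y 0 ord0) ->
  thin (G @` [set v | rn (v - a) <= r /\ critical G v]).
Proof.
move=> IH t0 rt Gd Gj; split.
  apply: image_rclosed => [v vr|v vr /= nc]; first by apply: Gd; exact: le_lt_trans vr rt.
  have [d d0 dP] := ball_sub (le_lt_trans vr rt).
  by apply: (critical_closed d0) => // z /dP/Gd.
move=> p e e0; pose u0 : 'rV[K]_n := col' ord0 a; pose s := p 0 j.
pose H u : 'rV[K]_m := col' j (G (ins ord0 s u)).
pose A := [set u | rn (ins ord0 s u - a) < t /\ critical G (ins ord0 s u)].
have HA : meagre (H @` A).
  apply: IH => u [ut cu].
  have Hd w : rn (ins ord0 s w - a) < t ->
      dif H w /\ forall v, D H w v = col' j (D G (ins ord0 s w) (ins ord0 0 v)).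
    move=> wt; have [h1 h2] := dif_ins ord0 s w.
    have [h3 h4] := dif_comp h1 (Gd _ wt).
    have [h5 h6] := dif_comp h3 (dif_col' j (G (ins ord0 s w))).1.
    split=> [|v]; first exact: h5.
    by rewrite h6 (dif_col' j _).2 h4 h2.
  have G0 v : D G (ins ord0 s u) v 0 j = v 0 ord0.
    have [_ <-] := dif_coord j (Gd _ ut).
    have [d d0 dP] := ball_sub ut.
    have [_ <-] := dif_proj ord0 (ins ord0 s u).
    have [h1 _] := dif_proj ord0 (ins ord0 s u).
    by have [_ ->] := eq_dif_near d0 (fun y yd => esym (Gj y (dP y (eq_ind _ (fun z => is_true (z < d)) yd _ (rnB _ _))))) h1.
  split=> [sur|].
    apply: cu => w; pose z0 : 'rV[K]_n.+1 := ins ord0 (w 0 j) 0.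
    have [v vE] := sur (col' j (w - D G (ins ord0 s u) z0)).
    exists (z0 + ins ord0 0 v); rewrite D_add; apply: (@insP _ _ j).
      by rewrite mxE !G0 /z0 !ins_at addr0.
    move: vE; rewrite (Hd u ut).2 => /rowP vE; apply/rowP => k; have := vE k.
    by rewrite !mxE => ->; rewrite addrC subrK.
  have [d d0 dP] := ball_sub ut; exists d => // w wu; apply: (Hd w _).1.
  by apply: dP; rewrite ins_sub subrr; apply: le_lt_trans wu; apply: rn_ins; rewrite ?rn0 ?rn_ge0.
have [q qp nq] := baire_rV (col' j p) HA e0.
exists (ins j s q).
  rewrite -(ins_eta j p) ins_sub subrr; apply: le_lt_trans qp.
  by apply: rn_ins; rewrite ?rn0 ?rn_ge0.
move=> [v [vr cv] vE]; apply: nq; have vt := le_lt_trans vr rt.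
have v0 : v 0 ord0 = s by rewrite -Gj // vE ins_at.
have vI : ins ord0 s (col' ord0 v) = v by rewrite -v0 ins_eta.
exists (col' ord0 v); first by rewrite /A /= vI.
by rewrite /H vI vE col'_ins.
Qed.

(** Where the differential of F is not zero, a component of F is a coordinate
    in suitable coordinates, and [sard_slices] applies. *)
Lemma sard_nonzero n m (F : 'rV[K]_n.+1 -> 'rV[K]_m) (A : set 'rV[K]_n.+1) : sard_at n ->
  (forall x, A x -> [/\ critical F x, exists2 e : R, 0 < e & dif_on x e F &
     exists v, D F x v != 0]) ->
  meagre (F @` A).
Proof.
move=> IH; case: m F => [|m] F AP.
  apply: (sub_meagre _ (@meagre0 _ _)) => _ [x /AP[_ _ [v /eqP v0]] <-]; case: v0.
  by apply/rowP => -[].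
apply: meagre_local_rV => x /AP[_ [e e0 Fd] [v v0]].
have xx : rn (x - x) < e by rewrite subrr rn0.
have [i [j ij]] : exists i j, Jmx F x i j != 0.
  apply: contrapT => H; case/eqP: v0; rewrite JmxE (_ : Jmx F x = 0) ?mulmx0 //.
  by apply/matrixP => i j; rewrite [RHS]mxE; apply: contrapT => /eqP h; apply: H; exists i, j.
have fd : dif_on x e (fun z => F z 0 j : K).
  by move=> z ze; exact: (proj1 (dif_coord j (Fd z ze))).
have fi : pd i (fun z => F z 0 j : K) x != 0.
  by rewrite /pd (dif_coord j (Fd x xx)).2; move: ij; rewrite mxE.
have [a [t [G [t0 Gd GP Gsur]]]] := straighten e0 fd fi.
have t2 : 0 < t / 2 by rewrite divr_gt0.
have tt : t / 2 < t by lra.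
have [d d0 dP] := Gsur (t / 2) t2.
have FGd : dif_on a t (fun y => F (G y)).
  by move=> y yt; apply: (proj1 (dif_comp (Gd y yt) (Fd _ (GP y yt).1))).
exists d => //; apply: sub_meagre; last first.
  exact: meagre_thin (sard_slices IH t0 tt FGd (fun y yt => (GP y yt).2)).
move=> _ [z [/AP[cz _ _] zd] <-]; have [y yt yE] := dP z zd.
exists y; last by rewrite yE.
have yt' : rn (y - a) < t by lra.
split; first exact: ltW.
apply: critical_comp; first exact: Gd.
  by apply: Fd; exact: (GP y yt').1.
by rewrite yE.
Qed.

(** The set phi = 0 is parametrized by n coordinates, and all points of A are
    critical for the restriction of F to it. *)
Lemma sard_hypersurface n m (F : 'rV[K]_n.+1 -> 'rV[K]_m.+1) (phi : 'rV[K]_n.+1 -> K) i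
    (A : set 'rV[K]_n.+1) : sard_at n ->
  (forall x, A x -> [/\ forall v, D F x v = 0, phi x = 0, pd i phi x != 0 &
     exists2 e : R, 0 < e & dif_on x e F /\ dif_on x e phi]) ->
  meagre (F @` A).
Proof.
move=> IH AP; apply: meagre_local_rV => x /AP[_ _ fi [e e0 [Fd fd]]].
have [a [t [G [t0 Gd GP Gsur]]]] := straighten e0 fd fi.
have [d d0 dP] := Gsur t t0; exists d => //.
pose H u := F (G (ins ord0 0 u)).
pose B := [set u | rn (ins ord0 0 u - a) < t /\ forall v, D F (G (ins ord0 0 u)) v = 0].
apply: (@sub_meagre _ _ _ (H @` B)); last first.
  apply: IH => u [ut u0].
  have Hd w : rn (ins ord0 0 w - a) < t ->
      dif H w /\ forall v, D H w v = D F (G (ins ord0 0 w)) (D G (ins ord0 0 w) (ins ord0 0 v)).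
    move=> wt; have [h1 h2] := dif_ins ord0 0 w.
    have [h3 h4] := dif_comp h1 (Gd _ wt).
    have [h5 h6] := dif_comp h3 (Fd _ (GP _ wt).1).
    by split=> [|v]; [exact: h5|rewrite h6 h4 h2].
  split.
    apply: (@critical0 _ _ _ _ (const_mx 1)).
      by move=> v; rewrite (Hd u ut).2.
    by apply/eqP => /rowP/(_ ord0); rewrite !mxE => /eqP; rewrite oner_eq0.
  have [d' d'0 dP'] := ball_sub ut; exists d' => // w wu; apply: (Hd w _).1.
  by apply: dP'; rewrite ins_sub subrr; apply: le_lt_trans wu; apply: rn_ins; rewrite ?rn0 ?rn_ge0.
move=> _ [z [/AP[z0 fz _ _] zd] <-]; have [y yt yE] := dP z zd.
have y0 : y 0 ord0 = 0 by rewrite -(GP y yt).2 yE.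
have yI : ins ord0 0 (col' ord0 y) = y by rewrite -y0 ins_eta.
exists (col' ord0 y); last by rewrite /H yI yE.
by split; rewrite /= yI; [exact: yt|rewrite yE].
Qed.

Lemma flat_constant n (f : 'rV[K]_n -> K) x (e : R) : 0 < e -> dif_on x e f ->
  (forall s, s != [::] -> pds s f x = 0) ->
  exists2 d : R, 0 < d & forall z, rn (z - x) < d -> f z = f x.
Proof.
move=> e0 fd fl.
pose g z := f z + - f x.
have gd z : rn (z - x) < e -> dif g z /\ forall v, D g z v = D f z v.
  move=> zx; have [h1 h2] := dif_cst (- f x) z; have [h3 h4] := difD (fd z zx) h1.
  by split=> [|v]; [exact: h3|rewrite h4 h2 addr0].
have xx : rn (x - x) < e by rewrite subrr rn0.
have gfl : flat g x.
  move=> s; case: (lastP s) => [|s' i]; first by rewrite /= /g subrr.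
  have := fl (rcons s' i); rewrite /pds !foldr_rcons => h.
  rewrite -[RHS]h; last by case: (s').
  have pgd : dif_on x e (pd i g).
    by apply: (@pds_dif _ _ x e [:: i]) => z /gd[].
  apply: (eq_pds s' pgd _ xx) => z ze.
  by rewrite /pd (gd z ze).2.
have [d d0 dP] := flat_near e0 (fun z ze => (gd z ze).1) gfl.
by exists d => // z /dP/eqP; rewrite subr_eq0 => /eqP.
Qed.

(** Where the differential vanishes, either all derivatives of F vanish, and
    then F is locally constant, or some derivative has a nonzero partial
    derivative; the latter points lie on countably many hypersurfaces. *)
Lemma sard_zero n m (F : 'rV[K]_n.+1 -> 'rV[K]_m.+1) (A : set 'rV[K]_n.+1) : sard_at n ->
  (forall x, A x -> (forall v, D F x v = 0) /\ exists2 e : R, 0 < e & dif_on x e F) ->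
  meagre (F @` A).
Proof.
move=> IH AP.
have fd x j (e : R) : dif_on x e F -> dif_on x e (fun z => F z 0 j : K).
  by move=> Fd z ze; exact: (proj1 (dif_coord j (Fd z ze))).
pose f j : 'rV[K]_n.+1 -> K := fun z => F z 0 j.
apply: (@meagreU _ (F @` [set x | A x /\ forall j s, s != [::] -> pds s (f j) x = 0])
  (F @` [set x | A x /\ exists j s i, pds s (f j) x = 0 /\ pds (i :: s) (f j) x != 0])).
- apply: meagre_local_rV => x [/AP[_ [e e0 Fd]] fl].
  have /choice[d dP] (j : 'I_m.+1) : exists d : R, 0 < d /\
      forall z, rn (z - x) < d -> F z 0 j = F x 0 j.
    have [d d0 dP] := flat_constant e0 (fd x j e Fd) (fl j).
    by exists d.
  exists (\big[Num.min/1]_(j < m.+1) d j).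
    by apply: lt_bigmin => // j _; exact: (dP j).1.
  apply: sub_meagre (meagre1 (F x)) => _ [z [_ zd] <-]; apply/rowP => j.
  by apply: (dP j).2; apply: lt_le_trans zd _; exact: bigmin_le_cond.
- pose B (q : 'I_m.+1 * seq 'I_n.+1 * 'I_n.+1) := [set x | A x /\
     pds q.1.2 (f q.1.1) x = 0 /\ pds (q.2 :: q.1.2) (f q.1.1) x != 0].
  apply: (@meagre_bigcup _ _ _ (fun q => F @` B q)); last first.
    by move=> _ [x [Ax [j [s [i h]]]] <-]; exists (j, s, i), x.
  move=> [[j s] i]; apply: (@sard_hypersurface n m F (pds s (f j)) i _ IH).
  move=> x [/AP[F0 [e e0 Fd]] [h1 h2]]; split=> //; exists e => //.
  by split=> //; apply: pds_dif; exact: fd.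
- move=> _ [x Ax <-].
  have [h|h] := pselect (forall j s, s != [::] -> pds s (f j) x = 0).
    by left; exists x.
  right; exists x => //; split=> //; apply: contrapT => H; apply: h => j s.
  have [F0 [e e0 Fd]] := AP x Ax; have xx : rn (x - x) < e by rewrite subrr rn0.
  elim: s => // i s IHs _; have [->|/IHs s0] := eqVneq s [::].
    by rewrite /= /pd (dif_coord j (Fd x xx)).2 F0 mxE.
  by apply: contrapT => /eqP h; apply: H; exists j, s, i.
Qed.

(** Sard's theorem for holomorphic maps, with meagre sets in place of null
    sets. *)
Theorem sard n m (F : 'rV[K]_n -> 'rV[K]_m) (A : set 'rV[K]_n) :
  (forall x, A x -> critical F x /\ exists2 e : R, 0 < e & dif_on x e F) -> meagre (F @` A).
Proof.
suff: sard_at n by apply.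
elim: n {m F A} => [|n IH] m F A AP.
  case: m F AP => [|m] F AP; last first.
    apply: sub_meagre (meagre1 (F 0)) => _ [x _ <-].
    by congr F; apply/rowP => -[].
  apply: (sub_meagre _ (@meagre0 _ _)) => _ [x /AP[c _] <-]; case: c => w.
  by exists 0; apply/rowP => -[].
case: m F AP => [|m] F AP.
  apply: (sub_meagre _ (@meagre0 _ _)) => _ [x /AP[c _] <-]; case: c => w.
  by exists 0; apply/rowP => -[].
apply: (@meagreU _ (F @` [set x | A x /\ exists v, D F x v != 0])
  (F @` [set x | A x /\ forall v, D F x v = 0])).
- by apply: (sard_nonzero IH) => x [/AP[]].
- by apply: (sard_zero IH) => x [/AP[]].
- move=> _ [x Ax <-]; have [h|h] := pselect (forall v, D F x v = 0).
    by right; exists x.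
  left; exists x => //; split=> //; apply: contrapT => H; apply: h => v.
  by apply: contrapT => /eqP h; apply: H; exists v.
Qed.

End Sard.

(** * The image of the degenerate points *)

Section Degenerate.
Variable R : realType.
Notation K := (C R).

(** At a zero of finite order, c' would vanish to a lower order than g c. *)
Lemma linear_ode (c g : K -> K) (r B M : R) : 0 < r -> dif_on 0 r c ->
  (forall t, rn t < r -> rn (c t) <= B) -> (forall t, rn t < r -> rn (g t) <= M) ->
  (forall t, rn t < r -> D c t (1 : K) = g t * c t) -> c 0 = 0 ->
  forall t, rn t <= r / (2 * Cq R) -> c t = 0.
Proof.
move=> r0 cd cB gM ode c0 t tr.
have cB' z : rn (z - 0) < r -> rn (c z) <= B by rewrite subr0; exact: cB.
have [[k [u [ud u0 uE]]]|] := dif_order r0 cd cB'; last by apply; rewrite subr0.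
case: k uE => [|k] uE; first by case/eqP: u0; have := esym (uE 0); rewrite c0 expr0 mul1r.
exfalso.
have [r1 r10 [M1 uM]] := locally_bounded r0 ud.
have u'd := dif_D (1 : K) ud.
have [r2 r20 [M2 u'M]] := locally_bounded r0 u'd.
have p0 : 0 < rn (u 0) by rewrite rn_gt0.
have z0 : rn (0 - 0 : K) < r by rewrite subrr rn0.
have [r3 r30 uc] := dif_continuous (ud 0 z0) (divr_gt0 p0 (ltr0n R 2)).
pose N := `|M| * `|M1| + `|M2| + 1.
have N0 : 0 < N by rewrite ltr_wpDl // addr_ge0 // mulr_ge0.
(* at a point this close to 0 the bounds for u contradict one another *)
pose m := Num.min (Num.min r r1) (Num.min (Num.min r2 r3) (rn (u 0) / 2 / N)).
have m0 : 0 < m by rewrite !lt_min r0 r10 r20 r30 !divr_gt0.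
pose z : K := RtoC (m / 2).
have zm : rn z = m / 2 by rewrite /z rn_real gtr0_norm // divr_gt0.
have mr : m <= r by rewrite !ge_min lexx.
have mr1 : m <= r1 by rewrite !ge_min lexx orbT.
have mr2 : m <= r2 by rewrite !ge_min lexx !orbT.
have mr3 : m <= r3 by rewrite !ge_min lexx !orbT.
have mN : m * N <= rn (u 0) / 2 by rewrite -ler_pdivlMr // !ge_min lexx !orbT.
have zr : rn z < r by lra.
have zn0 : z != 0 by rewrite -rn_gt0 zm divr_gt0.
have E : (k.+1%:R * u z) = z * (g z * u z - D u z (1 : K)).
  have z00 : rn (z - 0) < r by rewrite subr0.
  have hu : has_derivative u z (D u z (1 : K)) by split; first exact: ud.
  have [_] := has_derivativeM (has_derivativeX z k) hu.
  have -> : (fun t => t ^+ k.+1 * u t) = c by apply/funext => w; rewrite uE subr0.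
  rewrite ode // uE subr0 => h.
  have zk : z ^+ k != 0 by rewrite expf_neq0.
  apply: (mulfI zk); rewrite exprS in h.
  by move: h; move: (D u z 1) (u z) (g z) (z ^+ k) (k.+1%:R : K) => a b c' d e h; ring: h.
have h1 : rn (u z) <= rn (k.+1%:R * u z).
  by rewrite rnM rn_nat ler_peMl ?rn_ge0 // ler1n.
have h2 : rn (k.+1%:R * u z) <= m / 2 * N.
  rewrite E rnM zm ler_wpM2l //; first by rewrite divr_ge0 // ltW.
  have a1 : rn (g z * u z) <= `|M| * `|M1|.
    rewrite rnM ler_pM ?rn_ge0 //; first exact: le_trans (gM z zr) (ler_norm _).
    by apply: le_trans (uM z _) (ler_norm _); rewrite subr0; clear -zm m0 mr1; lra.
  have a2 : rn (D u z (1 : K) : K) <= `|M2|.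
    by apply: le_trans (u'M z _) (ler_norm _); rewrite subr0; clear -zm m0 mr2; lra.
  have a3 := rn_triB (g z * u z) (D u z (1 : K)).
  by rewrite /N; clear -a1 a2 a3; lra.
have h3 : rn (u 0 - u z) < rn (u 0) / 2.
  by apply: uc; rewrite sub0r rnN; clear -zm m0 mr3; lra.
have h4 := rn_subl (u 0) (u z); clear -h1 h2 h3 h4 mN p0; lra.
Qed.

(** The vector v is completed to a basis by the rows of Q, and l and P are the
    coordinates in this basis. *)
Lemma projection_along (F : fieldType) m (v : 'rV[F]_m.+1) : v != 0 ->
  exists (l : 'cV[F]_m.+1) (P : 'M[F]_(m.+1, m)) (Q : 'M[F]_(m, m.+1)),
  [/\ v *m P = 0, Q *m P = 1%:M, l *m v + P *m Q = 1%:M & \det (col_mx v Q : 'M[F]_(1 + m)) != 0].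
Proof.
move=> v0; have [i vi] : exists i, v 0 i != 0.
  apply: contrapT => H; case/eqP: v0; apply/rowP => i; rewrite mxE.
  by apply: contrapT => /eqP h; apply: H; exists i.
pose Q : 'M[F]_(m, m.+1) := \matrix_(k, j) (lift i k == j)%:R.
pose B : 'M[F]_(1 + m) := col_mx v Q.
have QE (u : 'rV_m) k : (u *m Q) 0 (lift i k) = u 0 k.
  rewrite mxE (bigD1 k) //= mxE eqxx mulr1 big1 ?addr0 // => k' kk'.
  by rewrite mxE (inj_eq lift_inj) (negPf kk') mulr0.
have Qi (u : 'rV_m) : (u *m Q) 0 i = 0.
  by rewrite mxE big1 // => k _; rewrite mxE eq_sym (negPf (neq_lift i k)) mulr0.
have uB : B \in unitmx.
  rewrite -row_free_unit -kermx_eq0; apply/eqP/row_matrixP => j; rewrite row0.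
  have /sub_kermxP : (row j (kermx B) <= kermx B)%MS by exact: row_sub.
  move: (row j _) => w; rewrite -(hsubmxK w) mul_row_col => wB.
  move: (lsubmx w) (rsubmx w) wB => a b wB.
  have a0 : a = 0.
    have := congr1 (fun X : 'rV_m.+1 => X 0 i) wB.
    rewrite [LHS]mxE Qi addr0 !mxE big_ord1 => /eqP; rewrite mulf_eq0 (negPf vi) orbF => /eqP h.
    by apply/rowP => k; rewrite !ord1 h mxE.
  rewrite a0 in wB *; rewrite mul0mx add0r in wB.
  rewrite (_ : b = 0) ?row_mx0 //; apply/rowP => k.
  by rewrite -QE wB !mxE.
pose X : 'M[F]_(1 + m) := invmx B.
have /eq_block_mx[h1 h2 _ h4] : block_mx (v *m lsubmx X) (v *m rsubmx X)
    (Q *m lsubmx X) (Q *m rsubmx X) = block_mx 1%:M 0 0 1%:M.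
  by rewrite -mul_col_row hsubmxK mulmxV // scalar_mx_block.
exists (lsubmx X), (rsubmx X), Q; split=> //.
  by rewrite -mul_row_col hsubmxK mulVmx.
by rewrite -unitfE -unitmxE.
Qed.

(** In the basis formed by v and the rows of Q the matrix J is block
    triangular, with an identity block. *)
Lemma det_fibre (F : fieldType) m (J : 'M[F]_(1 + m)) (v : 'rV[F]_(1 + m)) (l : 'cV[F]_(1 + m))
    (P : 'M[F]_(1 + m, m)) (Q : 'M[F]_(m, 1 + m)) :
  l *m v + P *m Q = 1%:M -> J *m P = col_mx 0 1%:M ->
  \det J = (J *m l) (lshift m ord0) 0 * \det (col_mx v Q).
Proof.
move=> lvPQ JP.
have JE : J = block_mx (usubmx (J *m l)) 0 (dsubmx (J *m l)) 1%:M *m col_mx v Q.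
  by rewrite block_mxEh vsubmxK -JP mul_row_col -!mulmxA -mulmxDr lvPQ mulmx1.
rewrite [in LHS]JE det_mulmx det_lblock det1 mulr1; congr (_ * _).
by rewrite [usubmx _]mx11_scalar det_scalar1 mxE.
Qed.

Lemma row_Jmx n m (F : 'rV[K]_n -> 'rV[K]_m) x i : row i (Jmx F x) = D F x (delta_mx 0 i).
Proof. by apply/rowP => j; rewrite !mxE. Qed.

Lemma Jmx_comp n m p (F : 'rV[K]_n -> 'rV[K]_m) (G : 'rV[K]_p -> 'rV[K]_n) x :
  (forall v, D (fun z => F (G z)) x v = D F (G x) (D G x v)) ->
  Jmx (fun z => F (G z)) x = Jmx G x *m Jmx F (G x).
Proof.
move=> FG; apply/row_matrixP => i; apply: etrans (row_Jmx _ _ _) _.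
apply: etrans (FG _) _; apply: etrans (JmxE _ _ _) _.
by rewrite row_mul; congr (_ *m _); rewrite row_Jmx.
Qed.

Lemma dif_Jmx n m (F : 'rV[K]_n -> 'rV[K]_m) x (e : R) i j : dif_on x e F ->
  dif_on x e (fun z => Jmx F z i j : K).
Proof.
move=> Fd z zx; have [d d0 dP] := ball_sub zx.
have fd : dif_on z d (fun w => F w 0 j : K).
  by move=> w /dP wx; exact: (proj1 (dif_coord j (Fd w wx))).
have zz : rn (z - z) < d by rewrite subrr rn0.
apply: (proj1 (eq_dif_near d0 _ (dif_D (delta_mx 0 i) fd zz))) => w; rewrite rnB => wd.
by rewrite mxE; have [_ ->] := dif_coord j (Fd w (dP w wd)).
Qed.

Lemma dif_bounded (V W : normedModType K) (f : V -> W) x : dif f x ->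
  exists2 r : R, 0 < r & exists M, forall z, rn (z - x) < r -> rn (f z) <= M.
Proof.
move=> fd; have [r r0 rP] := dif_continuous fd ltr01; exists r => //.
exists (rn (f x) + 1) => z; rewrite rnB => /rP.
by have := rn_subl (f z) (f x); rewrite (rnB (f z)); lra.
Qed.

(** The kernel of the differential is a line; a coordinate that is not zero on
    it completes F to a system of coordinates. *)
Lemma straighten_submersion m (F : 'rV[K]_m.+1 -> 'rV[K]_m) x (e : R) : 0 < e ->
  dif_on x e F -> ~ critical F x ->
  exists (a : 'rV[K]_m.+1) (t : R) (G : 'rV[K]_m.+1 -> 'rV[K]_m.+1),
  [/\ 0 < t, dif_on a t G,
    forall y, rn (y - a) < t -> rn (G y - x) < e /\ F (G y) = col' ord0 y, G a = x &
    forall (y : 'rV[K]_m.+1) (r : R), rn (y - a) < t -> 0 < r -> exists2 d : R, 0 < d &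
      forall z, rn (z - G y) < d -> exists2 w, rn (w - y) < r & G w = z].
Proof.
move=> e0 Fd /contrapT sur.
have xx : rn (x - x) < e by rewrite subrr rn0.
have [i iP] : exists i : 'I_m.+1, forall v, D F x v = 0 -> v 0 i = 0 -> v = 0.
  have rk : (\rank (kermx (Jmx F x)) <= 1)%N.
    rewrite mxrank_ker leq_subLR (_ : \rank (Jmx F x) = m) ?addn1 //.
    apply/eqP; rewrite -[_ == m]/(row_full _) -sub1mx; apply/row_subP => j.
    have [v vE] := sur (row j 1%:M); rewrite -vE JmxE; exact: submxMl.
  have [k0|/rowV0Pn[w wk w0]] := eqVneq (kermx (Jmx F x)) 0.
    exists ord0 => v; rewrite JmxE => /sub_kermxP; rewrite k0 submx0 => /eqP //.
  have [i wi] : exists i, w 0 i != 0.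
    apply: contrapT => H; case/eqP: w0; apply/rowP => i; rewrite mxE.
    by apply: contrapT => /eqP h; apply: H; exists i.
  exists i => v; rewrite JmxE => /sub_kermxP vk vi.
  have kw : (kermx (Jmx F x) <= w)%MS.
    by rewrite -(geq_leqif (mxrank_leqif_sup wk)) rank_rV w0.
  have /sub_rVP[c vE] := submx_trans vk kw.
  move/eqP: vi; rewrite vE mxE mulf_eq0 (negPf wi) orbF => /eqP ->.
  by rewrite scale0r.
pose H (y : 'rV[K]_m.+1) := ins ord0 (y 0 i) (F y).
have Hd z : rn (z - x) < e -> dif H z /\ forall v, D H z v = ins ord0 (v 0 i) (D F z v).
  move=> zx; have [h1 h2] := dif_proj i z; have [h3 h4] := dif_ins_fun ord0 h1 (Fd z zx).
  by split=> [|v]; [exact: h3|rewrite h4 h2].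
have [|t [G [t0 Gd GP Gx Gsur]]] := local_inverse e0 (fun z zx => (Hd z zx).1).
  move=> v; rewrite (Hd x xx).2 => v0; apply: iP.
    by rewrite -(col'_ins ord0 (v 0 i) (D F x v)) v0; apply/rowP => k; rewrite !mxE.
  by rewrite -(ins_at ord0 (v 0 i) (D F x v)) v0 mxE.
exists (H x), t, G; split=> // y yt; have [h1 h2] := GP y yt; split=> //.
by rewrite -[in RHS]h2 col'_ins.
Qed.

Lemma rn_step n (x a : 'rV[K]_n) (z : K) i (s r : R) : rn (x - a) <= s -> s <= r / 2 ->
  rn z < r / 2 -> rn (x + z *: delta_mx 0 i - a) < r.
Proof.
move=> xs sr zr; rewrite addrAC; have := rnD (x - a) (z *: delta_mx 0 i).
rewrite rnZ; have : rn z * rn (delta_mx 0 i : 'rV[K]_n) <= rn z * 1.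
  rewrite ler_wpM2l ?rn_ge0 //; apply: rn_rV => // j; rewrite mxE.
  by case: (_ && _); rewrite ?rn0 ?rn1.
move=> h1 h2; clear -xs sr zr h1 h2; lra.
Qed.

Lemma fibre_algebra (F : fieldType) (la dh dG dphi dB k : F) : k != 0 -> dB != 0 ->
  dG * dphi = la * dB -> la * dh = dG / dB * k^-1 * dh * (dphi * k).
Proof.
move=> k0 B0 E; rewrite (_ : la = dG * dphi / dB); last by rewrite E mulfK.
by field; rewrite k0.
Qed.

Section Regular.
Variables (m : nat) (phi : 'rV[K]_m.+1 -> 'rV[K]_m.+1) (h k : 'rV[K]_m.+1 -> K).
Variables (x v : 'rV[K]_m.+1) (e : R) (l : 'cV[K]_m.+1) (P : 'M[K]_(m.+1, m)) (Q : 'M[K]_(m, m.+1)).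
Hypotheses (e0 : 0 < e) (phid : dif_on x e phi) (kd : dif_on x e k).
Hypothesis hd : forall y, rn (y - x) < e ->
  exists2 d : R, 0 < d & dif_on (phi y) d h.
Hypothesis k0 : forall y, rn (y - x) < e -> k y != 0.
Hypothesis hE : forall y, rn (y - x) < e -> h (phi y) = \det (Jmx phi y) * k y.
Hypothesis hn0 : forall y (d : R), rn (y - x) < e -> 0 < d ->
  exists2 z, rn (z - y) < d & h (phi z) != 0.
Hypotheses (lvPQ : l *m v + P *m Q = 1%:M) (B0 : \det (col_mx v Q : 'M[K]_(1 + m)) != 0).

Let F y := phi y *m P.

Let Fdif y : rn (y - x) < e -> dif F y /\ forall w, D F y w = D phi y w *m P.
Proof.
move=> yx; have [A A0 AP] := mulmx_bounded P.
have [|h1 h2] := @dif_affine R _ _ (fun u : 'rV[K]_m.+1 => u *m P) (phi y)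
  (fun u : 'rV[K]_m.+1 => u *m P) A _ AP (fun u => mulmxDl _ _ _).
  by move=> c u w; rewrite mulmxDl scalemxAl.
have [h3 h4] := dif_comp (phid yx) h1.
by split=> [|w]; [exact: h3|rewrite h4 h2].
Qed.

Let kernel (p : 'rV[K]_m.+1) : p *m P = 0 -> p = (p *m l) 0 0 *: v.
Proof.
move=> pP; rewrite -{1}[p]mulmx1 -lvPQ mulmxDr !mulmxA pP mul0mx addr0.
by rewrite {1}[p *m l]mx11_scalar mul_scalar_mx.
Qed.

(** A fibre of F is mapped by phi into a line parallel to v. The speed on this
    line is the determinant of the Jacobian matrix of phi, up to nonzero
    factors, hence a multiple of h \o phi. *)
Let fibre_ode (a : 'rV[K]_m.+1) (t : R) (G : 'rV[K]_m.+1 -> 'rV[K]_m.+1) y : dif_on a t G ->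
  (forall z, rn (z - a) < t -> rn (G z - x) < e /\ F (G z) = col' ord0 z) ->
  rn (y - a) < t ->
  dif (fun y => h (phi (G y))) y /\
  D (fun y => h (phi (G y))) y (delta_mx 0 ord0) =
  \det (Jmx G y) / \det (col_mx v Q : 'M[K]_(1 + m)) * (k (G y))^-1 * D h (phi (G y)) v *
    h (phi (G y)).
Proof.
move=> Gd GP yt; have [Gy FG] := GP y yt.
have [h1 h2] := dif_comp (Gd y yt) (phid Gy).
have [d d0 hdy] := hd Gy.
have phiG0 : rn (phi (G y) - phi (G y)) < d by rewrite subrr rn0.
have [h3 h4] := dif_comp h1 (hdy _ phiG0); split; first exact: h3.
have DP w : D (fun z => phi (G z)) y w *m P = col' ord0 w.
  have [h5 h6] := dif_comp (Gd y yt) (Fdif Gy).1.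
  rewrite h2 -(Fdif Gy).2 -h6.
  have [r r0 rP] := ball_sub yt; have [h7 <-] := dif_col' ord0 y.
  have [_ ->] // : dif (fun z => F (G z)) y /\
      forall v, D (fun z => F (G z)) y v = D (col' ord0) y v.
  apply: (eq_dif_near r0 _ h7) => z; rewrite rnB => /rP zt.
  by rewrite (GP z zt).2.
pose p := D (fun z => phi (G z)) y (delta_mx 0 ord0).
have pE : p = (p *m l) 0 0 *: v.
  apply: kernel; rewrite DP; apply/rowP => j; rewrite !mxE.
  by rewrite (_ : lift ord0 j == ord0 = false) ?andbF //.
have JE : Jmx (fun z => phi (G z)) y = Jmx G y *m Jmx phi (G y).
  exact: Jmx_comp h2.
have lam : \det (Jmx G y) * \det (Jmx phi (G y)) = (p *m l) 0 0 * \det (col_mx v Q : 'M[K]_(1 + m)).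
  rewrite -det_mulmx -JE (det_fibre lvPQ); last first.
    apply/row_matrixP => i; rewrite row_mul row_Jmx DP.
    apply/rowP => j; case: (splitP i) => i' ii'.
      rewrite (_ : i = lshift m i'); last exact: val_inj.
      by rewrite rowKu !mxE; case: i' {ii'} => -[].
    rewrite (_ : i = rshift 1 i'); last exact: val_inj.
    have E : (lift ord0 j == rshift 1 i' :> 'I_(1 + m)) = (i' == j).
      by rewrite -!val_eqE /= /bump leq0n eqSS eq_sym.
    by rewrite rowKd !mxE E.
  rewrite (_ : lshift m ord0 = ord0 :> 'I_(1 + m)); last exact: val_inj.
  have -> : p = row ord0 (Jmx (fun z => phi (G z)) y) by rewrite row_Jmx.
  rewrite -row_mul [(row _ _) _ _]mxE.
  by [].
rewrite h4 -/p pE D_scale hE //.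
exact: fibre_algebra (k0 Gy) B0 lam.
Qed.

(** In coordinates in which F is a projection, the zero set of h \o phi is a
    union of fibres by [linear_ode]; its image under F is closed, and has no
    interior because h \o phi vanishes on no open set. *)
Lemma regular_meagre : ~ critical F x -> exists2 d : R, 0 < d &
  meagre (F @` [set y | rn (y - x) < d /\ h (phi y) = 0]).
Proof.
move=> Freg; have Fd y : rn (y - x) < e -> dif F y by move=> /Fdif[].
have [a [t [G [t0 Gd GP Gx Gsur]]]] := straighten_submersion e0 Fd Freg.
have e_gt0 := e0; have C1 := Cq_ge1 R; have C0 := Cq_gt0 R.
have aa : rn (a - a) < t by rewrite subrr rn0.
have ode y := fibre_ode Gd GP (y := y).
pose c y := h (phi (G y)).
pose g y := \det (Jmx G y) / \det (col_mx v Q : 'M[K]_(1 + m)) * (k (G y))^-1 * D h (phi (G y)) v.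
have cd y : rn (y - a) < t -> dif c y by move=> /ode[].
have cE y : rn (y - a) < t -> D c y (delta_mx 0 ord0) = g y * c y by move=> /ode[].
have [r1 r10 [B cB]] := locally_bounded t0 cd.
have xx : rn (G a - x) < e by rewrite Gx subrr rn0.
have gd : dif g a.
  have h1 : dif (fun y => \det (Jmx G y) : K) a.
    by apply: dif_det => i j; exact: dif_Jmx Gd _ aa.
  have [h2 _] := difM h1 (proj1 (dif_cst (\det (col_mx v Q : 'M[K]_(1 + m)))^-1 a)).
  have [h3 _] := dif_comp (Gd a aa) (difV (kd xx) (k0 xx)).
  have [h4 _] := difM h2 h3.
  have [d d0 hda] := hd xx; have [h5 _] := dif_comp (Gd a aa) (phid xx).
  have pp : rn (phi (G a) - phi (G a)) < d by rewrite subrr rn0.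
  have [h6 _] := dif_comp h5 (dif_D v hda pp).
  exact: (proj1 (difM h4 h6)).
have [r2 r20 [M gM]] := dif_bounded gd.
pose r := Num.min t (Num.min r1 r2).
have r0 : 0 < r by rewrite !lt_min t0 r10.
have rt : r <= t by rewrite ge_min lexx.
have rr1 : r <= r1 by rewrite !ge_min lexx orbT.
have rr2 : r <= r2 by rewrite !ge_min lexx !orbT.
(* s is such that a zero in the ball of radius s propagates along its fibre
   over the whole ball *)
have [s s0 s2] : exists2 s : R, 0 < s & 2 * s = r / 2 / (2 * Cq R).
  exists (r / 2 / (2 * Cq R) / 2); first by rewrite !divr_gt0 // mulr_gt0.
  by rewrite mulrC divfK.
have sr : s <= r / 2.
  have : 2 * s * (2 * Cq R) = r / 2 by rewrite s2 divfK // gt_eqF // mulr_gt0.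
  have : s * 1 <= s * Cq R by rewrite ler_pM2l.
  lra.
have st : s < t by lra.
have line y (tau : K) : rn (y - a) <= s -> c y = 0 -> rn tau <= 2 * s ->
    c (y + tau *: delta_mx 0 ord0) = 0.
  move=> ys cy; rewrite s2; have r2' : 0 < r / 2 by rewrite divr_gt0.
  have inb (z : K) : rn z < r / 2 -> rn (y + z *: delta_mx 0 ord0 - a) < r.
    exact: rn_step ys sr.
  have inb' (z : K) : rn z < r / 2 -> rn (y + z *: delta_mx 0 ord0 - a) < t.
    by move=> /inb zr; exact: lt_le_trans zr rt.
  pose u (z : K) := c (y + z *: delta_mx 0 ord0).
  have ud (z : K) : rn z < r / 2 ->
      dif u z /\ D u z (1 : K) = D c (y + z *: delta_mx 0 ord0) (delta_mx 0 ord0).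
    by move=> /inb' zt; exact: dif_line (cd _ zt).
  apply: (@linear_ode u (fun z => g (y + z *: delta_mx 0 ord0)) (r / 2) B M r2').
  - by move=> z; rewrite subr0 => /ud[].
  - by move=> z /inb zr; apply: cB; exact: lt_le_trans zr rr1.
  - by move=> z /inb zr; apply: gM; exact: lt_le_trans zr rr2.
  - by move=> z zr; rewrite (ud z zr).2; apply: cE; exact: inb'.
  - by rewrite /u scale0r addr0.
have Eth : thin ((@col' K 1 m.+1 ord0) @` [set y | rn (y - a) <= s /\ c y = 0]).
  split.
    apply: image_rclosed => [y _|y ys /eqP cy]; first exact: (proj1 (dif_col' ord0 y)).
    have [d d0 dP] := dif_neq0 (cd y (le_lt_trans ys st)) cy.
    by exists d => // w /dP/eqP.
  move=> p eps eps0; apply: contrapT => H.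
  have full w : rn (w - p) < eps -> exists y, [/\ rn (y - a) <= s, c y = 0 & col' ord0 y = w].
    move=> wp; apply: contrapT => H'; apply: H; exists w => // -[y [/= y1 y2] y3].
    by apply: H'; exists y.
  have pp : rn (p - p) < eps by rewrite subrr rn0.
  have [yp [yp1 yp2 yp3]] := full p pp.
  pose q := ins ord0 (a 0 ord0) p.
  have qs : rn (q - a) <= s.
    rewrite -(ins_eta ord0 a) ins_sub subrr; apply: rn_ins; first by rewrite rn0 ltW.
    rewrite -yp3; apply: le_trans yp1; have := rn_col' ord0 (yp - a).
    by rewrite (_ : col' ord0 (yp - a) = col' ord0 yp - col' ord0 a) //; apply/rowP => j; rewrite !mxE.
  have qt := le_lt_trans qs st.
  have m0 : 0 < Num.min eps s by rewrite lt_min eps0.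
  have [d d0 dP] := Gsur q _ qt m0.
  have [z zd /eqP] := hn0 (GP q qt).1 d0; apply.
  have [y yq <-] := dP z zd; move: yq; rewrite lt_min => /andP[y1 y2].
  have yE : col' ord0 (y - q) = col' ord0 y - p.
    by rewrite -[in RHS](col'_ins ord0 (a 0 ord0) p); apply/rowP => j; rewrite !mxE.
  have [w [w1 w2 w3]] := full (col' ord0 y) (le_lt_trans (eq_ind _ (fun u => is_true (rn u <= _)) (rn_col' ord0 (y - q)) _ yE) y1).
  have -> : y = w + (y 0 ord0 - w 0 ord0) *: delta_mx 0 ord0.
    apply: (@insP _ _ ord0); first by rewrite !mxE !eqxx mulr1 addrC subrK.
    by rewrite -w3; apply/rowP => j; rewrite !mxE (_ : lift ord0 j == ord0 = false) // andbF mulr0 addr0.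
  apply: line => //; apply: (@rn_near _ _ _ _ (a 0 ord0)).
    have := rn_coord (y - q) ord0; rewrite !mxE unlift_none => h1.
    exact: le_trans h1 (ltW y2).
  by have := rn_coord (w - a) ord0; rewrite !mxE => h1; exact: le_trans h1 w1.
have [d d0 dP] := Gsur a s aa s0; exists d; first exact: d0.
apply: sub_meagre (meagre_thin Eth) => _ [z [zx hz] <-].
have [|y ys yz] := dP z; first by rewrite Gx.
exists y; first by split; [exact: ltW|rewrite /c yz].
by rewrite -yz (GP y _).2 //; exact: lt_trans ys st.
Qed.

End Regular.

(** The critical points of the projection of phi along v are covered by Sard's
    theorem, and the other ones by [regular_meagre]. *)
Lemma degenerate_meagre m (phi : 'rV[K]_m.+1 -> 'rV[K]_m.+1) (h k : 'rV[K]_m.+1 -> K)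
    (x v : 'rV[K]_m.+1) (e : R) (l : 'cV[K]_m.+1) (P : 'M[K]_(m.+1, m)) (Q : 'M[K]_(m, m.+1)) :
  0 < e -> dif_on x e phi -> dif_on x e k ->
  (forall y, rn (y - x) < e -> exists2 d : R, 0 < d & dif_on (phi y) d h) ->
  (forall y, rn (y - x) < e -> k y != 0) ->
  (forall y, rn (y - x) < e -> h (phi y) = \det (Jmx phi y) * k y) ->
  (forall y (d : R), rn (y - x) < e -> 0 < d -> exists2 z, rn (z - y) < d & h (phi z) != 0) ->
  l *m v + P *m Q = 1%:M -> \det (col_mx v Q : 'M[K]_(1 + m)) != 0 ->
  meagre ((fun y => phi y *m P) @` [set y | rn (y - x) < e /\ h (phi y) = 0]).
Proof.
move=> e0 phid kd hd k0 hE hn0 lvPQ B0; pose F y := phi y *m P.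
have Fd : dif_on x e F.
  move=> y yx; have [A A0 AP] := mulmx_bounded P.
  have [|h1 _] := @dif_affine R _ _ (fun u : 'rV[K]_m.+1 => u *m P) (phi y)
    (fun u : 'rV[K]_m.+1 => u *m P) A _ AP (fun u => mulmxDl _ _ _).
    by move=> c u w; rewrite mulmxDl scalemxAl.
  exact: (proj1 (dif_comp (phid y yx) h1)).
apply: (@meagreU _ _ (F @` [set y | rn (y - x) < e /\ critical F y])
  (F @` [set y | [/\ rn (y - x) < e, h (phi y) = 0 & ~ critical F y]])).
- apply: sard => y [yx cy]; split=> //; have [d d0 dP] := ball_sub yx.
  by exists d => // z /dP/Fd.
- apply: meagre_local_rV => y [yx hy ncy]; have [d d0 dP] := ball_sub yx.
  have [r r0 rm] : exists2 r : R, 0 < r &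
      meagre (F @` [set z | rn (z - y) < r /\ h (phi z) = 0]).
    apply: (@regular_meagre m phi h k y v d l P Q d0 _ _ _ _ _ _ lvPQ B0 ncy).
    + by move=> z /dP/phid.
    + by move=> z /dP/kd.
    + by move=> z /dP/hd.
    + by move=> z /dP/k0.
    + by move=> z /dP/hE.
    + by move=> z r /dP; exact: hn0.
  exists r => //; apply: sub_meagre rm => _ [z [[_ hz _] zy] <-].
  by exists z.
- move=> _ [y [yx hy] <-]; have [c|c] := pselect (critical F y).
    by left; exists y.
  by right; exists y.
Qed.

End Degenerate.

(** * Persistence of zeros *)

Section Hurwitz.
Variable R : realType.
Notation K := (C R).

Lemma small_multiple (mu : R) : 0 < mu ->
  exists2 eta : R, 0 < eta & eta <= mu / 2 /\ eta * (128 * (2 / mu)) <= 1 / 2.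
Proof.
move=> mu0; exists (mu / 512); first lra.
split; first lra.
rewrite le_eqVlt; apply/orP; left; apply/eqP; field; exact: lt0r_neq0.
Qed.

(** If a line parallel to v close to y contained no zero, the maximum
    principle for the inverse of h on it would bound h from below at its
    centre y + w, where h is small. *)
Lemma hurwitz n (h : 'rV[K]_n -> K) y v (e : R) : 0 < e -> dif_on y e h -> h y = 0 ->
  (forall d : R, 0 < d -> exists2 t : K, rn t < d & h (y + t *: v) != 0) ->
  exists2 d : R, 0 < d & forall w, rn w < d ->
    exists t : K, rn (y + w + t *: v - y) < e /\ h (y + w + t *: v) = 0.
Proof.
move=> e0 hd hy hn.
have [r0' r0'0 [M hM0]] := locally_bounded e0 hd.
pose r0 : R := Num.min e r0'; have r00 : 0 < r0 by rewrite lt_min e0.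
have r0e : r0 <= e by rewrite ge_min lexx.
have hM z : rn (z - y) < r0 -> rn (h z) <= M by rewrite lt_min => /andP[_ /hM0].
have hd0 : dif_on y r0 h by move=> z zr; apply: hd; exact: lt_le_trans zr r0e.
have M0 : 0 <= M by apply: le_trans (hM y _); [exact: rn_ge0|rewrite subrr rn0].
have [A A0 vA] : exists2 A : R, 0 < A & rn v <= A.
  by exists (rn v + 1); [have := rn_ge0 v; lra|lra].
have [r1 r10 r1A] : exists2 r1 : R, 0 < r1 & r1 * A = r0 / 2.
  by exists (r0 / 2 / A); [rewrite !divr_gt0|rewrite divfK // gt_eqF].
have tv (t : K) (r : R) : rn t <= r -> rn (t *: v) <= r * A.
  by move=> tr; rewrite rnZ; apply: ler_pM; rewrite ?rn_ge0.
have inb (t : K) : rn t <= r1 -> rn (t *: v) <= r0 / 2 by move=> /tv; rewrite r1A.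
have cd : dif_on 0 r1 (fun t : K => h (y + t *: v)).
  move=> t; rewrite subr0 => /ltW/inb tr; apply: (proj1 (dif_line _)).
  by apply: hd0; rewrite (addrC y) addrK; lra.
have cM (t : K) : rn (t - 0) < r1 -> rn (h (y + t *: v)) <= M.
  rewrite subr0 => /ltW/inb tr; apply: hM; rewrite (addrC y) addrK; lra.
have [[k [u [ud u0 uE]]]|H] := dif_order r10 cd cM; last first.
  have C1 := Cq_gt0 R; have s0 : 0 < r1 / (2 * Cq R) by rewrite divr_gt0 // mulr_gt0.
  have [t ts /eqP] := hn _ s0; case; apply: H; rewrite subr0; exact: ltW.
have z0 : rn (0 - 0 : K) < r1 by rewrite subrr rn0.
have p0 : 0 < rn (u 0) / 2 by rewrite divr_gt0 // rn_gt0.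
have [r2 r20 uP] := dif_continuous (ud 0 z0) p0.
pose rho : R := Num.min r1 r2 / 2.
have m0 : 0 < Num.min r1 r2 by rewrite lt_min r10.
have rho0 : 0 < rho by rewrite divr_gt0.
have rho2 : 2 * rho = Num.min r1 r2 by rewrite /rho mulrC divfK.
have rhor1 : 2 * rho <= r1 by rewrite rho2 ge_min lexx.
have rhor2 : 2 * rho <= r2 by rewrite rho2 ge_min lexx orbT.
(* a lower bound for h on the annulus rho / 4 <= |t| <= rho of the line
   through y *)
pose mu : R := (rho / 4) ^+ k * (rn (u 0) / 2).
have mu0 : 0 < mu by rewrite mulr_gt0 // exprn_gt0 // divr_gt0.
have lower (t : K) : rho / 4 <= rn t <= rho -> mu <= rn (h (y + t *: v)).
  move=> /andP[t1 t2]; rewrite uE subr0 rnM rnX; apply: ler_pM.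
  - by rewrite exprn_ge0 // divr_ge0 // ltW.
  - exact: ltW.
  - by rewrite lerXn2r // ?nnegrE ?rn_ge0 // divr_ge0 // ltW.
  - have := uP t; rewrite sub0r rnN => /(_ _)/wrap[|h1]; first by clear -t2 rho0 rhor2; lra.
    by have h2 := rn_subl (u 0) (u t); clear -h1 h2; lra.
have C1 := Cq_gt0 R.
have r02 : 0 < r0 / 2 by rewrite divr_gt0.
pose L : R := Cq R / (r0 / 2) * M + 1.
have L0 : 0 < L by rewrite ltr_wpDl // mulr_ge0 // divr_ge0 // ltW.
have lip z w : rn (z - y) <= r0 / 2 -> rn w < r0 / 2 -> rn (h (z + w) - h z) <= L * rn w.
  move=> zy wr; have sub q : rn (q - z) < r0 / 2 -> rn (q - y) < r0.
    by move=> /rn_ball/(_ zy); apply; rewrite -splitr.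
  apply: le_trans (_ : Cq R / (r0 / 2) * M * rn w <= _).
    by apply: (@dif_lipschitz _ _ h z (r0 / 2) M) => // q /sub; [exact: hd0|exact: hM].
  by rewrite ler_wpM2r ?rn_ge0 // /L lerDl.
have [eta eta0 [eta2 etaE]] := small_multiple mu0.
pose d : R := Num.min (r0 / 2) (eta / L).
have d0 : 0 < d by rewrite lt_min r02 !divr_gt0.
have dr : d <= r0 / 2 by rewrite ge_min lexx.
have dL : L * d <= eta by rewrite mulrC -ler_pdivlMr // ge_min lexx orbT.
exists d => // w wd; apply: contrapT => nz.
have wr : rn w < r0 / 2 := lt_le_trans wd dr.
have hw z : rn (z - y) <= r0 / 2 -> rn (h (z + w) - h z) <= eta.
  move=> zy; apply: le_trans (lip z w zy wr) _; apply: le_trans dL.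
  by rewrite ler_wpM2l ?ltW.
have tin (t : K) : rn t <= rho -> rn (y + t *: v - y) <= r0 / 2.
  by move=> tr; rewrite (addrC y) addrK; apply: inb; clear -tr rho0 rhor1; lra.
have tin2 (t : K) : rn t <= rho -> rn (y + w + t *: v - y) < r0.
  move=> /tin h1; apply: (@rn_ball _ _ _ (y + t *: v) _ (r0 / 2) (r0 / 2)) => //.
    by rewrite (addrAC y w) (addrC (y + t *: v)) addrK.
  by rewrite -splitr.
have nz0 (t : K) : rn t <= rho -> h (y + w + t *: v) != 0.
  move=> tr; apply/eqP => E; apply: nz; exists t; split=> //.
  exact: lt_le_trans (tin2 t tr) r0e.
have hwt (t : K) : rn t <= rho -> rn (h (y + w + t *: v) - h (y + t *: v)) <= eta.
  by move=> /tin/hw; rewrite addrAC.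
have nzd (t : K) : rn t <= rho -> dif (fun t : K => (h (y + w + t *: v))^-1) t.
  move=> tr; apply: difV (nz0 t tr).
  by apply: (proj1 (dif_line _)); apply: hd0; exact: tin2.
have nzM (t : K) : rho / 4 <= rn t <= rho -> rn ((h (y + w + t *: v))^-1 : K) <= 2 / mu.
  move=> t12; have [_ tr] := andP t12; have h2 := lower t t12; have h1 := hwt t tr.
  have h3 : mu / 2 <= rn (h (y + w + t *: v)).
    have h3 := rn_subl (h (y + t *: v)) (h (y + w + t *: v)); rewrite rnB in h3.
    by clear -h1 h2 h3 eta2; lra.
  rewrite rnV -[2 / mu]invf_div lef_pV2 // posrE ?divr_gt0 //.
  by apply: lt_le_trans h3; exact: divr_gt0.
have h4 : (rn (h (y + w)))^-1 <= 128 * (2 / mu).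
  rewrite -rnV -[y + w]addr0 -(scale0r v).
  by apply: (@dif_weak_maximum R (fun t : K => (h (y + w + t *: v))^-1) 0 rho (2 / mu) rho0)
    => t; rewrite subr0; [exact: nzd|exact: nzM].
have := hw y; rewrite subrr rn0 hy subr0 => /(_ (ltW r02)) h1.
have := nz0 0; rewrite rn0 scale0r addr0 => /(_ (ltW rho0)) h2.
have h3 : 0 < rn (h (y + w)) by rewrite rn_gt0.
have : rn (h (y + w)) * (rn (h (y + w)))^-1 <= eta * (128 * (2 / mu)).
  by apply: ler_pM; rewrite ?invr_ge0 // ltW.
rewrite divff; last by rewrite gt_eqF.
by move=> h5; have h6 := le_trans h5 etaE; clear -h6; lra.
Qed.

End Hurwitz.

(** * The exterior algebra *)

Section Exterior.
Import mathcomp.boot.finset.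
Variable F : numFieldType.
Notation ext d := (extalg F d).

Section Fixed.
Variable d : nat.
Implicit Types (a b x : ext d) (v w : 'rV[F]_d) (S T A B : {set 'I_d}) (i j : 'I_d).

Definition below i S : nat := #|[set j in S | (j < i)%N]%SET|.

Definition sc (c : F) a : ext d := [ffun S => c * a S].

Lemma below0 i : below i set0 = 0%N.
Proof. by apply/eqP; rewrite cards_eq0; apply/eqP/setP => j; rewrite !inE. Qed.

Lemma belowU i A B : [disjoint A & B]%B -> below i (A :|: B) = (below i A + below i B)%N.
Proof.
move=> AB; rewrite /below -cardsUI.
have -> : ([set j in A | (j < i)%N] :&: [set j in B | (j < i)%N] = set0)%SET.
  apply/setP => j; rewrite !inE; apply/negP => /andP[/andP[jA _] /andP[jB _]].
  by move/pred0P/(_ j): AB; rewrite /= jA jB.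
rewrite cards0 addn0.
by congr #|pred_of_set _|; apply/setP => j; rewrite !inE andb_orl.
Qed.

Lemma below1 i j : below i [set j]%SET = (j < i)%N.
Proof.
rewrite /below; case: (ltnP j i) => ji /=.
  by rewrite (_ : [set _ in _ | _]%SET = [set j]%SET) ?cards1 //; apply/setP => k; rewrite !inE; case: eqP => // ->.
by apply/eqP; rewrite cards_eq0; apply/eqP/setP => k; rewrite !inE; case: eqP => // ->; rewrite ltnNge ji.
Qed.

Lemma belowU1 i j A : j \notin A -> below i (j |: A) = ((j < i) + below i A)%N.
Proof. by move=> jA; rewrite belowU ?below1 // disjoints1. Qed.

Lemma inversionsE A B : inversions A B =
  #|[set p : 'I_d * 'I_d | [&& p.1 \in A, p.2 \in B & (p.2 < p.1)%N]]%SET|.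
Proof. by apply: eq_card => p; rewrite [RHS]inE; exact: asboolb. Qed.

Lemma inversions0 A : inversions set0 A = 0%N.
Proof. by apply/eqP; rewrite inversionsE cards_eq0; apply/eqP/setP => p; rewrite !inE. Qed.

Lemma inversionsU1 i A B : i \notin A ->
  inversions (i |: A) B = (below i B + inversions A B)%N.
Proof.
move=> iA; rewrite !inversionsE -(cardsID [set p : 'I_d * 'I_d | p.1 == i]%SET); congr (_ + _)%N.
  rewrite /below -(card_imset _ (fun j k (e : (i, j) = (i, k)) => congr1 snd e)).
  congr #|pred_of_set _|; apply/setP => -[k j]; rewrite !inE /=.
  apply/idP/imsetP => [/andP[/and3P[_ jB ji] /eqP ki]|[j' + [-> ->]]].
    by exists j; rewrite ?ki // inE jB -ki.
  by rewrite inE => /andP[-> ->]; rewrite !eqxx.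
congr #|pred_of_set _|; apply/setP => -[k j]; rewrite !inE /=.
by case: (eqVneq k i) => [->|] //=; rewrite (negPf iA).
Qed.

(** The basis vector of index i has to pass the elements of S below i. *)
Lemma wedge_vec v b S :
  wedge (ext_vec v) b S = \sum_(i in S) (-1) ^+ below i (S :\ i) * v 0 i * b (S :\ i).
Proof.
rewrite ffunE; transitivity (\sum_(A : {set 'I_d} | A \subset S)
    \sum_(i < d | A == [set i]%SET) (-1) ^+ below i (S :\ i) * v 0 i * b (S :\ i)).
  apply: eq_bigr => A _; rewrite ffunE mulr_sumr mulr_suml; apply: eq_bigr => i /eqP ->.
  congr (_ ^+ _ * _ * _); rewrite -(setU0 [set i]%SET).
  by rewrite inversionsU1 ?inE // inversions0 addn0.
rewrite (exchange_big_dep predT) //= [RHS]big_mkcond /=; apply: eq_bigr => i _.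
case: ifP => iS; last by rewrite big1 // => A /andP[AS /eqP E]; rewrite E sub1set iS in AS.
rewrite (big_pred1 [set i]%SET) // => A /=; case: (eqVneq A [set i]%SET) => [->|]; last by rewrite andbF.
by rewrite sub1set iS.
Qed.

Lemma wedge_suml (I : finType) (P : pred I) (X : I -> ext d) b :
  wedge (\sum_(k | P k) X k) b = \sum_(k | P k) wedge (X k) b.
Proof.
apply/ffunP => S; rewrite sum_ffunE ffunE.
under eq_bigr do rewrite sum_ffunE mulr_sumr mulr_suml.
by rewrite exchange_big; apply: eq_bigr => k _; rewrite ffunE.
Qed.

Lemma wedge_sumr (I : finType) (P : pred I) (X : I -> ext d) a :
  wedge a (\sum_(k | P k) X k) = \sum_(k | P k) wedge a (X k).
Proof.
apply/ffunP => S; rewrite sum_ffunE ffunE.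
under eq_bigr do rewrite sum_ffunE mulr_sumr.
by rewrite exchange_big; apply: eq_bigr => k _; rewrite ffunE.
Qed.

Lemma wedge_scl c a b : wedge (sc c a) b = sc c (wedge a b).
Proof.
apply/ffunP => S; rewrite !ffunE mulr_sumr; apply: eq_bigr => A _.
by rewrite ffunE; ring.
Qed.

Lemma wedge_scr c a b : wedge a (sc c b) = sc c (wedge a b).
Proof.
apply/ffunP => S; rewrite !ffunE mulr_sumr; apply: eq_bigr => A _.
by rewrite ffunE; ring.
Qed.

Lemma wedge0r a : wedge a 0 = 0.
Proof.
apply/ffunP => S; rewrite !ffunE big1 // => A _.
by rewrite [X in _ * X]ffunE mulr0.
Qed.

Lemma scsc c e a : sc c (sc e a) = sc (c * e) a.
Proof. by apply/ffunP => S; rewrite !ffunE mulrA. Qed.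

Lemma sc1 a : sc 1 a = a.
Proof. by apply/ffunP => S; rewrite !ffunE mul1r. Qed.

Lemma sc0 c : sc c 0 = 0.
Proof. by apply/ffunP => S; rewrite !ffunE mulr0. Qed.

Lemma wedge1l a : wedge (ext1 F d) a = a.
Proof.
apply/ffunP => S; rewrite ffunE (bigD1 set0) ?sub0set //= big1 => [|A /andP[_ A0]].
  by rewrite addr0 ffunE eqxx inversions0 setD0 expr0 !mul1r.
by rewrite ffunE (negPf A0) mulr0 mul0r.
Qed.

(** In both expressions an index i of S is contributed by v, and the other
    elements of S are distributed between a and b. *)
Lemma wedge_vecA v a b : wedge (wedge (ext_vec v) a) b = wedge (ext_vec v) (wedge a b).
Proof.
apply/ffunP => S; rewrite wedge_vec ffunE.
transitivity (\sum_(A : {set 'I_d} | A \subset S) \sum_(i in A) (-1) ^+ inversions A (S :\: A) *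
    ((-1) ^+ below i (A :\ i) * v 0 i * a (A :\ i)) * b (S :\: A)).
  by apply: eq_bigr => A _; rewrite wedge_vec mulr_sumr mulr_suml.
rewrite (exchange_big_dep (mem S)) /=; last by move=> A i /fintype.subsetP AS /AS.
apply: eq_bigr => i iS; rewrite ffunE mulr_sumr.
rewrite (reindex_onto (fun A => i |: A) (fun A => A :\ i)) /=; last first.
  by move=> A /andP[_ iA]; exact: setD1K.
apply: eq_big => [A|A /andP[/andP[iAS _] /eqP E]].
  rewrite subUset sub1set iS /= setU11 andbT subsetD1; congr (_ && _).
  by apply/eqP/idP => [<-|/setU1K//]; rewrite !inE eqxx.
have iA : i \notin A by rewrite -E !inE eqxx.
have SA : S :\: (i |: A) = S :\ i :\: A by apply/setP => j; rewrite !inE negb_or andbCA andbA.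
rewrite SA setU1K // inversionsU1 //.
have -> : below i (S :\ i) = (below i A + below i (S :\ i :\: A))%N.
  rewrite -belowU; last by rewrite -setI_eq0; apply/eqP/setP => j; rewrite !inE; case: (j \in A).
  congr below; apply/setP => j; rewrite !inE; case: (boolP (j \in A)) => jA //=.
  have jS : j \in S by apply: (fintype.subsetP iAS); rewrite !inE jA orbT.
  by rewrite jS andbT; apply: contraNneq iA => <-.
rewrite !exprD.
have /eqP s1 : (-1) ^+ below i A * (-1) ^+ below i A == 1 :> F by rewrite -expr2 sqrr_sign.
by ring.
Qed.

(** Exactly one of i and j is below the other. *)
Lemma below_swap i j S : i \in S -> j \in S -> i != j ->
  (-1) ^+ below i (S :\ i) * (-1) ^+ below j (S :\ i :\ j) =
  - ((-1) ^+ below j (S :\ j) * (-1) ^+ below i (S :\ j :\ i)) :> F.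
Proof.
move=> iS jS ij; pose T := S :\ i :\ j.
have Ti : S :\ i = j |: T by rewrite setD1K // !inE eq_sym ij.
have TE : S :\ j :\ i = T by apply/setP => k; rewrite !inE andbCA.
have Tj : S :\ j = i |: T by rewrite -TE setD1K // !inE ij.
have iT : i \notin T by rewrite !inE eqxx andbF.
have jT : j \notin T by rewrite !inE eqxx.
rewrite TE -/T Ti Tj !belowU1 // !exprD.
have : (-1) ^+ (j < i)%N = - (-1) ^+ (i < j)%N :> F.
  have : i != j :> nat by [].
  by case: ltngtP => //= _ _; rewrite ?expr0 ?expr1 ?opprK.
by move=> ->; ring.
Qed.

Lemma wedge_vecC v w x :
  wedge (ext_vec v) (wedge (ext_vec w) x) = sc (-1) (wedge (ext_vec w) (wedge (ext_vec v) x)).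
Proof.
apply/ffunP => S; rewrite [RHS]ffunE !wedge_vec mulr_sumr.
transitivity (\sum_(i in S) \sum_(j in S | i != j) (-1) ^+ below i (S :\ i) * v 0 i *
    ((-1) ^+ below j (S :\ i :\ j) * w 0 j * x (S :\ i :\ j))).
  apply: eq_bigr => i iS; rewrite wedge_vec mulr_sumr; apply: eq_bigl => j.
  by rewrite !inE andbC eq_sym.
rewrite (exchange_big_dep (mem S)) /=; last by move=> i j _ /andP[].
apply: eq_bigr => j jS; rewrite wedge_vec !mulr_sumr; apply: eq_big => [i|i /andP[iS]].
  by rewrite !inE jS /= andbC.
move=> /andP[_ ij]; have := below_swap iS jS ij.
have -> : S :\ j :\ i = S :\ i :\ j by apply/setP => k; rewrite !inE andbCA.
move: (_ ^+ below i _) (_ ^+ below j _) (_ ^+ below j _) (_ ^+ below i _) => s1 s2 s3 s4 E.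
transitivity (s4 * s3 * (v 0 i * w 0 j * x (S :\ i :\ j))); first by ring.
by rewrite E; ring.
Qed.

(** By [wedge_vecC] this is its own opposite. *)
Lemma wedge_vecvv v x : wedge (ext_vec v) (wedge (ext_vec v) x) = 0.
Proof.
have := wedge_vecC v v x; set y := wedge _ _ => E; apply/ffunP => S.
move/ffunP/(_ S): E; rewrite !ffunE mulN1r => /eqP; rewrite -addr_eq0 -mulr2n mulrn_eq0 /=.
by move=> /eqP.
Qed.

End Fixed.

Lemma enum_min e (S : {set 'I_e}) m : m \in S -> (forall i, i \in S -> (m <= i)%N) ->
  enum S = m :: enum (S :\ m).
Proof.
move=> mS mP; pose r (i j : 'I_e) := (i < j)%N.
have rtr : transitive r by move=> i j k; exact: ltn_trans.
have srt (T : {set 'I_e}) : sorted r (enum T).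
  apply: sorted_filter => //; have := iota_ltn_sorted 0 e.
  by rewrite -val_enum_ord sorted_map enumT.
apply: (irr_sorted_eq rtr) => [i|//||i]; first exact: ltnn.
  rewrite /= path_sortedE // srt andbT; apply/allP => i.
  rewrite mem_enum !inE => /andP[im iS]; rewrite /r ltn_neqAle mP // andbT.
  by rewrite eq_sym.
by rewrite inE !mem_enum !inE; case: (eqVneq i m) => [->|].
Qed.

Lemma set_min e (S : {set 'I_e}) : S != set0 ->
  exists2 m, m \in S & forall i, i \in S -> (m <= i)%N.
Proof.
move=> /set0Pn[i0 iS].
by case: (@arg_minnP _ i0 (mem S) (fun i => i : nat) iS) => m mS mP; exists m.
Qed.

Section Basis.
Variables (e d : nat) (v : 'I_e -> 'rV[F]_d).
Implicit Types (S A B : {set 'I_e}) (i m : 'I_e).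

Definition wedges (s : seq 'I_e) : ext d := \big[@wedge F d/ext1 F d]_(i <- s) ext_vec (v i).

Lemma wedges_cons i s : wedges (i :: s) = wedge (ext_vec (v i)) (wedges s).
Proof. exact: big_cons. Qed.

Lemma wedges0 : wedges (enum (set0 : {set 'I_e})) = ext1 F d.
Proof. by rewrite enum_set0 /wedges big_nil. Qed.

Lemma wedges_min S m : m \in S -> (forall i, i \in S -> (m <= i)%N) ->
  wedges (enum S) = wedge (ext_vec (v m)) (wedges (enum (S :\ m))).
Proof. by move=> mS mP; rewrite (enum_min mS mP) wedges_cons. Qed.

Lemma below_min m S : (forall i, i \in S -> (m <= i)%N) -> below m S = 0%N.
Proof.
move=> mP; apply/eqP; rewrite cards_eq0; apply/eqP/setP => i; rewrite !inE.
by apply/negP => /andP[/mP]; rewrite leqNgt => /negP.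
Qed.

(** The vector v m is moved to its place in the increasing sequence B; every
    transposition changes the sign. *)
Lemma wedge_vec_basis m B : wedge (ext_vec (v m)) (wedges (enum B)) =
  if m \in B then 0 else sc ((-1) ^+ below m B) (wedges (enum (m |: B))).
Proof.
elim: {B}#|B| {-2}B (leqnn #|B|) => [|k IH] B.
  rewrite leqn0 cards_eq0 => /eqP ->; rewrite inE below0 expr0 sc1 setU0.
  rewrite (@wedges_min [set m] m) ?inE // => [|i]; last by rewrite inE => /eqP ->.
  by rewrite setDv.
have [->|/set_min[b bB bP] Bk] := eqVneq B set0.
  by rewrite cards0 => _; apply: IH; rewrite cards0.
have Bb : (#|B :\ b| <= k)%N by move: Bk; rewrite (cardsD1 b) bB.
have [mB|mB] := boolP (m \in B).
  rewrite (wedges_min bB bP); have [<-|mb] := eqVneq m b; first exact: wedge_vecvv.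
  by rewrite wedge_vecC IH // !inE mb mB wedge0r sc0.
have mb : m != b by apply: contraNneq mB => ->.
case: (ltngtP m b) mb => [mb|bm|/val_inj ->] //=; rewrite ?eqxx // => _.
  rewrite below_min ?expr0 ?sc1 => [|i /bP]; last exact: leq_trans (ltnW mb).
  rewrite (@wedges_min (m |: B) m) ?setU11 // ?setU1K // => i.
  by rewrite !inE => /predU1P[->//|/bP]; exact: leq_trans (ltnW mb).
rewrite (wedges_min bB bP) wedge_vecC IH // !inE (negPf mB) andbF wedge_scr scsc.
have bmB : b \notin m |: (B :\ b) by rewrite !inE eqxx orbF neq_ltn bm.
have E : b |: (m |: B :\ b) = m |: B.
  by apply/setP => i; rewrite !inE; case: (eqVneq i b) => [->|_] //=; rewrite bB orbT.
rewrite (@wedges_min (m |: B) b); last first.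
- by move=> i; rewrite !inE => /predU1P[->|/bP//]; exact: ltnW.
- by rewrite !inE bB orbT.
rewrite -E setU1K //; congr sc.
by rewrite -{2}(setD1K bB) belowU1 ?bm ?exprS ?mulN1r // !inE eqxx.
Qed.

(** By induction on A, from the multiplication by the vector of smallest index
    in A. *)
Lemma wedge_basis A B : wedge (wedges (enum A)) (wedges (enum B)) =
  if [disjoint A & B]%B then sc ((-1) ^+ inversions A B) (wedges (enum (A :|: B))) else 0.
Proof.
elim: {A}#|A| {-2}A (leqnn #|A|) => [|k IH] A.
  rewrite leqn0 cards_eq0 => /eqP ->; rewrite inversions0 expr0 sc1 set0U wedges0.
  by rewrite wedge1l -setI_eq0 set0I eqxx.
have [->|/set_min[m mA mP] Ak] := eqVneq A set0.
  by rewrite cards0 => _; apply: IH; rewrite cards0.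
have Am : (#|A :\ m| <= k)%N by move: Ak; rewrite (cardsD1 m) mA.
rewrite (wedges_min mA mP) wedge_vecA IH //.
have mAm : m \notin A :\ m by rewrite !inE eqxx.
have dE : [disjoint A & B]%B = (m \notin B) && [disjoint A :\ m & B]%B.
  by rewrite -{1}(setD1K mA) -setI_eq0 setIUl setU_eq0 !setI_eq0 disjoints1.
have [dAB|/negPf dAB] := boolP [disjoint A :\ m & B]%B; last by rewrite dE dAB andbF wedge0r.
rewrite wedge_scr wedge_vec_basis !inE eqxx /= dE dAB andbT.
case: (boolP (m \in B)) => mB /=; first by rewrite sc0.
rewrite scsc setUA setD1K //; congr sc.
rewrite -[in RHS](setD1K mA) inversionsU1 // exprD mulrC belowU // below_min ?add0n // => i.
by rewrite !inE => /andP[_ /mP].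
Qed.

End Basis.

Section Morphism.
Variables (e d : nat) (L : 'M[F]_(e, d)).
Implicit Types (a b : ext e).

Lemma ext_mapE a :
  ext_map L a = \sum_(S : {set 'I_e}) sc (a S) (wedges (fun i => row i L) (enum S)).
Proof.
apply/ffunP => T; rewrite sum_ffunE ffunE; apply: eq_bigr => S _.
by rewrite ffunE.
Qed.

Lemma ext_map1 : ext_map L (ext1 F e) = ext1 F d.
Proof.
rewrite ext_mapE (bigD1 set0) //= big1 => [|S S0].
  by rewrite addr0 ffunE eqxx sc1 wedges0.
by apply/ffunP => T; rewrite !ffunE (negPf S0) mul0r.
Qed.

(** Both sides are sums over pairs of disjoint sets of wedges of rows of L. *)
Lemma ext_mapM a b : ext_map L (wedge a b) = wedge (ext_map L a) (ext_map L b).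
Proof.
rewrite !ext_mapE wedge_suml.
pose W S := wedges (fun i => row i L) (enum (S : {set 'I_e})).
transitivity (\sum_(A : {set 'I_e}) \sum_(S : {set 'I_e} | A \subset S)
    sc ((-1) ^+ inversions A (S :\: A) * a A * b (S :\: A)) (W S)).
  rewrite (exchange_big_dep predT) //=; apply: eq_bigr => S _.
  by apply/ffunP => T; rewrite sum_ffunE !ffunE mulr_suml; apply: eq_bigr => A _; rewrite ffunE.
apply: eq_bigr => A _; rewrite wedge_sumr.
rewrite (reindex_onto (fun B => A :|: B) (fun S => S :\: A)) /=; last first.
  move=> S AS; apply/setP => i; rewrite !inE.
  by case: (boolP (i \in A)) => // /(fintype.subsetP AS) ->.
have E (B : {set 'I_e}) :
    ((A \subset A :|: B) && ((A :|: B) :\: A == B)) = [disjoint A & B]%B.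
  rewrite subsetUl /= -setI_eq0 setDUl setDv set0U.
  apply/eqP/eqP => [<-|AB]; first by apply/setP => i; rewrite !inE; case: (i \in A).
  by apply/setP => i; rewrite !inE; have /setP/(_ i) := AB; rewrite !inE; case: (i \in A).
rewrite (eq_bigl _ _ E) big_mkcond /=; apply: eq_bigr => B _.
rewrite wedge_scl wedge_scr wedge_basis; case: ifP => AB; last by rewrite !sc0.
have -> : (A :|: B) :\: A = B.
  rewrite setDUl setDv set0U; apply/setP => i; rewrite !inE.
  by move/pred0P/(_ i): AB => /=; case: (i \in A).
by rewrite !scsc; congr sc; ring.
Qed.

Lemma ext_map_pow a n : ext_map L (ext_pow a n) = ext_pow (ext_map L a) n.
Proof. by elim: n => [|n IH]; [exact: ext_map1|rewrite /= ext_mapM IH]. Qed.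

End Morphism.

Lemma ext_homogeneousM d k l (a b : ext d) : ext_homogeneous k a -> ext_homogeneous l b ->
  ext_homogeneous (k + l) (wedge a b).
Proof.
move=> ak bl S Skl; rewrite ffunE big1 // => A AS.
have [Ak|/ak ->] := eqVneq #|A| k; last by rewrite mulr0 mul0r.
rewrite [b _]bl ?mulr0 //; apply: contraNneq Skl => <-.
by rewrite cardsDS // Ak subnKC // -Ak subset_leq_card.
Qed.

Lemma ext_homogeneousX d k (a : ext d) n : ext_homogeneous k a ->
  ext_homogeneous (n * k) (ext_pow a n).
Proof.
move=> ak; elim: n => [|n IH]; last by rewrite mulSn; exact: ext_homogeneousM.
by move=> S S0; rewrite ffunE -cards_eq0 (negPf S0).
Qed.

Lemma top_eq0 d (a : ext d) : ext_homogeneous d a -> a setT = 0 -> a = 0.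
Proof.
move=> ad aT; apply/ffunP => S; rewrite [RHS]ffunE.
have [->|ST] := eqVneq S setT; first exact: aT.
apply: ad; apply: contraNneq ST => Sd.
by apply/eqP/setP/subset_cardP; rewrite ?cardsT ?card_ord // subsetT.
Qed.

(** The j-th coordinate does not contribute to a coefficient on a set that
    does not contain j. *)
Lemma wedges_col' d r (j : 'I_d.+1) (L : 'M[F]_(r, d.+1)) (s : seq 'I_r) (T : {set 'I_d}) :
  wedges (fun i => row i L) s (lift j @: T) = wedges (fun i => row i (col' j L)) s T.
Proof.
have linj : injective (lift j) by exact: lift_inj.
elim: s T => [|i s IH] T; first by rewrite /wedges !big_nil !ffunE imset_eq0.
rewrite !wedges_cons !wedge_vec big_imset /=; last by move=> x y _ _ /linj.
apply: eq_bigr => k kT; have TE : lift j @: T :\ lift j k = lift j @: (T :\ k).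
  apply/setP => x; rewrite !inE; apply/andP/imsetP => [[xk /imsetP[y yT E]]|[y]].
    by exists y => //; rewrite !inE yT andbT; apply: contraNneq xk => <-; rewrite E.
  by rewrite !inE => /andP[yk yT] ->; rewrite (inj_eq linj) yk imset_f.
rewrite TE IH !mxE; congr (_ ^+ _ * _ * _).
rewrite /below -(card_imset _ linj); congr #|pred_of_set _|; apply/setP => x; rewrite inE.
apply/andP/imsetP => [[/imsetP[y yT ->] yk]|[y + ->]].
  by exists y => //; rewrite inE yT /=; move: yk; rewrite /= !ltnNge leq_bump2.
rewrite inE => /andP[yT yk]; split; first exact: imset_f.
by move: yk; rewrite /= !ltnNge leq_bump2.
Qed.

(** Multiplication by the first row is the Laplace expansion of the
    determinant along it. *)
Lemma wedges_det d (L : 'M[F]_d) :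
  wedges (fun i => row i L) (enum [set: 'I_d]) setT = \det L.
Proof.
elim: d L => [|d IH] L.
  rewrite (_ : [set: 'I_0] = set0); last by apply/setP => -[].
  by rewrite wedges0 ffunE eqxx det_mx00.
rewrite enum_setT -enumT enum_ordSl wedges_cons wedge_vec (expand_det_row L ord0) /=.
apply: eq_big => [j|j _]; first by rewrite inE.
rewrite mxE /cofactor add0n.
have -> : [set: 'I_d.+1] :\ j = lift j @: [set: 'I_d].
  apply/setP => i; rewrite !inE andbT; apply/idP/imsetP => [ij|[k _ ->]].
    by case: (unliftP j i) ij => [k -> _|->]; [exists k|rewrite eqxx].
  by rewrite eq_sym neq_lift.
have -> : below j (lift j @: [set: 'I_d]) = j.
  rewrite /below -sum1_card (eq_bigl (fun i : 'I_d.+1 => (i < j)%N)) => [|i].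
    by rewrite -(big_ord_widen _ (fun=> 1%N) (ltnW (ltn_ord j))) sum1_card card_ord.
  rewrite inE; case: (unliftP j i) => [k ->|->]; first by rewrite imset_f ?inE.
  by rewrite ltnn andbF.
have -> : wedges (fun i => row i L) [seq lift ord0 i | i <- enum 'I_d] =
    wedges (fun i => row i (row' ord0 L)) (enum 'I_d).
  rewrite /wedges big_map; apply: eq_bigr => i _; congr ext_vec.
  by apply/rowP => k; rewrite !mxE.
rewrite wedges_col' (_ : enum 'I_d = enum [set: 'I_d]); last by rewrite enum_setT enumT.
rewrite (_ : (fun i => row i (col' j (row' ord0 L))) = (fun i => row i (row' ord0 (col' j L)))).
  by rewrite IH; ring.
by apply/funext => i; apply/rowP => k; rewrite !mxE.
Qed.

(** In top degree the only basis multivector is the wedge of all rows of L. *)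
Lemma ext_map_top d (L : 'M[F]_d) (a : ext d) : ext_homogeneous d a ->
  ext_map L a setT = \det L * a setT.
Proof.
move=> ad; rewrite ext_mapE sum_ffunE (bigD1 setT) //= big1 => [|S ST].
  by rewrite addr0 ffunE wedges_det mulrC.
rewrite ffunE ad ?mul0r //; apply: contraNneq ST => Sd.
by apply/eqP/setP/subset_cardP; rewrite ?cardsT ?card_ord // subsetT.
Qed.

End Exterior.

(** * Contact resolutions *)

Section Resolutions.
Variable R : realType.
Notation K := (C R).

Lemma jacobian_Jmx n m (F : 'rV[K]_n -> 'rV[K]_m) x : jacobian F x = Jmx F x.
Proof. by apply/matrixP => i j; rewrite !mxE DE. Qed.

Lemma nbhs_open_ball (V : normedModType K) (U : set V) x : open U -> U x ->
  exists2 e : R, 0 < e & forall y, rn (y - x) < e -> U y.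
Proof.
rewrite openE => Uo /Uo/nbhs_rn[e e0 eU]; exists e => // y; rewrite rnB; exact: eU.
Qed.

Lemma ball_nbhs (V : normedModType K) (x : V) (e : R) : 0 < e ->
  nbhs x [set y | rn (y - x) < e].
Proof. by move=> e0; apply/nbhs_rn; exists e => // y; rewrite rnB. Qed.

Section Charts.
Variables (T U : topologicalType) (d e : nat) (c : chart R T d) (c' : chart R U e).
Variable f : T -> U.

Lemma chart_map_near x (A : set 'rV[K]_d) : chart_dom c x -> nbhs (chart_map c x) A ->
  nbhs x [set x' | chart_dom c x' /\ A (chart_map c x')].
Proof.
move=> xc Ax; have := @chart_map_continuous R T d c.
rewrite continuous_open_subspace; last exact: chart_dom_open.
move=> /(_ x); rewrite inE => /(_ xc) mc.
have h1 : nbhs x (chart_dom c) by apply: open_nbhs_nbhs; split=> //; exact: chart_dom_open.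
exact: filterI h1 (mc _ Ax).
Qed.

Lemma chart_inv_near y (A : set T) : chart_cod c y -> nbhs (chart_inv c y) A ->
  nbhs y [set y' | chart_cod c y' /\ A (chart_inv c y')].
Proof.
move=> yc Ay; have := @chart_inv_continuous R T d c.
rewrite continuous_open_subspace; last exact: chart_cod_open.
move=> /(_ y); rewrite inE => /(_ yc) mc.
have h1 : nbhs y (chart_cod c) by apply: open_nbhs_nbhs; split=> //; exact: chart_cod_open.
exact: filterI h1 (mc _ Ay).
Qed.

Lemma local_dom_ball y : continuous f -> local_dom c c' f y ->
  exists2 r : R, 0 < r & forall z, rn (z - y) < r -> local_dom c c' f z.
Proof.
move=> fc [yc fy]; have h1 : nbhs (chart_inv c y) (f @^-1` chart_dom c').
  by apply: fc; apply: open_nbhs_nbhs; split=> //; exact: chart_dom_open.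
have /nbhs_rn[r r0 rP] := chart_inv_near yc h1.
by exists r => // z; rewrite rnB => /rP.
Qed.

End Charts.

(** By homogeneity, the only coefficient of E /\ pi ^ n that can be nonzero,
    where d = 2 n + 1. *)
Definition top_field d (N : jacobi_manifold R d) (c : chart R N d) (y : 'rV[K]_d) : K :=
  wedge (Defs.comp (jacobi_E N) c y) (ext_pow (Defs.comp (jacobi_pi N) c y) d./2) finset.setT.

Section TopField.
Variables (d : nat) (N : jacobi_manifold R d).
Hypothesis d_odd : odd d.

Lemma top_homogeneous (c : chart R N d) y : atlas c -> chart_cod c y ->
  ext_homogeneous d (wedge (Defs.comp (jacobi_E N) c y) (ext_pow (Defs.comp (jacobi_pi N) c y) d./2)).
Proof.
move=> cA cy; have dE : d = (1 + d./2 * 2)%N.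
  by rewrite muln2 -{1}(odd_double_half d) d_odd.
rewrite [X in ext_homogeneous X](dE); apply: ext_homogeneousM.
  exact: comp_homogeneous.
by apply: ext_homogeneousX; exact: comp_homogeneous.
Qed.

Lemma dif_wedge (V : normedModType K) (a b : V -> extalg K d) x :
  (forall S, dif (fun z => a z S : K) x) -> (forall S, dif (fun z => b z S : K) x) ->
  forall S, dif (fun z => wedge (a z) (b z) S : K) x.
Proof.
move=> ad bd S.
have -> : (fun z => wedge (a z) (b z) S : K) = (fun z => \sum_(A : {set 'I_d} | A \subset S)
    (-1) ^+ inversions A (S :\: A)%SET * a z A * b z (S :\: A)%SET).
  by apply/funext => z; rewrite ffunE.
apply: dif_sum => A; apply: (proj1 (difM _ (bd _))).
exact: (proj1 (difM (proj1 (dif_cst _ _)) (ad _))).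
Qed.

Lemma dif_top_field (c : chart R N d) y : atlas c -> chart_cod c y -> dif (top_field c) y.
Proof.
move=> cA cy; have compd k (X : mvfield N k) S : dif (fun z => Defs.comp X c z S : K) y.
  by split; exact: comp_holomorphic.
apply: dif_wedge => S; first exact: compd.
elim: (d./2) S => [|n IH] S; first exact: (proj1 (dif_cst _ _)).
by apply: dif_wedge => S' //; exact: compd.
Qed.

End TopField.

Lemma top_field_map d (M N : jacobi_manifold R d) (c : chart R M d) (c' : chart R N d)
    (L : 'M[K]_d) y z : odd d -> atlas c -> chart_cod c y ->
  ext_map L (Defs.comp (jacobi_pi M) c y) = Defs.comp (jacobi_pi N) c' z ->
  ext_map L (Defs.comp (jacobi_E M) c y) = Defs.comp (jacobi_E N) c' z ->
  top_field c' z = \det L * top_field c y.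
Proof.
move=> od cA cy piE EE; rewrite /top_field -piE -EE -ext_map_pow -ext_mapM.
by apply: ext_map_top; exact: top_homogeneous.
Qed.

(** The transition between charts multiplies the top coefficient by a
    determinant, so a zero in one chart is a zero in all charts. *)
Lemma singularP d (N : jacobi_manifold R d) (c : chart R N d) x : odd d -> atlas c ->
  chart_dom c x -> @singular_locus R d N x <-> top_field c (chart_map c x) = 0.
Proof.
move=> od cA cx; split=> [sx|tx c' c'A c'x].
  by rewrite /top_field sx // ffunE.
apply: top_eq0; first by apply: top_homogeneous => //; exact: chart_map_cod.
have yd : local_dom c c' id (chart_map c x).
  by split; [exact: chart_map_cod|rewrite chart_mapK].
have zE : local_map c c' id (chart_map c x) = chart_map c' x.
  by rewrite /local_map /= chart_mapK.
have cy := chart_map_cod cx.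
have := top_field_map (c' := c') (z := chart_map c' x) od cA cy.
rewrite tx => /(_ (jacobian (local_map c c' id) (chart_map c x))).
by rewrite mulr0 -zE; apply; rewrite comp_transition.
Qed.

(** A point z close to y with h z != 0 gives the direction: a zero of infinite
    order at y on the line through z would propagate to z. *)
Lemma nonzero_direction n (h : 'rV[K]_n -> K) y (e : R) : 0 < e -> dif_on y e h ->
  (forall d : R, 0 < d -> exists2 z, rn (z - y) < d & h z != 0) ->
  exists v, forall d : R, 0 < d -> exists2 t : K, rn t < d & h (y + t *: v) != 0.
Proof.
move=> e0 hd hn; have [r' r'0 [M hM']] := locally_bounded e0 hd.
pose r : R := Num.min e r'; have r0 : 0 < r by rewrite lt_min e0.
have hdr : dif_on y r h by move=> z; rewrite lt_min => /andP[/hd].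
have hM z : rn (z - y) < r -> rn (h z) <= M by rewrite lt_min => /andP[_ /hM'].
have C0 := Cq_gt0 R; have s0 : 0 < r / (2 * Cq R) by rewrite divr_gt0 // mulr_gt0.
have [z zy hz] := hn _ s0; exists (z - y) => d d0; apply: contrapT => H.
have H0 (t : K) : rn t < d -> h (y + t *: (z - y)) = 0.
  by move=> td; apply: contrapT => /eqP ht; apply: H; exists t.
have [vy|v0] := eqVneq (z - y) 0.
  have := H0 0; rewrite rn0 scale0r addr0 => /(_ d0) hy.
  by move/eqP: hz; apply; rewrite -(subrK y z) vy add0r.
have v1 : 0 < rn (z - y) by rewrite rn_gt0.
have q0 : 0 < r / rn (z - y) by rewrite divr_gt0.
have inb (t : K) : rn (t - 0) < r / rn (z - y) -> rn (y + t *: (z - y) - y) < r.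
  exact: line_in.
have ud : dif_on (0 : K) (r / rn (z - y)) (fun t : K => h (y + t *: (z - y))).
  by move=> t /inb/hdr ht; exact: (proj1 (dif_line ht)).
have uM (t : K) : rn (t - 0) < r / rn (z - y) -> rn (h (y + t *: (z - y))) <= M.
  by move=> /inb/hM.
have [[k [g [gd g0 gE]]]|H1] := dif_order q0 ud uM; last first.
  have /eqP : h (y + 1 *: (z - y)) = 0.
    apply: H1; rewrite subr0 rn1 ler_pdivlMr ?mulr_gt0 // mul1r ler_pdivlMr //.
    by move: zy; rewrite ltr_pdivlMr ?mulr_gt0 // mulrC => /ltW.
  by rewrite scale1r addrC subrK (negPf hz).
have z00 : rn (0 - 0 : K) < r / rn (z - y) by rewrite subrr rn0.
have [d1 d10 dP] := dif_neq0 (gd 0 z00) g0.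
have m0 : 0 < Num.min d d1 / 2 by rewrite divr_gt0 // lt_min d0.
have m1 : Num.min d d1 / 2 < Num.min d d1 by lra.
pose t : K := RtoC (Num.min d d1 / 2).
have tm : rn t = Num.min d d1 / 2 by rewrite /t rn_real gtr0_norm.
have := m1; rewrite -tm lt_min => /andP[td td1].
have /eqP := H0 t td; rewrite gE subr0 mulf_eq0 expf_eq0.
have t0 : t != 0 by rewrite -rn_gt0 tm.
by rewrite (negPf t0) andbF /= (negPf (dP t _)) // subr0.
Qed.

Section Contradiction.
Variables (m : nat) (M S : jacobi_manifold R m.+1) (f : S -> M).
Hypothesis d_odd : odd m.+1.
Hypothesis fmor : jacobi_morphism f.
Hypothesis fsur : forall x, exists s, f s = x.
Hypothesis Scontact : forall s : S, ~ singular_locus s.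
Hypothesis fsemi : semi_connected f.

Let fcont : continuous f.
Proof. by have [[]] := fmor. Qed.

Let flocal c c' y : atlas c -> atlas c' -> local_dom c c' f y -> dif (local_map c c' f) y.
Proof. by have [[_ H] _ _] := fmor; split; exact: H. Qed.

Let ftop c c' y : atlas c -> atlas c' -> local_dom c c' f y ->
  top_field c' (local_map c c' f y) = \det (Jmx (local_map c c' f) y) * top_field c y.
Proof.
move=> cA c'A yd; have [_ pipi EE] := fmor; rewrite -jacobian_Jmx.
apply: top_field_map => //; first exact: yd.1.
  exact: pipi.
exact: EE.
Qed.

Let Z : set S := [set s | nbhs s [set s' | singular_locus (f s')]].

Let gdif c c' y : atlas c -> atlas c' -> local_dom c c' f y ->
  dif (fun z => top_field c' (local_map c c' f z)) y.
Proof.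
move=> cA c'A yd; apply: (proj1 (dif_comp (flocal cA c'A yd) _)).
by apply: dif_top_field => //; apply: chart_map_cod; exact: yd.2.
Qed.

Let singular_local c c' z : atlas c -> atlas c' -> local_dom c c' f z ->
  singular_locus (f (chart_inv c z)) <-> top_field c' (local_map c c' f z) = 0.
Proof. by move=> cA c'A [_ zd]; exact: singularP. Qed.

(** In charts, the points of [Z] are those where the top coefficient composed
    with f is flat. *)
Let Z_closed : closed Z.
Proof.
move=> s Zs; have [c cA cs] := atlas_cover s; have [c' c'A c's] := atlas_cover (f s).
pose y := chart_map c s.
have yd : local_dom c c' f y by split; [exact: chart_map_cod|rewrite chart_mapK].
have [r r0 rP] := local_dom_ball fcont yd.
pose g z := top_field c' (local_map c c' f z).
have gd : dif_on y r g by move=> z /rP; exact: gdif.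
have gfl : flat g y.
  apply: (flat_closed r0 gd) => e e0; have m0 : 0 < Num.min e r by rewrite lt_min e0.
  have [s' [Zs' [s'c]]] := Zs _ (chart_map_near cs (ball_nbhs _ m0)).
  rewrite /= lt_min => /andP[s'e s'r]; exists (chart_map c s') => //.
  have yc' := chart_map_cod s'c; have := Zs'; rewrite /Z /= -{1}(chart_mapK s'c).
  move=> /(chart_inv_near yc')/nbhs_rn[e1 e10 eP].
  have [e2 e20 eP2] := ball_sub s'r.
  apply: (@near_flat R m.+1 (chart_map c s') (Num.min e1 e2)); first by rewrite lt_min e10.
  move=> z; rewrite lt_min => /andP[ze1 /eP2/rP zd].
  apply/(singular_local cA c'A zd); have := eP z; rewrite rnB => /(_ ze1)[_]; exact.
have [e e0 eP] := flat_near r0 gd gfl.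
have m0 : 0 < Num.min e r by rewrite lt_min e0.
apply: filterS (chart_map_near cs (ball_nbhs _ m0)) => s' [s'c /=].
rewrite lt_min => /andP[s'e s'r]; rewrite -(chart_mapK s'c).
by apply/(singular_local cA c'A (rP _ s'r)); exact: eP.
Qed.

(** Being open and closed, [Z] contains the connected component of each of its
    points. *)
Let Z_empty s : ~ Z s.
Proof.
move=> Zs; apply: (fsemi (s := s)) => _ [s' s'C <-].
have Zopen : open Z by exact: open_interior.
have C1 : connected_component setT s `&` Z = connected_component setT s.
  apply: component_connected; [exists s|exists Z|exists Z] => //.
  by split=> //; exact: connected_component_refl.
by move: s'C; rewrite -C1 => -[_ /nbhs_singleton].
Qed.

Variables (x0 : M) (c' : chart R M m.+1).
Hypotheses (c'A : atlas c') (x0c : chart_dom c' x0) (x0s : singular_locus x0).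

Let h := top_field c'.

Let hd z : chart_cod c' z -> exists2 r : R, 0 < r & dif_on z r h.
Proof.
move=> zc; have [r r0 rP] := nbhs_open_ball (@chart_cod_open R _ _ c') zc.
by exists r => // w /rP; exact: dif_top_field.
Qed.

Let hn0 c y (e : R) : atlas c -> local_dom c c' f y -> 0 < e ->
  exists2 z, rn (z - y) < e & h (local_map c c' f z) != 0.
Proof.
move=> cA yd e0; apply: contrapT => H; apply: (@Z_empty (chart_inv c y)).
have [r r0 rP] := local_dom_ball fcont yd.
have m0 : 0 < Num.min e r by rewrite lt_min e0.
have yc := chart_inv_dom yd.1; rewrite /Z /=.
have := chart_map_near yc (ball_nbhs _ m0); apply: filterS => s' [s'c] /=.
rewrite (chart_invK yd.1) lt_min => /andP[s'e s'r]; rewrite -(chart_mapK s'c).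
apply/(singular_local cA c'A (rP _ s'r)); apply: contrapT => /eqP hz; apply: H.
by exists (chart_map c s').
Qed.

(** Near a point of S this is [degenerate_meagre], for a chart of S in which
    the top coefficient does not vanish at the point; as S is second countable,
    countably many such neighbourhoods suffice. *)
Let zeros_meagre (v : 'rV[K]_m.+1) (l : 'cV[K]_m.+1) (P : 'M[K]_(m.+1, m))
    (Q : 'M[K]_(m, m.+1)) :
  l *m v + P *m Q = 1%:M -> \det (col_mx v Q : 'M[K]_(1 + m)) != 0 ->
  meagre ((fun s => chart_map c' (f s) *m P) @`
    [set s | chart_dom c' (f s) /\ h (chart_map c' (f s)) = 0]).
Proof.
move=> lvPQ B0; have [U UP] := second_countable_family (@manifold_second_countable R _ S).
apply: (@meagre_local R S _ nat U (fun s N => nbhs s N)) => [|s [sc' hs]].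
  by move=> s N /UP[k Uk UN]; exists k.
have [c [cA [cs ks]]] : exists c, atlas c /\ chart_dom c s /\ top_field c (chart_map c s) != 0.
  apply: contrapT => H; apply: (Scontact (s := s)) => c cA cs.
  apply: top_eq0; first by apply: top_homogeneous => //; exact: chart_map_cod.
  by apply: contrapT => /eqP hc; apply: H; exists c.
pose y := chart_map c s; have ycod := chart_map_cod cs.
have yd : local_dom c c' f y by split; [exact: chart_map_cod|rewrite chart_mapK].
have [r1 r10 rP1] := local_dom_ball fcont yd.
have [r2 r20 rP2] := dif_neq0 (dif_top_field cA ycod) ks.
pose r : R := Num.min r1 r2; have r0 : 0 < r by rewrite lt_min r10.
have rld z : rn (z - y) < r -> local_dom c c' f z by rewrite lt_min => /andP[/rP1].
have rk z : rn (z - y) < r -> top_field c z != 0 by rewrite lt_min => /andP[_ /rP2].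
exists [set s' | chart_dom c s' /\ rn (chart_map c s' - y) < r].
  exact: chart_map_near cs (ball_nbhs _ r0).
apply: sub_meagre (_ : meagre ((fun z => local_map c c' f z *m P) @`
    [set z | rn (z - y) < r /\ h (local_map c c' f z) = 0])).
  move=> _ [s' [[s'c' hs'] [s'c s'r]] <-]; exists (chart_map c s').
    split; first exact: s'r.
    by rewrite /local_map /= chart_mapK.
  by rewrite /local_map /= chart_mapK.
apply: (@degenerate_meagre R m (local_map c c' f) h (top_field c) y v r l P Q) => //.
- by move=> z /rld; exact: flocal.
- by move=> z /rld[zc _]; exact: dif_top_field.
- by move=> z /rld[_ zd]; apply: hd; exact: chart_map_cod.
- by move=> z /rld zd; exact: ftop.
- by move=> z d /rld zd; exact: hn0.
Qed.

(** By [hurwitz] the projection of the singular locus along v contains a ball,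
    all of whose points come from S. *)
Lemma resolution_absurd : False.
Proof.
pose y0 := chart_map c' x0; have y0c : chart_cod c' y0 := chart_map_cod x0c.
have [e e0 eP] := nbhs_open_ball (@chart_cod_open R _ _ c') y0c.
have hde : dif_on y0 e h by move=> z /eP; exact: dif_top_field.
have hy0 : h y0 = 0 by apply/(singularP d_odd c'A x0c).
have hn (d : R) : 0 < d -> exists2 w, rn (w - y0) < d & h w != 0.
  move=> d0; apply: contrapT => H; have [s0 sE] := fsur x0; apply: (@Z_empty s0).
  have : nbhs (f s0) [set x | chart_dom c' x /\ rn (chart_map c' x - y0) < d].
    by rewrite sE; exact: chart_map_near x0c (ball_nbhs _ d0).
  move=> /fcont; apply: filterS => s' [s'c s'd].
  apply/(singularP d_odd c'A s'c); apply: contrapT => /eqP hz; apply: H.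
  by exists (chart_map c' s').
have [v vP] := nonzero_direction e0 hde hn.
have v0 : v != 0.
  have [t _] := vP 1 ltr01; apply: contraNneq => ->; rewrite scaler0 addr0.
  by rewrite hy0.
have [l [P [Q [vP0 QP lvPQ B0]]]] := projection_along v0.
have [d d0 dP] := hurwitz e0 hde hy0 vP.
have [A A0 AQ] := mulmx_bounded Q.
have dA : 0 < d / A by rewrite divr_gt0.
have [u ud nu] := baire_rV (y0 *m P) (zeros_meagre lvPQ B0) dA.
(* the line through y0 + w is the one that P maps to u *)
pose w := (u - y0 *m P) *m Q.
have wd : rn w < d.
  by apply: le_lt_trans (AQ _) _; rewrite mulrC -ltr_pdivlMr.
have [t [ze hz]] := dP w wd; set z := y0 + w + t *: v in ze hz.
have zc := eP z ze; have [s sE] := fsur (chart_inv c' z).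
apply: nu; exists s.
  by rewrite /= sE; split; [exact: chart_inv_dom|rewrite chart_invK].
rewrite sE chart_invK // !mulmxDl -scalemxAl vP0 scaler0 addr0.
by rewrite /w -mulmxA QP mulmx1 addrC subrK.
Qed.

End Contradiction.
End Resolutions.


Theorem theorem4p4 (R : realType) (d : nat) (M : jacobi_manifold R d)
    (hM : ~ contact_manifold M) :
  ~ exists (S : jacobi_manifold R d) (f : S -> M),
      contact_resolution f /\ semi_connected f.
Proof.
move=> [S [f [[[od Sc] fmor fsur] fsemi]]].
have [x0 x0s] : exists x : M, singular_locus x.
  by apply: contrapT => H; apply: hM; split=> // x xs; apply: H; exists x.
have [c' c'A x0c] := atlas_cover x0.
case: d => [|m] in M hM S f od Sc fmor fsur fsemi x0 x0s c' c'A x0c *; first by [].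
exact: (resolution_absurd od fmor fsur Sc fsemi c'A x0c x0s).
Qed.
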